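(* Let $G$ be a set and $A=(A(i,j))_{i,j\in G}$ a matrix with entries in $\{0,1\}$. Let $\widetilde{O_A}$ be the universal unital C*-algebra generated by partial isometries $\{S_x\}_{x\in G}$ as described in the context, and let $\mathcal{O}(\widetilde{\Omega_A},\alpha,L)$ be the crossed product by a partial endomorphism induced by the local homeomorphism $\sigma:U\to\widetilde{\Omega_A}$. Then the unital *-homomorphism $\psi:\widetilde{O_A}\to\mathcal{O}(\widetilde{\Omega_A},\alpha,L)$ determined by $\psi(S_x)=\widetilde{1_x}$ for all $x\in G$ is a *-isomorphism.
   Context: For finite $X,Y\subseteq G$ and $j\in G$ put $A(X,Y,j)=\prod_{x\in X}A(x,j)\prod_{y\in Y}(1-A(y,j))$. $\widetilde{O_A}$ is the universal unital C*-algebra generated by partial isometries $\{S_x\}_{x\in G}$ with relations: (1) $S_i^*S_i$ and $S_j^*S_j$ commute; (2) $S_i^*S_j=0$ for $i\ne j$; (3) $S_i^*S_iS_j=A(i,j)S_j$; (4) $\prod_{x\in X}S_x^*S_x\prod_{y\in Y}(1-S_y^*S_y)=\sum_{j\in G}A(X,Y,j)S_jS_j^*$ whenever $X,Y\subseteq G$ are finite and $A(X,Y,j)\neq0$ for only finitely many $j\in G$. Let $\mathbb{F}$ be the free group on $G$ with unit $e$, $|t|$ the reduced word length, and $\Omega_e=\{\xi\subseteq\mathbb{F}: e\in\xi\}$, a compact subspace of $\{0,1\}^{\mathbb{F}}$ (product topology). For $t\in\mathbb{F}$ let $1_t$ be the characteristic function of $\{\xi\in\Omega_e: t\in\xi\}$.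 Let $R_A\subseteq C(\Omega_e)$ consist of the functions: $1_x1_y$ for $x\ne y$ in $G$; $1_{x^{-1}}1_y-A(x,y)1_y$ for $x,y\in G$; $1_{ts}1_t-1_{ts}$ for $t,s\in\mathbb{F}$ with $|ts|=|t|+|s|$; $\prod_{x\in X}1_{x^{-1}}\prod_{y\in Y}(1-1_{y^{-1}})-\sum_{j\in G}A(X,Y,j)1_j$ for finite $X,Y\subseteq G$ with $A(X,Y,j)\ne0$ for only finitely many $j$. Put $\widetilde{\Omega_A}=\{\xi\in\Omega_e: f(t^{-1}\xi)=0\ \forall t\in\xi,\ f\in R_A\}$ (compact Hausdorff), $\Delta_x=\{\xi\in\widetilde{\Omega_A}: x\in\xi\}$, and $U=\bigcup_{x\in G}\Delta_x$, an open subset. Each $\xi\in U$ contains a unique $x\in G$, and $\sigma:U\to\widetilde{\Omega_A}$, $\sigma(\xi)=x^{-1}\xi$ for that $x$, is a local homeomorphism. $1_x$ (restricted to $\widetilde{\Omega_A}$) is the characteristic function of the clopen set $\Delta_x$, so $1_x\in C_c(U)$. General construction for a compact Hausdorff space $X$ (here $X=\widetilde{\Omega_A}$), an open $U\subseteq X$, and a local homeomorphism $\sigma:U\to X$: $C_c(U)$ is the set of $f\in C(X)$ whose support (closure in $X$) lies in $U$; $\alpha(f)=f\circ\sigma\in C^b(U)$ for $f\in C(X)$, and $g\alpha(f)\in C_c(U)$ for $g\in C_c(U)$; $L:C_c(U)\to C(X)$, $L(f)(x)=\sum_{y\in U,\ \sigma(y)=x}f(y)$ (finitely many nonzero terms).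 $M$ is the right Hilbert $C(X)$-module obtained by completing $C_c(U)$ (modulo $\{f:L(f^*f)=0\}$) with $f\cdot a=f\alpha(a)$ and $\langle f,g\rangle=L(f^*g)$; $\widetilde f\in M$ is the class of $f$; the left action is $a\widetilde f=\widetilde{af}$, giving $\varphi:C(X)\to\mathcal{L}(M)$. $\mathcal{T}(X,\alpha,L)$ is the universal C*-algebra generated by $C(X)\cup M$ subject to the relations of $C(X)$, the linear relations of $M$, the bimodule products and $m^*n=\langle m,n\rangle$. $\widehat{K_1}$ is its closed subalgebra generated by all $mn^*$; a redundancy is $(a,k)\in C(X)\times\widehat{K_1}$ with $am=km$ for all $m\in M$; $I_0=\ker(\varphi)^\perp\cap\varphi^{-1}(K(M))$ with $K(M)$ the compact operators and $\ker(\varphi)^\perp=\{a:ab=0\ \forall b\in\ker\varphi\}$. $\mathcal{O}(X,\alpha,L)$ is the quotient of $\mathcal{T}(X,\alpha,L)$ by the closed ideal generated by all $a-k$ with $(a,k)$ a redundancy and $a\in I_0$; elements of $C(X)$ and $M$ are identified with their images in it. *)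

(* Defs.v *)
From HB Require Import structures.
From mathcomp Require Import all_boot all_order all_algebra finmap.
From mathcomp Require Import complex ring.
From mathcomp Require Import all_classical all_reals.
From mathcomp Require Import topology function_spaces normedtype.
Import numFieldNormedType.Exports.

Set Implicit Arguments.
Unset Strict Implicit.
Unset Printing Implicit Defensive.

Import Order.TTheory GRing.Theory Num.Theory.
Local Open Scope classical_set_scope.
Local Open Scope complex_scope.
Local Open Scope ring_scope.

HB.instance Definition _ (R : realType) := NormedModule.copy R[i] R[i]^o.

Lemma complex_complete (R : realType) (F : set_system R[i]) :
  ProperFilter F -> cauchy F -> cvg F.
Proof.
move=> FF /cauchyP Fc.
have part (p : R[i] -> R) : (forall x y, `|p x - p y|%:C <= `|x - y|) ->
    cvg (p @ F).
  move=> hp; apply: cauchy_cvg; apply/cauchyP => e e0.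
  have e0C : 0 < e%:C by rewrite ltcR.
  have [z Fz] := Fc _ e0C; exists (p z) => /=.
  apply: filterS Fz => y /=; rewrite -!ball_normE /= => xy.
  by rewrite -ltcR; exact: le_lt_trans (hp _ _) xy.
have cRe : cvg (@complex.Re R @ F).
  by apply: part => x y; rewrite -raddfB; exact: normc_ge_Re.
have cIm : cvg (@complex.Im R @ F).
  have imle (z : R[i]) : `|complex.Im z|%:C <= `|z|.
    rewrite -[leRHS]mulr1 -(normCi R[i]) -complexiE -normrM.
    by rewrite (le_trans _ (normc_ge_Re _))// ReiNIm normrN.
  by apply: part => x y; rewrite -raddfB; exact: imle.
apply/cvg_ex; exists (lim (@complex.Re R @ F) +i* lim (@complex.Im R @ F)).
apply/cvgrPdist_lt => e e0.
have /complex_realP[r re] : e \is Num.real by exact: gtr0_real.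
have r0 : 0 < r by rewrite -ltcR -re.
have r20 : 0 < r / 2 by rewrite divr_gt0.
have split_sub (a b : R) z : a +i* b - z =
    (a - complex.Re z)%:C + 'i%C * (b - complex.Im z)%:C.
  by case: z => c d; simpc.
near=> z.
rewrite re split_sub (le_lt_trans (ler_normD _ _))// normrM.
have -> : `|'i%C : R[i]| = 1 by rewrite complexiE normCi.
rewrite mul1r !normc_def /= !expr0n /= !addr0 !sqrtr_sqr -raddfD /= ltcR.
rewrite [ltRHS](splitr r) ltrD//.
- by near: z; move/cvgrPdist_lt : cRe; apply.
- by near: z; move/cvgrPdist_lt : cIm; apply.
Unshelve. all: by end_near. Qed.

HB.instance Definition _ (R : realType) :=
  Uniform_isComplete.Build R[i] (@complex_complete R).

(* The product of the multiplicative structures of monoid.v, kept apart from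
   the ring product so that both can be used without scope switching. *)
Notation "a ** b" := (monoid.mul a b) (at level 40, left associativity).

(* The algebras need not be unital, and the zero algebra is not excluded (it is
   the universal algebra below when G is empty); hence a semigroup rather than
   a ring. *)
HB.mixin Record isCStarAlgebra (R : realType) A
    & CompleteNormedModule R[i] A & Semigroup A := {
  star : A -> A;
  cmulDl : forall a b c : A, (a + b) ** c = a ** c + b ** c;
  cmulDr : forall a b c : A, a ** (b + c) = a ** b + a ** c;
  cscaleAl : forall (k : R[i]) (a b : A), (k *: a) ** b = k *: (a ** b);
  cscaleAr : forall (k : R[i]) (a b : A), a ** (k *: b) = k *: (a ** b);
  starK : forall a : A, star (star a) = a;
  starD : forall a b : A, star (a + b) = star a + star b;
  starZ : forall (k : R[i]) (a : A), star (k *: a) = k^* *: star a;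
  starM : forall a b : A, star (a ** b) = star b ** star a;
  cnormM : forall a b : A, `|a ** b| <= `|a| * `|b|;
  cnorm_star : forall a : A, `|star a ** a| = `|a| ^+ 2
}.

#[short(type="cstarAlgType")]
HB.structure Definition CStarAlgebra (R : realType) :=
  {A of isCStarAlgebra R A & CompleteNormedModule R[i] A & Semigroup A}.

#[short(type="unitalCStarAlgType")]
HB.structure Definition UnitalCStarAlgebra (R : realType) :=
  {A of CStarAlgebra R A & Monoid A}.

Definition star_hom (R : realType) (A B : cstarAlgType R) (f : A -> B) : Prop :=
  [/\ forall (k : R[i]) (a b : A), f (k *: a + b) = k *: f a + f b,
      forall a b : A, f (a ** b) = f a ** f b
    & forall a : A, f (star a) = star (f a)].

Definition is_identity (R : realType) (A : cstarAlgType R) (e : A) : Prop :=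
  forall a : A, e ** a = a /\ a ** e = a.

(* The target need not come with a chosen unit: the image of 1 must be one. *)
Definition unital_star_hom (R : realType) (A : unitalCStarAlgType R)
    (B : cstarAlgType R) (f : A -> B) : Prop :=
  star_hom f /\ is_identity (f 1%g).

Definition star_isomorphism (R : realType) (A B : cstarAlgType R) (f : A -> B) :
    Prop :=
  star_hom f /\ bijective f.

Definition closed_subalgebra (R : realType) (A : cstarAlgType R)
    (B : set A) : Prop :=
  [/\ closed B, B 0,
      forall (k : R[i]) a b, B a -> B b -> B (k *: a + b)
    & forall a b, B a -> B b -> B (a ** b)].

Definition closed_ideal (R : realType) (A : cstarAlgType R)
    (J : set A) : Prop :=
  [/\ closed J, J 0,
      forall (k : R[i]) a b, J a -> J b -> J (k *: a + b)
    & forall a b, J b -> J (a ** b) /\ J (b ** a)].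

Definition is_quotient (R : realType) (A B : cstarAlgType R) (J : set A)
    (q : A -> B) : Prop :=
  [/\ star_hom q, forall b, exists a, q a = b & forall a, q a = 0 <-> J a].

HB.mixin Record isCompactHausdorff X & Topological X := {
  compactT : compact [set: X];
  hausdorffT : hausdorff_space X
}.

#[short(type="compactHausdorffType")]
HB.structure Definition CompactHausdorff :=
  {X of isCompactHausdorff X & Topological X}.

Definition cfun (R : realType) (X : compactHausdorffType) : Type :=
  continuousType X R[i].

HB.instance Definition _ R X := Choice.on (cfun R X).

Section Cfun.
Variables (R : realType) (X : compactHausdorffType).
Implicit Types (f g h : cfun R X) (k : R[i]).

Definition cfun_apply (f : cfun R X) : X -> R[i] := f.
Coercion cfun_apply : cfun >-> Funclass.

Lemma cfunP f g : (forall x, f x = g x) -> f = g.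
Proof. by move=> fg; apply/continuousEP. Qed.

Lemma cfun_cont f : continuous (f : X -> R[i]).
Proof. exact: cts_fun. Qed.

Definition Cfun (u : X -> R[i]) (cu : continuous u) : cfun R X :=
  (mkcts cu : continuousType X R[i]).

Lemma CfunE u (cu : continuous u) x : Cfun cu x = u x.
Proof. by []. Qed.

Lemma cont_cst k : continuous (fun _ : X => k : R[i]).
Proof. by move=> x; exact: cvg_cst. Qed.

Lemma cont_add f g : continuous (fun x => f x + g x).
Proof. by move=> x; apply: cvgD; exact: cfun_cont. Qed.

Lemma cont_opp f : continuous (fun x => - f x).
Proof. by move=> x; apply: cvgN; exact: cfun_cont. Qed.

Lemma cont_scale k f : continuous (fun x => k * f x).
Proof. by move=> x; apply: cvgM; [exact: cvg_cst|exact: cfun_cont]. Qed.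

Lemma cont_mul f g : continuous (fun x => f x * g x).
Proof. by move=> x; apply: cvgM; exact: cfun_cont. Qed.

Lemma cont_conj f : continuous (fun x => (f x)^*).
Proof.
move=> x; apply/cvgrPdist_lt => e e0.
have /cvgrPdist_lt/(_ e e0) := @cfun_cont f x.
by apply: filterS => y; rewrite -rmorphB norm_conjC.
Qed.

Definition cfun_zero : cfun R X := Cfun (@cont_cst 0).
Definition cfun_one : cfun R X := Cfun (@cont_cst 1).
Definition cfun_add f g : cfun R X := Cfun (@cont_add f g).
Definition cfun_opp f : cfun R X := Cfun (@cont_opp f).
Definition cfun_scale k f : cfun R X := Cfun (@cont_scale k f).
Definition cfun_mul f g : cfun R X := Cfun (@cont_mul f g).
Definition cfun_star f : cfun R X := Cfun (@cont_conj f).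

Fact cfun_addA : associative cfun_add.
Proof. by move=> f g h; apply: cfunP => x; exact: addrA. Qed.
Fact cfun_addC : commutative cfun_add.
Proof. by move=> f g; apply: cfunP => x; exact: addrC. Qed.
Fact cfun_add0 : left_id cfun_zero cfun_add.
Proof. by move=> f; apply: cfunP => x; exact: add0r. Qed.
Fact cfun_addN : left_inverse cfun_zero cfun_opp cfun_add.
Proof. by move=> f; apply: cfunP => x; exact: addNr. Qed.

HB.instance Definition _ := GRing.isZmodule.Build (cfun R X)
  cfun_addA cfun_addC cfun_add0 cfun_addN.

Fact cfun_scaleA k l f : cfun_scale k (cfun_scale l f) = cfun_scale (k * l) f.
Proof. by apply: cfunP => x; exact: mulrA. Qed.
Fact cfun_scale1 : left_id 1 cfun_scale.
Proof. by move=> f; apply: cfunP => x; exact: mul1r. Qed.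
Fact cfun_scaleDr : right_distributive cfun_scale +%R.
Proof. by move=> k f g; apply: cfunP => x; exact: mulrDr. Qed.
Fact cfun_scaleDl f : {morph cfun_scale^~ f : k l / k + l}.
Proof. by move=> k l; apply: cfunP => x; exact: mulrDl. Qed.

HB.instance Definition _ := GRing.Zmodule_isLmodule.Build R[i] (cfun R X)
  cfun_scaleA cfun_scale1 cfun_scaleDr cfun_scaleDl.

Definition cfun_norm f : R[i] := (sup (range (fun x => complex.Re `|f x|)))%:C.

Lemma normCRe (z : R[i]) : (complex.Re `|z|)%:C = `|z|.
Proof. by rewrite RRe_real ?normr_real. Qed.

Lemma cfun_has_ubound f : has_ubound (range (fun x => complex.Re `|f x|)).
Proof.
pose g x := complex.Re `|f x|.
have gc : continuous (g : X -> R).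
  move=> x; apply/cvgrPdist_lt => e e0.
  have e0C : 0 < e%:C by rewrite ltcR.
  have /cvgrPdist_lt/(_ _ e0C) := @cfun_cont f x.
  apply: filterS => y fxy; rewrite -ltcR (le_lt_trans _ fxy)//.
  rewrite /g -raddfB (le_trans (normc_ge_Re _))//.
  exact: ler_dist_dist.
have := continuous_compact (continuous_subspaceT gc) compactT.
move=> /compact_bounded[M [_ gM]]; exists (M + 1) => _ [x _ <-].
rewrite (le_trans (ler_norm _))//; apply: (gM (M + 1)); first by rewrite ltrDl.
by exists x.
Qed.

Lemma cfun_norm_ge f x : `|f x| <= cfun_norm f.
Proof.
rewrite -normCRe lecR; apply: ub_le_sup; first exact: cfun_has_ubound.
by exists x.
Qed.

Lemma cfun_norm_le f c : 0 <= c -> (forall x, `|f x| <= c) -> cfun_norm f <= c.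
Proof.
move=> c0 fc; have cR : (complex.Re c)%:C = c by rewrite RRe_real ?ger0_real.
rewrite -cR lecR; have [XE|/set0P XN0] :=
  eqVneq (range (fun x => complex.Re `|f x|)) set0.
  by rewrite XE sup0 -lecR cR.
apply: ge_sup => //.
by move=> _ [x _ <-]; rewrite -lecR normCRe cR.
Qed.

Lemma cfun_norm_ge0 f : 0 <= cfun_norm f.
Proof.
rewrite /cfun_norm; have [->|/set0P[_ [x _ _]]] :=
  eqVneq (range (fun x => complex.Re `|f x|)) set0; first by rewrite sup0.
exact: le_trans (normr_ge0 (f x)) (cfun_norm_ge f x).
Qed.

Fact cfun_normD f g : cfun_norm (f + g) <= cfun_norm f + cfun_norm g.
Proof.
apply: cfun_norm_le => [|x]; first by rewrite addr_ge0 ?cfun_norm_ge0.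
by rewrite (le_trans (ler_normD _ _))// lerD ?cfun_norm_ge.
Qed.

Fact cfun_normZ k f : cfun_norm (k *: f) = `|k| * cfun_norm f.
Proof.
have leZ l h : cfun_norm (l *: h) <= `|l| * cfun_norm h.
  apply: cfun_norm_le => [|x]; first by rewrite mulr_ge0 ?cfun_norm_ge0.
  by rewrite [leLHS](normrM l (h x)) ler_wpM2l ?cfun_norm_ge.
apply/le_anti; rewrite leZ /=; have [->|k0] := eqVneq k 0.
  by rewrite normr0 mul0r cfun_norm_ge0.
have := leZ k^-1 (k *: f).
rewrite scalerA mulVf// scale1r normfV.
by rewrite -ler_pdivrMl ?invr_gt0 ?normr_gt0// invrK.
Qed.

Fact cfun_norm0_eq0 f : cfun_norm f = 0 -> f = 0.
Proof.
move=> f0; apply: cfunP => x; apply/eqP; rewrite -normr_le0 -f0.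
exact: cfun_norm_ge.
Qed.

HB.instance Definition _ := Lmodule_isNormed.Build R[i] (cfun R X)
  cfun_normD cfun_normZ cfun_norm0_eq0.

Lemma cfun_complete (F : set_system (cfun R X)) :
  ProperFilter F -> cauchy F -> cvg F.
Proof.
move=> FF /cauchy_ballP Fc.
have Fx x : cvg ((fun f : cfun R X => f x) @ F).
  apply: cauchy_cvg; apply/cauchyP => e e0.
  have /cauchyP/(_ e e0)[f Ff] : cauchy F by apply/cauchy_ballP.
  exists (f x) => /=; apply: filterS Ff => g; rewrite -!ball_normE /=.
  exact: le_lt_trans (cfun_norm_ge (f - g) x).
pose u x := lim ((fun f : cfun R X => f x) @ F).
have Fu (e : R[i]) : 0 < e ->
      \forall f \near F, forall x, `|u x - (f : cfun R X) x| <= e.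
  move=> e0; have e20 : 0 < e / 2 by rewrite divr_gt0.
  near=> f => x.
  have Ff : \forall g \near F, ball f (e / 2) g.
    by near: f; exact: nearP_dep (Fc _ e20).
  near F => g.
  rewrite [leRHS]splitr (le_trans (ler_distD (g x) _ _))// lerD//.
  - by apply: ltW; near: g; move/cvgrPdist_lt : (Fx x); apply.
  - rewrite distrC (le_trans (cfun_norm_ge (f - g) x))// ltW//.
    by near: g; apply: filterS Ff => g; rewrite -ball_normE.
have uc : continuous u.
  move=> x; apply/cvgrPdist_le => e e0.
  have e30 : 0 < e / 3 by rewrite divr_gt0.
  near F => f.
  have uf : forall y, `|u y - f y| <= e / 3 by near: f; exact: Fu.
  have /cvgrPdist_le/(_ _ e30) := @cfun_cont f x.
  apply: filterS => y fxy.
  have -> : e = e / 3 + (e / 3 + e / 3).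
    by field.
  rewrite (le_trans (ler_distD (f x) _ _))// lerD//.
  by rewrite (le_trans (ler_distD (f y) _ _))// lerD// distrC.
apply/cvg_ex; exists (Cfun uc); apply/cvgrPdist_le => e e0.
apply: filterS (Fu e e0) => f uf.
exact: (@cfun_norm_le (Cfun uc - f) e (ltW e0) uf).
Unshelve. all: by end_near. Qed.

HB.instance Definition _ :=
  Uniform_isComplete.Build (cfun R X) cfun_complete.

Fact cfun_mulA : associative cfun_mul.
Proof. by move=> f g h; apply: cfunP => x; exact: mulrA. Qed.
Fact cfun_mul1 : left_id cfun_one cfun_mul.
Proof. by move=> f; apply: cfunP => x; exact: mul1r. Qed.
Fact cfun_mulr1 : right_id cfun_one cfun_mul.
Proof. by move=> f; apply: cfunP => x; exact: mulr1. Qed.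

HB.instance Definition _ := isMonoid.Build (cfun R X)
  cfun_mulA cfun_mul1 cfun_mulr1.

Fact cfun_mulDl f g h : (f + g) ** h = f ** h + g ** h.
Proof. by apply: cfunP => x; exact: mulrDl. Qed.
Fact cfun_mulDr f g h : f ** (g + h) = f ** g + f ** h.
Proof. by apply: cfunP => x; exact: mulrDr. Qed.
Fact cfun_scaleAl k f g : (k *: f) ** g = k *: (f ** g).
Proof. by apply: cfunP => x; rewrite [RHS]mulrA. Qed.
Fact cfun_scaleAr k f g : f ** (k *: g) = k *: (f ** g).
Proof. by apply: cfunP => x; exact: mulrCA. Qed.
Fact cfun_starK f : cfun_star (cfun_star f) = f.
Proof. by apply: cfunP => x; exact: conjCK. Qed.
Fact cfun_starD f g : cfun_star (f + g) = cfun_star f + cfun_star g.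
Proof. by apply: cfunP => x; exact: rmorphD. Qed.
Fact cfun_starZ k f : cfun_star (k *: f) = k^* *: cfun_star f.
Proof. by apply: cfunP => x; exact: rmorphM. Qed.
Fact cfun_starM f g : cfun_star (f ** g) = cfun_star g ** cfun_star f.
Proof. by apply: cfunP => x; rewrite [RHS]mulrC; exact: rmorphM. Qed.
Fact cfun_normM f g : `|f ** g| <= `|f| * `|g|.
Proof.
apply: cfun_norm_le => [|x]; first by rewrite mulr_ge0.
by rewrite [leLHS](normrM (f x) (g x)) ler_pM// cfun_norm_ge.
Qed.
Fact cfun_norm_star f : `|cfun_star f ** f| = `|f| ^+ 2.
Proof.
have nsx x : `|(cfun_star f ** f) x| = `|f x| ^+ 2.
  by rewrite [LHS](normrM (f x)^* (f x)) norm_conjC expr2.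
apply/le_anti/andP; split.
  apply: cfun_norm_le => [|x]; first by rewrite exprn_ge0.
  by rewrite nsx lerXn2r ?nnegrE// cfun_norm_ge.
rewrite -[leRHS](sqrtCK) lerXn2r ?nnegrE ?sqrtC_ge0//.
apply: cfun_norm_le => [|x]; first by rewrite sqrtC_ge0.
rewrite -(@ler_pXn2r _ 2)// ?nnegrE ?sqrtC_ge0// sqrtCK -nsx.
exact: cfun_norm_ge.
Qed.

HB.instance Definition _ := isCStarAlgebra.Build R (cfun R X)
  cfun_mulDl cfun_mulDr cfun_scaleAl cfun_scaleAr cfun_starK cfun_starD
  cfun_starZ cfun_starM cfun_normM cfun_norm_star.

End Cfun.

(* [inner] is linear in its second argument.  Positivity of an element of a
   C*-algebra is being of the form [star b ** b]. *)
HB.mixin Record isHilbertModule (R : realType) (A : cstarAlgType R) M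
    & CompleteNormedModule R[i] M := {
  ract : M -> A -> M;
  inner : M -> M -> A;
  ractDl : forall (m n : M) (a : A), ract (m + n) a = ract m a + ract n a;
  ractDr : forall (m : M) (a b : A), ract m (a + b) = ract m a + ract m b;
  ractZl : forall (k : R[i]) (m : M) (a : A), ract (k *: m) a = k *: ract m a;
  ractZr : forall (k : R[i]) (m : M) (a : A), ract m (k *: a) = k *: ract m a;
  ractM : forall (m : M) (a b : A), ract (ract m a) b = ract m (a ** b);
  innerDr : forall m n p : M, inner m (n + p) = inner m n + inner m p;
  innerZr : forall (k : R[i]) (m n : M), inner m (k *: n) = k *: inner m n;
  inner_ract : forall (m n : M) (a : A), inner m (ract n a) = inner m n ** a;
  inner_star : forall m n : M, star (inner m n) = inner n m;
  inner_pos : forall m : M, exists b : A, inner m m = star b ** b;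
  inner_norm : forall m : M, `|m| ^+ 2 = `|inner m m|
}.

#[short(type="hilbertModType")]
HB.structure Definition HilbertModule (R : realType) (A : cstarAlgType R) :=
  {M of isHilbertModule R A M & CompleteNormedModule R[i] M}.

(* [lact a] is the operator called phi(a): [lactD] to [lact_inner] say that phi
   is a *-homomorphism from A to the adjointable operators of M. *)
HB.mixin Record isCorrespondence (R : realType) (A : cstarAlgType R) M
    & HilbertModule R A M := {
  lact : A -> M -> M;
  lactDr : forall (a : A) (m n : M), lact a (m + n) = lact a m + lact a n;
  lactZr : forall (k : R[i]) (a : A) (m : M), lact a (k *: m) = k *: lact a m;
  lactDl : forall (a b : A) (m : M), lact (a + b) m = lact a m + lact b m;
  lactZl : forall (k : R[i]) (a : A) (m : M), lact (k *: a) m = k *: lact a m;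
  lactM : forall (a b : A) (m : M), lact (a ** b) m = lact a (lact b m);
  lact_inner : forall (a : A) (m n : M),
    inner (lact a m) n = inner m (lact (star a) n)
}.

#[short(type="correspondenceType")]
HB.structure Definition Correspondence (R : realType) (A : cstarAlgType R) :=
  {M of isCorrespondence R A M & HilbertModule R A M}.

Section CuntzPimsner.
Variables (R : realType) (A : cstarAlgType R) (M : correspondenceType A).

Definition rank_one (m n : M) : M -> M := fun p => ract m (inner n p).

(* Membership in K(M), the closed linear span of the [rank_one m n] for the
   operator norm.  Scalars need no separate treatment: they can be absorbed in
   the left vectors. *)
Definition compact_operator (T : M -> M) : Prop :=
  forall e : R[i], 0 < e -> exists s : seq (M * M), forall p : M,
    `|T p - \sum_(mn <- s) rank_one mn.1 mn.2 p| <= e * `|p|.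

Definition lact_kernel : set A := [set a | forall m : M, lact a m = 0].

Definition katsura_ideal : set A :=
  [set a | (forall b, lact_kernel b -> a ** b = 0)
           /\ compact_operator (lact a : M -> M)].

Definition representation (B : cstarAlgType R) (pi : A -> B) (tau : M -> B) :
    Prop :=
  [/\ star_hom pi,
      forall (k : R[i]) (m n : M), tau (k *: m + n) = k *: tau m + tau n,
      forall (a : A) (m : M), tau (lact a m) = pi a ** tau m,
      forall (m : M) (a : A), tau (ract m a) = tau m ** pi a
    & forall m n : M, star (tau m) ** tau n = pi (inner m n)].

Section Toeplitz.
Variables (T : cstarAlgType R) (iA : A -> T) (iM : M -> T).

Definition is_toeplitz : Prop :=
  representation iA iM /\
  forall (B : cstarAlgType R) (pi : A -> B) (tau : M -> B),
    representation pi tau ->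
    exists! rho : T -> B, [/\ star_hom rho,
      forall a, rho (iA a) = pi a & forall m, rho (iM m) = tau m].

Definition K1_hat : set T :=
  smallest (@closed_subalgebra R T)
    [set t | exists m n : M, t = iM m ** star (iM n)].

Definition redundancy (a : A) (k : T) : Prop :=
  K1_hat k /\ forall m : M, iA a ** iM m = k ** iM m.

Definition redundancy_ideal : set T :=
  smallest (@closed_ideal R T)
    [set t | exists a k, [/\ redundancy a k, katsura_ideal a & t = iA a - k]].

End Toeplitz.
End CuntzPimsner.

(* A partial map from the open set U to X is given by a total map, whose values
   outside U are never used. *)
Section Transfer.
Variables (R : realType) (X : compactHausdorffType).
Variables (U : set X) (sigma : X -> X).

Definition Cc : set (X -> R[i]) :=
  [set f | continuous f /\ closure [set x | f x != 0] `<=` U].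

Definition transfer (f : X -> R[i]) (x : X) : R[i] :=
  \sum_(y \in [set y | U y /\ sigma y = x]) f y.

(* [M] is the completion of [Cc] for [<f, g> = L(f^* g)], the class of [f] being
   [cls f] (the values of [cls] outside [Cc] are irrelevant).  That
   [f] and [g] are identified when [L ((f - g)^* (f - g)) = 0] follows from the
   formula for the inner product. *)
Record is_completion (M : correspondenceType (cfun R X))
    (cls : (X -> R[i]) -> M) : Prop := {
  cls_linear : forall (k : R[i]) f g, Cc f -> Cc g ->
    cls (fun x => k * f x + g x) = k *: cls f + cls g;
  cls_inner : forall f g, Cc f -> Cc g -> forall x : X,
    inner (cls f) (cls g) x = transfer (fun y => (f y)^* * g y) x;
  cls_ract : forall f (a : cfun R X), Cc f ->
    ract (cls f) a = cls (fun x => f x * a (sigma x));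
  cls_lact : forall (a : cfun R X) f, Cc f ->
    lact a (cls f) = cls (fun x => a x * f x);
  cls_dense : closure (cls @` Cc) = [set: M]
}.

End Transfer.

Section FreeGroup.
Variable G : choiceType.

(* [(x, true)] stands for x and [(x, false)] for its inverse. *)
Definition letter : Type := (G * bool)%type.
Definition flip (a : letter) : letter := (a.1, ~~ a.2).
Definition reduced (w : seq letter) : bool := sorted (fun a b => b != flip a) w.

Record free_group : Type := FreeGroup {
  word :> seq letter;
  word_reduced : reduced word
}.

HB.instance Definition _ := [isSub for word].
HB.instance Definition _ := [Choice of free_group by <:].

Definition word_length (t : free_group) : nat := size (word t).

Definition push (a : letter) (w : seq letter) : seq letter :=
  if w is b :: w' then if b == flip a then w' else a :: w else [:: a].

Lemma flipK : involutive flip.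
Proof. by move=> [x b]; rewrite /flip /= negbK. Qed.

Lemma reduced_push a w : reduced w -> reduced (push a w).
Proof.
case: w => [//|b w] /=; case: ifPn => [_ /path_sorted //|ba bw].
by rewrite /reduced /= ba.
Qed.

Lemma reduced_foldr u w : reduced w -> reduced (foldr push w u).
Proof. by move=> rw; elim: u => //= a u; exact: reduced_push. Qed.

Lemma pushK a w : reduced w -> push a (push (flip a) w) = w.
Proof.
case: w => [|b w] /=; first by rewrite eqxx.
rewrite flipK; case: eqVneq => [->|ba] bw; last by rewrite /= eqxx.
by case: w bw => //= c w /andP[/negPf-> _].
Qed.

Lemma push_cons a w : reduced (a :: w) -> push a w = a :: w.
Proof. by case: w => //= b w /andP[/negPf-> _]. Qed.

Lemma foldr_push_nil w : reduced w -> foldr push [::] w = w.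
Proof.
elim: w => //= a w IHw raw; rewrite IHw ?push_cons//.
exact: path_sorted raw.
Qed.

Lemma foldr_push_push a t w : reduced t -> reduced w ->
  foldr push w (push a t) = push a (foldr push w t).
Proof.
move=> rt rw; case: t rt => //= b t _; case: eqVneq => [->|//].
by rewrite pushK// reduced_foldr.
Qed.

Definition fg_one : free_group := @FreeGroup [::] isT.

Definition fg_mul (u v : free_group) : free_group :=
  FreeGroup (reduced_foldr u (word_reduced v)).

Lemma reduced_inv w : reduced w -> reduced (rev (map flip w)).
Proof.
rewrite /reduced rev_sorted sorted_map; apply: sub_sorted => a b /=.
by rewrite flipK eq_sym.
Qed.

Definition fg_inv (u : free_group) : free_group :=
  FreeGroup (reduced_inv (word_reduced u)).

Fact fg_mulA : associative fg_mul.
Proof.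
move=> u v w; apply: val_inj => /=.
elim: (word u) => //= a s ->; rewrite foldr_push_push ?word_reduced//.
by apply: reduced_foldr; exact: word_reduced.
Qed.

Fact fg_mul1 : left_id fg_one fg_mul.
Proof. by move=> u; exact: val_inj. Qed.

Fact fg_mulr1 : right_id fg_one fg_mul.
Proof. by move=> u; apply: val_inj; exact: foldr_push_nil (word_reduced u). Qed.

Lemma foldr_push_inv z w : reduced z ->
  foldr push z (w ++ rev (map flip w)) = z.
Proof.
elim: w z => //= a w IHw z rz.
by rewrite rev_cons -rcons_cat foldr_rcons IHw ?pushK// reduced_push.
Qed.

Lemma inv_wordK w : rev (map flip (rev (map flip w))) = w.
Proof. by rewrite map_rev revK (mapK flipK). Qed.

Fact fg_mulgV : right_inverse fg_one fg_inv fg_mul.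
Proof.
move=> u; apply: val_inj => /=.
rewrite -[X in foldr _ X _]foldr_push_nil ?reduced_inv ?word_reduced//.
by rewrite -foldr_cat foldr_push_inv.
Qed.

Fact fg_mulVg : left_inverse fg_one fg_inv fg_mul.
Proof.
move=> u; rewrite -[X in fg_mul _ X](_ : fg_inv (fg_inv u) = u) ?fg_mulgV//.
by apply: val_inj; exact: inv_wordK.
Qed.

HB.instance Definition _ := isGroup.Build free_group
  fg_mulA fg_mul1 fg_mulr1 fg_mulVg fg_mulgV.

Definition gen (x : G) : free_group := @FreeGroup [:: (x, true)] isT.

End FreeGroup.

Section Space.
Variables (R : realType) (G : choiceType) (A : G -> G -> bool).

Local Notation F := (free_group G).
Implicit Types (s t : F) (x y j : G) (X Y : {fset G}).

Definition AXY X Y j : R[i] :=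
  \prod_(x <- X) (A x j)%:R * \prod_(y <- Y) (1 - (A y j)%:R).

(* {0,1}^F, with the product topology; a subset of F is identified with its
   characteristic function. *)
Definition subsets : Type := prod_topology (fun _ : F => bool).

HB.instance Definition _ := Topological.on subsets.

Definition ind t (xi : subsets) : R[i] := (xi t)%:R.

(* The translate t xi: s belongs to it when t^-1 s belongs to xi. *)
Definition translate t (xi : subsets) : subsets := fun s => xi (t^-1 * s)%g.

Inductive RA : (subsets -> R[i]) -> Prop :=
| RA_orthogonal x y of x != y :
    RA (fun xi => ind (gen x) xi * ind (gen y) xi)
| RA_matrix x y :
    RA (fun xi => ind (gen x)^-1%g xi * ind (gen y) xi
                  - (A x y)%:R * ind (gen y) xi)
| RA_prefix t s of word_length (t * s)%g = (word_length t + word_length s)%N :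
    RA (fun xi => ind (t * s)%g xi * ind t xi - ind (t * s)%g xi)
| RA_finite X Y of finite_set [set j | AXY X Y j != 0] :
    RA (fun xi => \prod_(x <- X) ind (gen x)^-1%g xi
                    * \prod_(y <- Y) (1 - ind (gen y)^-1%g xi)
                  - \sum_(j \in [set: G]) AXY X Y j * ind (gen j) xi).

(* The functions of [RA] only matter on the subsets that contain 1: if t is in
   xi then 1 is in t^-1 xi. *)
Definition OmegaA_set : set subsets :=
  [set xi : subsets | xi 1%g /\
    forall t f, xi t -> RA f -> f (translate t^-1%g xi) = 0].

Definition OmegaA : Type := set_type OmegaA_set.

HB.instance Definition _ := Topological.on OmegaA.

Lemma ind_translate t s xi : ind s (translate t^-1%g xi) = ind (t * s)%g xi.
Proof. by rewrite /ind /translate invgK. Qed.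

Lemma translate_translate s t xi :
  translate s^-1%g (translate t^-1%g xi) = translate (t * s)^-1%g xi.
Proof. by apply/funext => r; rewrite /translate !invgK mulgA. Qed.

Lemma OmegaA_translate t xi :
  OmegaA_set xi -> xi t -> OmegaA_set (translate t^-1%g xi).
Proof.
move=> [_ xiR] xit; split; first by rewrite /translate invgK mulg1.
move=> s f xits fR; rewrite translate_translate; apply: xiR fR.
by move: xits; rewrite {1}/translate invgK.
Qed.

Lemma ind_continuous t : continuous (ind t).
Proof.
move=> xi; apply: (@continuous_comp _ _ _ (fun z : subsets => z t)
  (fun b : bool => b%:R : R[i])).
  exact: (@proj_continuous F (fun _ => bool)).
move=> V Vb.
have sub : [set (xi t : bool)] `<=` (fun b : bool => b%:R : R[i]) @^-1` V.
  by move=> _ ->; exact: nbhs_singleton Vb.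
exact: filterS sub (discrete_set1 (xi t : bool)).
Qed.

Lemma continuous_seq (I : Type) (r : seq I) (op : R[i] -> R[i] -> R[i]) idx
    (f : I -> subsets -> R[i]) :
  (forall g h, continuous g -> continuous h ->
    continuous (fun xi : subsets => op (g xi) (h xi))) ->
  (forall i, continuous (f i)) ->
  continuous (fun xi => \big[op/idx]_(i <- r) f i xi).
Proof.
move=> opc fc; elim: r => [|i r IHr].
  rewrite (_ : (fun _ => _) = fun=> idx); first by move=> xi; exact: cvg_cst.
  by apply/funext => xi; rewrite big_nil.
rewrite (_ : (fun _ => _) =
    fun xi => op (f i xi) (\big[op/idx]_(j <- r) f j xi)).
  exact: opc (fc i) IHr.
by apply/funext => xi; rewrite big_cons.
Qed.

Lemma RA_translate_continuous t f : RA f ->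
  continuous (fun xi => f (translate t^-1%g xi)).
Proof.
have contM (g h : subsets -> R[i]) : continuous g -> continuous h ->
    continuous (fun xi => g xi * h xi).
  by move=> gc hc xi; apply: cvgM; [exact: gc|exact: hc].
have contD (g h : subsets -> R[i]) : continuous g -> continuous h ->
    continuous (fun xi => g xi + h xi).
  by move=> gc hc xi; apply: cvgD; [exact: gc|exact: hc].
have contN (g : subsets -> R[i]) : continuous g ->
    continuous (fun xi => - g xi).
  by move=> gc xi; apply: cvgN; exact: gc.
have cont_c (c : R[i]) : continuous (fun _ : subsets => c).
  by move=> xi; exact: cvg_cst.
have cont_ind s : continuous (fun xi => ind s (translate t^-1%g xi)).
  rewrite (_ : (fun _ => _) = ind (t * s)%g); first exact: ind_continuous.
  by apply/funext => xi; rewrite ind_translate.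
case=> {f} [x y _|x y|s1 s2 _|X Y XYfin].
- exact: contM (cont_ind _) (cont_ind _).
- exact: contD (contM _ _ (cont_ind _) (cont_ind _))
    (contN _ (contM _ _ (cont_c _) (cont_ind _))).
- exact: contD (contM _ _ (cont_ind _) (cont_ind _)) (contN _ (cont_ind _)).
- have prod1 : continuous (fun xi => \prod_(x <- X)
      ind (gen x)^-1%g (translate t^-1%g xi)).
    exact: (continuous_seq (f := fun x xi =>
      ind (gen x)^-1%g (translate t^-1%g xi)) contM (fun=> cont_ind _)).
  have prod2 : continuous (fun xi => \prod_(y <- Y)
      (1 - ind (gen y)^-1%g (translate t^-1%g xi))).
    exact: (continuous_seq (f := fun y xi =>
      1 - ind (gen y)^-1%g (translate t^-1%g xi)) contM
      (fun=> contD _ _ (cont_c 1) (contN _ (cont_ind _)))).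
  apply: (contD _ _ (contM _ _ prod1 prod2) (contN _ _)).
  have sumE xi : \sum_(j \in [set: G])
        AXY X Y j * ind (gen j) (translate t^-1%g xi)
      = \sum_(j <- fset_set [set j | AXY X Y j != 0])
        AXY X Y j * ind (gen j) (translate t^-1%g xi).
    rewrite (fsbigE (fset_set [set j | AXY X Y j != 0]))//.
    - by under eq_bigl do rewrite in_setT.
    - move=> j _; rewrite in_fset_set// notin_setE /= => /negP/negPn/eqP ->.
      by rewrite mul0r.
  rewrite (_ : (fun _ => _) = fun xi =>
      \sum_(j <- fset_set [set j | AXY X Y j != 0])
      AXY X Y j * ind (gen j) (translate t^-1%g xi)); last exact/funext.
  apply: (@continuous_seq _ _ +%R 0 (fun j xi =>
    AXY X Y j * ind (gen j) (translate t^-1%g xi))) => [g h|j].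
    exact: contD.
  exact: (contM _ _ (cont_c _) (cont_ind _)).
Qed.

Lemma closed_ind t b : closed [set xi : subsets | xi t = b].
Proof.
apply: (@preimage_closed _ _ (fun xi : subsets => xi t) [set b]).
  by move=> xi _; exact: (@proj_continuous F (fun _ => bool)).
exact: discrete_closed.
Qed.

Lemma OmegaA_closed : closed OmegaA_set.
Proof.
have -> : OmegaA_set = [set xi : subsets | xi 1%g = true] `&`
    \bigcap_(tf in [set tf : F * (subsets -> R[i]) | RA tf.2])
      ([set xi : subsets | xi tf.1 = false]
       `|` [set xi | tf.2 (translate tf.1^-1%g xi) = 0]).
  apply/seteqP; split=> xi /= [xi1 xiR]; split=> //.
    move=> [t f] /= fR; case xit: (xi t); last by left.
    by right; exact: xiR.
  move=> t f xit fR; have [/=|//] := xiR (t, f) fR.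
  by rewrite xit.
apply: closedI; first exact: closed_ind.
apply: closed_bigI => -[t f] /= fR; apply: closedU; first exact: closed_ind.
apply: (@preimage_closed _ _ (fun xi => f (translate t^-1%g xi)) [set 0]).
  by move=> xi _; exact: RA_translate_continuous.
apply: accessible_closed_set1; apply: hausdorff_accessible.
exact: norm_hausdorff.
Qed.

Lemma subsets_compact : compact [set: subsets].
Proof.
have := @tychonoff F (fun _ => bool) _ (fun=> bool_compact).
by congr (compact _); rewrite eqEsubset.
Qed.

Lemma subsets_hausdorff : hausdorff_space subsets.
Proof. by apply: hausdorff_product => ?; exact: discrete_hausdorff. Qed.

Fact OmegaA_compact : compact [set: OmegaA].
Proof.
have cO : compact OmegaA_set.
  exact: subclosed_compact OmegaA_closed subsets_compact _.
move=> H HF _; pose H' := (val : OmegaA -> subsets) @ H.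
have H'O : H' OmegaA_set.
  by rewrite /H' /= /nbhs /=; apply: filterE => xi; exact: (set_valP xi).
have [p [Op clp]] := cO H' _ H'O; exists (exist _ p (mem_set Op)); split=> //.
move=> B N HB [_ [[W oW <-] /= Wp] WN].
have [||_ [[xi Bxi <-] Wxi]] := clp (val @` B) W.
- by rewrite /H' /= /nbhs /=; apply: filterS HB => xi Bxi; exists xi.
- exact: open_nbhs_nbhs.
- by exists xi; split=> //; exact: WN.
Qed.

Fact OmegaA_hausdorff : hausdorff_space OmegaA.
Proof.
move=> xi eta clxe; apply: val_inj; apply: subsets_hausdorff => V W nV nW.
have [||z [Vz Wz]] := clxe (val @^-1` V) (val @^-1` W).
- exact: initial_continuous.
- exact: initial_continuous.
- by exists (val z).
Qed.

HB.instance Definition _ :=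
  isCompactHausdorff.Build OmegaA OmegaA_compact OmegaA_hausdorff.

Definition Delta x : set OmegaA := [set xi : OmegaA | val xi (gen x)].

Definition UA : set OmegaA := \bigcup_(x in [set: G]) Delta x.

(* The choice of x is immaterial by [Delta_uniq]. *)
Definition sigma (xi : OmegaA) : OmegaA :=
  if pselect (exists x, val xi (gen x)) is left h then
    exist _ (translate (gen (projT1 (cid h)))^-1%g (val xi))
      (mem_set (OmegaA_translate (set_valP xi) (projT2 (cid h))))
  else xi.

Lemma Delta_uniq xi x y : Delta x xi -> Delta y xi -> x = y.
Proof.
move=> xix xiy; apply/eqP/negPn/negP => xy; have [xi1 xiR] := set_valP xi.
have := xiR _ _ xi1 (RA_orthogonal xy).
rewrite /= !ind_translate !mul1g /ind xix xiy mulr1 => /eqP.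
by rewrite oner_eq0.
Qed.

Lemma val_sigma xi x : Delta x xi ->
  val (sigma xi) = translate (gen x)^-1%g (val xi).
Proof.
move=> xix; rewrite /sigma; case: pselect => [h|[]]; last by exists x.
by rewrite /=; case: cid => y /= xiy; rewrite (Delta_uniq xix xiy).
Qed.

Definition chi x (xi : OmegaA) : R[i] := ind (gen x) (val xi).

Lemma chi_Cc x : Cc UA (chi x).
Proof.
have valc : continuous (val : OmegaA -> subsets) by exact: initial_continuous.
split.
  move=> xi; apply: (@continuous_comp _ _ _ (val : OmegaA -> subsets)).
    exact: valc.
  exact: ind_continuous.
suff -> : closure [set xi | chi x xi != 0] = Delta x.
  by move=> xi xix; exists x.
have -> : [set xi | chi x xi != 0] = Delta x.
  apply/seteqP; split=> xi; rewrite /chi /ind /Delta /=.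
    by case: (val xi (gen x)) => //; rewrite eqxx.
  by move=> ->; rewrite oner_eq0.
apply/esym/closure_id.
apply: (@preimage_closed _ _ (val : OmegaA -> subsets)
  [set xi : subsets | xi (gen x) = true]).
  by move=> xi _; exact: valc.
exact: closed_ind.
Qed.

End Space.

Arguments UA {R G A}.
Arguments sigma {R G A} xi.
Arguments chi {R G A} x xi.

Section UniversalAlgebra.
Variables (R : realType) (G : choiceType) (A : G -> G -> bool).

(* By [OA_commute], the order of the factors in the products of [OA_finite] is
   irrelevant. *)
Record OA_relations (B : unitalCStarAlgType R) (S : G -> B) : Prop := {
  OA_partial_isometry : forall i, S i ** star (S i) ** S i = S i;
  OA_commute : forall i j,
    (star (S i) ** S i) ** (star (S j) ** S j)
      = (star (S j) ** S j) ** (star (S i) ** S i);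
  OA_orthogonal : forall i j, i != j -> star (S i) ** S j = 0;
  OA_matrix : forall i j,
    star (S i) ** S i ** S j = ((A i j)%:R : R[i]) *: S j;
  OA_finite : forall X Y : {fset G},
    finite_set [set j | AXY R A X Y j != 0] ->
    (\prod_(x <- X) (star (S x) ** S x))%g
      ** (\prod_(y <- Y) (1%g - star (S y) ** S y))%g
    = \sum_(j \in [set: G]) AXY R A X Y j *: (S j ** star (S j))
}.

Definition is_universal_OA (OA : unitalCStarAlgType R) (S : G -> OA) : Prop :=
  OA_relations S /\
  forall (B : unitalCStarAlgType R) (S' : G -> B), OA_relations S' ->
    exists! rho : OA -> B,
      [/\ star_hom rho, rho 1%g = 1%g & forall x, rho (S x) = S' x].

End UniversalAlgebra.

(* Main.v *)
Require Import Defs.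
From HB Require Import structures.
From mathcomp Require Import all_boot all_order all_algebra finmap.
From mathcomp Require Import complex ring.
From mathcomp Require Import all_classical all_reals topology normedtype.

(** Write chi_x for the class of [chi x] in the module, s_x for its image in the
    crossed product O, and 1_t for the indicator of the xi that contain t.

    The s_x satisfy the relations of OA ([gens_OA_relations]), which yields psi.
    The elements s_x^* s_y are inner products of the module, so that all
    relations but the finiteness relation are identities between functions on
    [OmegaA].  The finiteness relation also needs s_x s_x^* = 1_x in O, which
    holds because 1_x and s_x s_x^* form a redundancy with 1_x in the Katsura
    ideal ([jA_cind]).  That O has an identity is not given: it comes from the
    universal property of the Toeplitz algebra ([toeplitz_unit]).

    The inverse of psi comes from a representation of the module in OA, and more
    generally in any unital algebra with elements S_x satisfying the relations.
    A reduced word, read as a product of S_x and S_x^*, gives a partial isometry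
    with range projection e_t for each t in the free group.  These projections
    commute ([word_proj_comm]), because e_t is 0 or S_x^* S_x as soon as t
    begins with the inverse of x.  A subset xi of the free group is called
    spectral when every finite product of e_t for t in xi and of 1 - e_t for t
    not in xi is nonzero.  Spectral sets are stable under the translations that
    define [OmegaA], so each relation between the e_t need only be checked at
    the identity: spectral sets belong to [OmegaA] ([spectral_OmegaA]).  By
    compactness every nonzero finite product is realised by a spectral set
    ([spectral_extension]).  Hence 1_t |-> e_t is contractive on the algebra
    generated by the 1_t, which is dense, and it extends to a homomorphism pi
    on the continuous functions on [OmegaA] ([spectral_hom]).  A vector m of the
    module is the limit of the finite sums of the chi_x . <chi_x, m>, and
    tau(m) = sum_x S_x pi(<chi_x, m>) completes pi to a representation
    ([tau_exists]).

    The induced homomorphism rho on the Toeplitz algebra kills the elements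
    a - k of the ideal that defines O ([redundancy_killed]).  Indeed
    pi(a) S_x = rho(k) S_x for every x, so pi(a) and rho(k) agree after
    multiplication by p_X = sum_(x in X) S_x S_x^* for X finite.  On the side of
    k the p_X act as an approximate unit by construction; on the side of a they
    do because a function in the Katsura ideal is a uniform limit of functions
    supported on finitely many of the sets [Delta x] ([katsura_vanish]).  So rho
    induces theta : O -> OA.  Finally theta psi = id and psi theta = id by the
    uniqueness clauses of the two universal properties ([gens_isomorphism]).

    A homomorphism of C*-algebras is bounded, although its definition does not
    ask for it ([star_hom_bounded]); this is what allows the passages to the
    limit. *)

Set Implicit Arguments.
Unset Strict Implicit.
Unset Printing Implicit Defensive.

Import Order.TTheory GRing.Theory Num.Theory.
Import numFieldNormedType.Exports.

Local Open Scope classical_set_scope.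
Local Open Scope complex_scope.
Local Open Scope ring_scope.

(** * Dense subspaces of normed modules *)
Section NormedTools.
Variables (R : realType).

Lemma lee_eps (x y : R[i]) (c : R[i]) : 0 <= c ->
  (forall e : R[i], 0 < e -> x <= y + c * e) -> x <= y.
Proof.
move=> c0 xy; apply/ler_addgt0Pr => e e0.
have c1 : 0 < c + 1 by rewrite ltr_wpDl.
apply: le_trans (xy (e / (c + 1)) _) _; first by rewrite divr_gt0.
rewrite lerD2l mulrA ler_pdivrMr// mulrC ler_pM2l//.
by rewrite lerDl.
Qed.

Lemma norm_eps_eq0 (V : normedModType R[i]) (v : V) (c : R[i]) : 0 <= c ->
  (forall e : R[i], 0 < e -> `|v| <= c * e) -> v = 0.
Proof.
move=> c0 vc; apply/eqP; rewrite -normr_le0; apply: (lee_eps c0) => e e0.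
by rewrite add0r vc.
Qed.

Lemma lower_bound2 (e1 e2 : R[i]) : 0 < e1 -> 0 < e2 ->
  exists2 m : R[i], 0 < m & m <= e1 /\ m <= e2.
Proof.
move=> e10 e20; have s0 : 0 < e1^-1 + e2^-1 by rewrite addr_gt0 ?invr_gt0.
exists (e1^-1 + e2^-1)^-1; first by rewrite invr_gt0.
split; rewrite -[leRHS]invrK lef_pV2 ?posrE ?invr_gt0//.
  by rewrite lerDl invr_ge0 ltW.
by rewrite lerDr invr_ge0 ltW.
Qed.

Definition dense_in (V : normedModType R[i]) (D : set V) :=
  forall v (e : R[i]), 0 < e -> exists2 d, D d & `|v - d| < e.

Lemma dense_inP (V : normedModType R[i]) (D : set V) :
  closure D = setT -> dense_in D.
Proof.
move=> DT v e e0; have : closure D v by rewrite DT.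
move=> /(_ (ball v e) (nbhsx_ballx _ _ e0)) [d [Dd]].
by rewrite -ball_normE /= => vd; exists d.
Qed.

Lemma dense_eq (V W : normedModType R[i]) (D : set V) (h1 h2 : V -> W)
    (K : R[i]) : 0 <= K -> dense_in D ->
  (forall u v, h1 (u - v) = h1 u - h1 v) ->
  (forall u v, h2 (u - v) = h2 u - h2 v) ->
  (forall v, `|h1 v| <= K * `|v|) -> (forall v, `|h2 v| <= K * `|v|) ->
  (forall d, D d -> h1 d = h2 d) -> forall v, h1 v = h2 v.
Proof.
move=> K0 Dd h1B h2B h1K h2K h12 v; apply/eqP; rewrite -subr_eq0; apply/eqP.
apply: (@norm_eps_eq0 _ _ (K + K)); first by rewrite addr_ge0.
move=> e e0; have [d Dd' vd] := Dd v e e0.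
have -> : h1 v - h2 v = h1 (v - d) - h2 (v - d).
  by rewrite h1B h2B (h12 d)// opprB addrA subrK.
apply: le_trans (ler_normB _ _) _; rewrite mulrDl lerD//.
- by apply: le_trans (h1K _) _; rewrite ler_wpM2l// ltW.
- by apply: le_trans (h2K _) _; rewrite ler_wpM2l// ltW.
Qed.

(** The extension principle for a contractive linear relation.  A relation is
    used because the maps to be extended are given by generators, so that a
    value is not visibly independent of the way its argument is written;
    contractivity gives this independence. *)
Lemma contractive_extension (V : normedModType R[i])
    (W : completeNormedModType R[i]) (R0 : V -> W -> Prop) :
  dense_in [set v | exists w, R0 v w] ->
  (forall (k : R[i]) u v x y, R0 u x -> R0 v y ->
     R0 (k *: u + v) (k *: x + y)) ->
  (forall v w, R0 v w -> `|w| <= `|v|) ->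
  exists h : V -> W,
    [/\ forall v w, R0 v w -> h v = w,
        forall (k : R[i]) u v, h (k *: u + v) = k *: h u + h v
      & forall v, `|h v| <= `|v|].
Proof.
move=> dom lin contr.
have diff u v x y : R0 u x -> R0 v y -> `|x - y| <= `|u - v|.
  move=> ux vy; apply: contr; have := lin (-1) _ _ _ _ vy ux.
  by rewrite !scaleN1r ![- _ + _]addrC.
(* The value l at v is characterised by |l - w| <= |v - d| for all (d, w) in
   the relation; all properties of the extension follow from this. *)
have lim_ex v : exists l, forall d w, R0 d w -> `|l - w| <= `|v - d|.
  pose B (e : R[i]) := [set w | exists2 d, R0 d w & `|v - d| < e].
  pose F := filter_from [set e : R[i] | 0 < e] B.
  have FF : ProperFilter F.
    apply: filter_from_proper.
      apply: filter_from_filter; first by exists 1 => /=.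
      move=> e1 e2 /= e10 e20.
      have [m m0 [me1 me2]] := lower_bound2 e10 e20; exists m => //.
      move=> w [d dw vd]; split; exists d => //.
        exact: lt_le_trans me1.
      exact: lt_le_trans me2.
    move=> e /= e0; have [d [w dw] vd] := dom v e e0.
    by exists w; exists d.
  have Fc : cauchy F.
    apply/cauchyP => e e0; have e20 : 0 < e / 2 by rewrite divr_gt0.
    have [d [w dw] vd] := dom v _ e20; exists w.
    exists (e / 2) => //= x [d' d'x vd'].
    rewrite -ball_normE /=; apply: le_lt_trans (diff _ _ _ _ dw d'x) _.
    rewrite (splitr e); apply: le_lt_trans (ler_distD v _ _) _.
    by rewrite ltrD// distrC.
  have /cvg_ex[l Fl] : cvg F by exact: cauchy_cvg.
  exists l => d w dw; apply: (@lee_eps _ _ 2) => // e e0.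
  have [e' /= e'0 Be'] : F (ball l e) by apply: Fl; exact: nbhsx_ballx.
  have [m m0 [me me']] := lower_bound2 e0 e'0.
  have [d' [w' dw'] vd'] := dom v _ m0.
  have /Be' : B e' w' by exists d' => //; exact: lt_le_trans me'.
  have {}vd' : `|v - d'| < e by exact: lt_le_trans me.
  rewrite -ball_normE /= => lw'.
  apply: le_trans (ler_distD w' _ _) _.
  apply: le_trans (lerD (ltW lw') (diff _ _ _ _ dw' dw)) _.
  apply: le_trans (lerD (lexx _) (ler_distD v _ _)) _.
  rewrite addrA addrC lerD2l mulr_natl mulr2n lerD2l distrC.
  exact: ltW.
have /choice[h hP] := lim_ex; exists h.
have ex0 v : v = 0 -> R0 v 0.
  move=> ->; have [d [w dw] _] := dom 0 1 ltr01.
  by have := lin (-1) _ _ _ _ dw dw; rewrite !scaleN1r !addNr.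
split.
- move=> v w vw; apply/eqP; rewrite -subr_eq0 -normr_le0.
  by apply: le_trans (hP v _ _ vw) _; rewrite subrr normr0.
- move=> k u v; apply/eqP; rewrite -subr_eq0; apply/eqP.
  apply: (@norm_eps_eq0 _ _ ((`|k| + 1) + (`|k| + 1))).
    by rewrite !addr_ge0.
  move=> e e0; have [d1 [w1 dw1] ud1] := dom u e e0.
  have [d2 [w2 dw2] vd2] := dom v e e0.
  have -> : h (k *: u + v) - (k *: h u + h v)
      = (h (k *: u + v) - (k *: w1 + w2)) - (k *: (h u - w1) + (h v - w2)).
    by rewrite scalerBr addrACA -opprD opprB addrA subrK.
  rewrite mulrDl; apply: le_trans (ler_normB _ _) _; apply: lerD.
    apply: le_trans (hP _ _ _ (lin k _ _ _ _ dw1 dw2)) _.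
    have -> : k *: u + v - (k *: d1 + d2) = k *: (u - d1) + (v - d2).
      by rewrite scalerBr opprD addrACA.
    apply: le_trans (ler_normD _ _) _; rewrite normrZ mulrDl mul1r lerD//.
      by rewrite ler_wpM2l// ltW.
    exact: ltW.
  apply: le_trans (ler_normD _ _) _; rewrite normrZ mulrDl mul1r lerD//.
    by rewrite ler_wpM2l// (le_trans (hP _ _ _ dw1))// ltW.
  by rewrite (le_trans (hP _ _ _ dw2))// ltW.
- move=> v; have := hP v 0 0 (ex0 0 erefl).
  by rewrite !subr0.
Qed.

End NormedTools.

(** * Homomorphisms of C*-algebras are bounded *)
Section CStarBasics.
Variables (R : realType) (A : cstarAlgType R).
Implicit Types a b c : A.

Lemma cmul0l a : 0 ** a = 0.
Proof. by apply: (addrI (0 ** a)); rewrite -cmulDl !addr0. Qed.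

Lemma cmul0r a : a ** 0 = 0.
Proof. by apply: (addrI (a ** 0)); rewrite -cmulDr !addr0. Qed.

Lemma cmulNl a b : (- a) ** b = - (a ** b).
Proof. by apply: (addrI (a ** b)); rewrite -cmulDl !subrr cmul0l. Qed.

Lemma cmulNr a b : a ** (- b) = - (a ** b).
Proof. by apply: (addrI (a ** b)); rewrite -cmulDr !subrr cmul0r. Qed.

Lemma cmulBl a b c : (a - b) ** c = a ** c - b ** c.
Proof. by rewrite cmulDl cmulNl. Qed.

Lemma cmulBr a b c : a ** (b - c) = a ** b - a ** c.
Proof. by rewrite cmulDr cmulNr. Qed.

Lemma star0 : star 0 = 0 :> A.
Proof. by apply: (addrI (star 0)); rewrite -starD !addr0. Qed.

Lemma starN a : star (- a) = - star a.
Proof. by apply: (addrI (star a)); rewrite -starD !subrr star0. Qed.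

Lemma starB a b : star (a - b) = star a - star b.
Proof. by rewrite starD starN. Qed.

Lemma cmul_suml (I : Type) (r : seq I) (F : I -> A) a :
  (\sum_(i <- r) F i) ** a = \sum_(i <- r) F i ** a.
Proof.
by apply: (big_morph (fun b => b ** a)) => [b c|];
  rewrite ?cmulDl ?cmul0l.
Qed.

Lemma cmul_sumr (I : Type) (r : seq I) (F : I -> A) a :
  a ** (\sum_(i <- r) F i) = \sum_(i <- r) a ** F i.
Proof.
by apply: (big_morph (fun b => a ** b)) => [b c|];
  rewrite ?cmulDr ?cmul0r.
Qed.

Lemma star_sum (I : Type) (r : seq I) (F : I -> A) :
  star (\sum_(i <- r) F i) = \sum_(i <- r) star (F i).
Proof. by apply: big_morph => [b c|]; rewrite ?starD ?star0. Qed.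

Lemma norm_star a : `|star a| = `|a|.
Proof.
have le b : `|b| <= `|star b|.
  have [->|b0] := eqVneq b 0; first by rewrite star0.
  have := cnormM (star b) b; rewrite cnorm_star expr2 ler_pM2r//.
  by rewrite normr_gt0.
by apply/le_anti; rewrite le -{2}[a]starK le.
Qed.

End CStarBasics.

Lemma star1 (R : realType) (B : unitalCStarAlgType R) : star 1%g = 1%g :> B.
Proof. by have := starM 1%g (star 1%g : B); rewrite mul1g starK mul1g. Qed.

Section StarHom.
Variables (R : realType) (A B : cstarAlgType R) (f : A -> B).
Hypothesis fhom : star_hom f.
Implicit Types a b c : A.

Lemma shomP (k : R[i]) a b : f (k *: a + b) = k *: f a + f b.
Proof. by case: fhom. Qed.

Lemma shomM a b : f (a ** b) = f a ** f b.
Proof. by case: fhom. Qed.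

Lemma shom_star a : f (star a) = star (f a).
Proof. by case: fhom. Qed.

Lemma shomD a b : f (a + b) = f a + f b.
Proof. by rewrite -[a]scale1r shomP !scale1r. Qed.

Lemma shom0 : f 0 = 0.
Proof. by apply: (addrI (f 0)); rewrite -shomD !addr0. Qed.

Lemma shomZ (k : R[i]) a : f (k *: a) = k *: f a.
Proof. by rewrite -[k *: a]addr0 shomP shom0 addr0. Qed.

Lemma shomN a : f (- a) = - f a.
Proof. by rewrite -[- a]scaleN1r shomZ scaleN1r. Qed.

Lemma shomB a b : f (a - b) = f a - f b.
Proof. by rewrite shomD shomN. Qed.

Lemma shom_sum (I : Type) (r : seq I) (F : I -> A) :
  f (\sum_(i <- r) F i) = \sum_(i <- r) f (F i).
Proof. by apply: big_morph => [a b|]; rewrite ?shomD ?shom0. Qed.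

End StarHom.

Section Bounded.
Variables (R : realType).
Local Notation C := R[i].

Lemma half_pow_small (e : C) : 0 < e -> exists n, 2 ^- n < e.
Proof.
move=> e0; have eR : (complex.Re e)%:C = e by rewrite RRe_real ?gtr0_real.
have r0 : 0 < complex.Re e by rewrite -ltcR eR.
exists (Num.Def.archi_bound (complex.Re e)^-1).
have h := @upper_nthrootP R (complex.Re e)^-1 _ (leqnn _).
rewrite -[ltRHS]invrK ltf_pV2 ?posrE ?invr_gt0 ?exprn_gt0//.
set n := Num.Def.archi_bound _ in h *.
have -> : 2 ^+ n = (2 ^+ n)%:C :> C by rewrite rmorphXn/= rmorph_nat.
have -> : e^-1 = ((complex.Re e)^-1)%:C :> C by rewrite fmorphV/= eR.
by rewrite ltcR.
Qed.

(** The limit comes with its rate of convergence, so that identities pass to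
    the limit by norm estimates. *)
Lemma half_cauchy (V : completeNormedModType C) (u : nat -> V) :
  (forall n, `|u n.+1 - u n| <= 2 ^- n) ->
  exists l, forall n, `|l - u n| <= 2 * 2 ^- n.
Proof.
move=> du.
have dist n m : `|u (n + m)%N - u n| <= 2 * 2 ^- n - 2 * 2 ^- (n + m).
  elim: m => [|m IHm]; first by rewrite addn0 !subrr normr0.
  apply: le_trans (ler_distD (u (n + m)%N) _ _) _.
  rewrite addnS; apply: le_trans (lerD (du _) IHm) _.
  rewrite exprS invfM mulrA mulfV ?pnatr_eq0// mul1r.
  set x := 2 ^- (n + m); set y := 2 ^- n.
  by have -> : x + (2 * y - 2 * x) = 2 * y - x by ring.
have dist1 n m : (n <= m)%N -> `|u m - u n| <= 2 * 2 ^- n.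
  move=> /subnKC <-; apply: le_trans (dist _ _) _.
  by rewrite gerBl mulr_ge0// invr_ge0 exprn_ge0.
pose F := u @ \oo.
have Fc : cauchy F.
  apply/cauchyP => e e0; have [n ne] := half_pow_small (divr_gt0 e0 (ltr0n _
    2)).
  exists (u n); exists n => // m /= nm; rewrite -ball_normE /=.
  rewrite distrC; apply: le_lt_trans (dist1 _ _ nm) _.
  by rewrite mulrC -ltr_pdivlMr.
have /cvg_ex[l Fl] : cvg F by exact: cauchy_cvg.
exists l => n; apply: (@lee_eps _ _ _ 1) => // e e0; rewrite mul1r [leRHS]addrC.
have [N _ NF] : F (ball l e) by apply: Fl; exact: nbhsx_ballx.
have := NF (N + n)%N (leq_addr _ _); rewrite -ball_normE /= => lu.
apply: le_trans (ler_distD (u (N + n)%N) _ _) _; rewrite lerD//;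
  first exact: ltW.
exact/dist1/leq_addl.
Qed.

End Bounded.

Section Automatic.
Variables (R : realType) (A B : cstarAlgType R) (f : A -> B).
Hypothesis fhom : star_hom f.

(** The element 1 - z is a square root of 1 - a^2, found without a unit: the
    equation (1 - z)^2 = 1 - a^2 reads z = (a^2 + z^2) / 2, which is solved by
    iterating a contraction of the ball of radius 1/2. *)
Lemma sqrt_defect (a : A) : star a = a -> `|a ** a| <= 2^-1 ->
  exists z, [/\ star z = z, a ** z = z ** a & 2 *: z = a ** a + z ** z].
Proof.
move=> aS a2; set h := a ** a in a2 *.
pose g z : A := 2^-1 *: (h + z ** z).
pose u n := iter n g 0.
have hf : (0 : R[i]) < 2^-1 by rewrite invr_gt0.
have un n : `|u n| <= 2^-1.
  elim: n => [|n IHn]; first by rewrite normr0 ltW.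
  rewrite /= /g normrZ gtr0_norm// -[leRHS]mulr1 ler_wpM2l ?(ltW hf)//.
  apply: le_trans (ler_normD _ _) _; rewrite [leRHS](splitr 1) !mul1r lerD//.
  apply: le_trans (cnormM _ _) _; rewrite -[leRHS]mulr1 ler_pM//.
  by apply: le_trans IHn _; rewrite invf_le1// ler1n.
have gL x y : `|x| <= 2^-1 -> `|y| <= 2^-1 -> `|g x - g y| <= 2^-1 * `|x - y|.
  move=> x2 y2; rewrite /g -scalerBr normrZ gtr0_norm// ler_wpM2l ?(ltW hf)//.
  have -> : h + x ** x - (h + y ** y) = x ** (x - y) + (x - y) ** y.
    by rewrite opprD addrACA subrr add0r cmulBr cmulBl addrA subrK.
  apply: le_trans (ler_normD _ _) _; rewrite -[leRHS]mul1r [in leRHS](splitr 1).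
  rewrite !mul1r mulrDl lerD//.
    by apply: le_trans (cnormM _ _) _; rewrite ler_wpM2r.
  by apply: le_trans (cnormM _ _) _; rewrite mulrC ler_wpM2r.
have du n : `|u n.+1 - u n| <= 2 ^- n.
  elim: n => [|n IHn].
    rewrite /u /= subr0 expr0 invr1; apply: le_trans (un 1) _.
    by rewrite invf_le1// ler1n.
  apply: le_trans (gL _ _ (un n.+1) (un n)) _.
  by rewrite exprS invfM ler_wpM2l// ltW.
have [l lu] := half_cauchy du.
have u_lim (z1 z2 : A) : (forall n, exists2 x, z1 = z2
  + x & `|x| <= 8 * 2 ^- n) ->
    z1 = z2.
  move=> H; apply/eqP; rewrite -subr_eq0; apply/eqP.
  apply: (@norm_eps_eq0 _ _ _ 8) => // e e0; have [n ne] := half_pow_small e0.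
  have [x -> x8] := H n; rewrite addrC addKr; apply: le_trans x8 _.
  by rewrite ler_wpM2l// ltW.
have uS n : star (u n) = u n.
  elim: n => [|n IHn]; first exact: star0.
  rewrite /= /g starZ starD !starM aS IHn; congr (_ *: _).
  by rewrite conj_Creal// ger0_real// ltW.
have ua n : a ** u n = u n ** a.
  elim: n => [|n IHn]; first by rewrite cmul0l cmul0r.
  rewrite /= /g cscaleAr cscaleAl cmulDr cmulDl; congr (_ *: (_ + _)).
    by rewrite mulgA.
  by rewrite mulgA IHn -!mulgA IHn.
have l2 : `|l| <= 2^-1.
  apply: (@lee_eps _ _ _ 2) => // e e0; have [n ne] := half_pow_small e0.
  rewrite -[l](subrK (u n)) [leRHS]addrC; apply: le_trans (ler_normD _ _) _.
  rewrite lerD ?un//; apply: le_trans (lu n) _.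
  by rewrite ler_wpM2l// ltW.
have a1 : `|a| <= 1.
  rewrite -(@ler_pXn2r _ 2)// ?nnegrE// -cnorm_star aS expr1n.
  by apply: le_trans a2 _; rewrite invf_le1// ler1n.
have bnd n (x : R[i]) : x <= 4 -> x * 2 ^- n <= 8 * 2 ^- n.
  move=> x4; rewrite ler_wpM2r// ?invr_ge0 ?exprn_ge0//.
  by rewrite (le_trans x4)// ler_nat.
exists l; split.
- apply: u_lim => n; exists (star (l - u n) - (l - u n)).
    by rewrite starB uS opprB subrKA addrC subrK.
  apply: le_trans (ler_normB _ _) _; rewrite norm_star.
  apply: le_trans (lerD (lu n) (lu n)) _.
  by rewrite -mulrDl bnd// -natrD.
- apply: u_lim => n; exists (a ** (l - u n) - (l - u n) ** a).
    by rewrite cmulBr cmulBl ua opprB subrKA addrC subrK.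
  apply: le_trans (ler_normB _ _) _.
  apply: le_trans (lerD (cnormM _ _) (cnormM _ _)) _.
  rewrite mulrC -mulrDr.
  apply: (@le_trans _ _ (`|l - u n| * (1 + 1))).
    by rewrite ler_wpM2l// lerD.
  rewrite mulrC; apply: le_trans (ler_wpM2l _ (lu n)) _;
    first by rewrite addr_ge0.
  by rewrite mulrA bnd// (_ : (1 + 1) * 2 = 4)//; ring.
- have -> : a ** a + l ** l = 2 *: g l by rewrite /g scalerA mulfV ?pnatr_eq0//
  scale1r.
  congr (_ *: _); apply: u_lim => n.
  exists ((l - u n.+1) - (g l - g (u n))).
    by rewrite opprB subrKA addrC subrK.
  apply: le_trans (ler_normB _ _) _.
  apply: le_trans (lerD (lu _) (gL _ _ l2 (un n))) _.
  apply: le_trans (lerD (lexx _) (ler_wpM2l (ltW hf) (lu _))) _.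
  rewrite exprS invfM mulrA mulfV ?pnatr_eq0// mul1r mulrA mulVf ?pnatr_eq0//.
  by rewrite mul1r -mulr2n -[_ *+ 2]mulr_natl bnd// ler_nat.
Qed.

(** With b = f a and w = f z, where 1 - z is a square root of 1 - a^2, the
    elements u = b + i (1 - w) and u^* = b - i (1 - w) are formally unitary.
    They act isometrically by left multiplication even if the algebra has no
    unit, and b, which is half of their sum, is then of norm at most 1. *)
Lemma shom_small (a : A) : star a = a -> `|a ** a| <= 2^-1 -> `|f a| <= 1.
Proof.
move=> aS a2; have [z [zS az z2]] := sqrt_defect aS a2.
set b := f a; set w := f z.
have bS : star b = b by rewrite /b -shom_star// aS.
have wS : star w = w by rewrite /w -shom_star// zS.
have bw : b ** w = w ** b by rewrite /b /w -!shomM// az.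
have w2 : 2 *: w = b ** b + w ** w.
  by rewrite /b /w -!shomM// -shomD// -shomZ// z2.
(* v s c is (b + s i (1 - w)) c, for s = 1 or s = -1. *)
pose v (s : R[i]) c := b ** c + (s * 'i) *: (c - w ** c).
have vv s c : s^* = s -> s * s = 1 -> star (v s c) ** v s c = star c ** c.
  move=> sS s1; rewrite /v starD starZ starB !starM bS wS.
  have -> : (s * 'i)^* = - (s * 'i) by rewrite rmorphM/= sS conjCi mulrN.
  have ss : (s * 'i) * (s * 'i) = -1 by rewrite mulrACA s1 mul1r -expr2 sqrCi.
  set k := s * 'i in ss *.
  have comm : star c ** b ** (c - w ** c) = (star c - star c ** w) ** (b ** c).
    by rewrite cmulBr cmulBl !mulgA -[_ ** b ** w]mulgA bw mulgA.
  have sq : star c ** b ** (b ** c) + (star c - star c ** w) ** (c - w ** c)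
      = star c ** c.
    rewrite cmulBr !cmulBl -[_ ** b ** _]mulgA.
    have -> : star c ** (b ** (b ** c)) = star c ** (b ** b) ** c.
      by rewrite !mulgA.
    have -> : b ** b = 2 *: w - w ** w by rewrite w2 addrK.
    rewrite cmulBr cmulBl cscaleAr cscaleAl scaler_nat !mulgA mulr2n.
    rewrite opprB addrA; set p := star c ** w ** c; set r := _ ** w ** c.
    by rewrite -addrA addrCA subrKA addrK subrK.
  rewrite cmulDl !cmulDr !cscaleAl !cscaleAr scalerA mulNr ss opprK scale1r.
  by rewrite scaleNr comm addrA addrK.
have nv s c : s^* = s -> s * s = 1 -> `|v s c| = `|c|.
  move=> sS s1; apply/eqP; rewrite -(@eqrXn2 _ 2)//.
  by rewrite -!cnorm_star vv.
have bc c : `|b ** c| <= `|c|.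
  have -> : b ** c = 2^-1 *: (v 1 c + v (-1) c).
    rewrite /v mulN1r mul1r scaleNr addrACA subrr addr0 -mulr2n -[(b
      ** c) *+ 2]scaler_nat.
    by rewrite scalerA mulVf ?pnatr_eq0// scale1r.
  rewrite normrZ ger0_norm ?invr_ge0// ler_pdivrMl// mulr_natl mulr2n.
  apply: le_trans (ler_normD _ _) _; rewrite !nv// ?rmorphN ?rmorph1//.
    by rewrite mulrNN mulr1.
  by rewrite mulr1.
have [b0|b0] := eqVneq b 0; first by rewrite b0 normr0.
rewrite -(@ler_pM2r _ `|b|) ?normr_gt0// mul1r -expr2 -cnorm_star bS.
exact: bc.
Qed.

(** Rescaling reduces a selfadjoint element to [shom_small], and the C*-identity
    reduces an arbitrary element to a selfadjoint one.  The optimal constant is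
    1, but boundedness is all that continuity needs. *)
Lemma star_hom_bounded (a : A) : `|f a| <= 2 * `|a|.
Proof.
have sa (h : A) : star h = h -> `|f h| <= 2 * `|h|.
  move=> hS; have [->|h0] := eqVneq h 0; first by rewrite shom0// !normr0 mulr0.
  have h2 : 0 < 2 * `|h| by rewrite mulr_gt0// normr_gt0.
  have /shom_small : star ((2 * `|h|)^-1 *: h) = (2 * `|h|)^-1 *: h.
    by rewrite starZ hS conj_Creal// ger0_real// ltW// invr_gt0.
  rewrite (shomZ fhom) normrZ gtr0_norm ?invr_gt0// ler_pdivrMl// mulr1; apply.
  apply: le_trans (cnormM _ _) _; rewrite normrZ gtr0_norm ?invr_gt0//.
  have -> : (2 * `|h|)^-1 * `|h| = 2^-1.
    by rewrite invfM -mulrA mulVf ?normr_eq0// mulr1.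
  by rewrite -[leRHS]mulr1 ler_wpM2l// ?invf_le1 ?ler1n ?invr_ge0.
rewrite -(@ler_pXn2r _ 2)// ?nnegrE ?mulr_ge0//.
rewrite -cnorm_star -shom_star// -shomM//.
apply: le_trans (sa _ _) _; first by rewrite starM starK.
rewrite cnorm_star exprMn ler_wpM2r ?exprn_ge0//.
by rewrite -natrX ler_nat.
Qed.

End Automatic.

(** * Splitting a norm along a projection *)
Section TwoPower.
Variable R : realType.

(** If x > y, then (x / y)^N exceeds 2 for N large, by Bernoulli. *)
Lemma power_cancel (x y : R[i]) : 0 <= x -> 0 <= y ->
  (forall n, x ^+ (2 ^ n) <= 2 * y ^+ (2 ^ n)) -> x <= y.
Proof.
move=> x0 y0 h; have xR : (complex.Re x)%:C = x by rewrite RRe_real ?ger0_real.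
have yR : (complex.Re y)%:C = y by rewrite RRe_real ?ger0_real.
move: x0 y0 h; rewrite -xR -yR; move: (complex.Re x) (complex.Re y) => {xR yR}a
  b.
move=> a0 b0 h; rewrite lecR leNgt; apply/negP => ba.
have {}a0 : 0 <= a by rewrite -lecR.
have {}b0 : 0 <= b by rewrite -lecR.
have {}h n : a ^+ (2 ^ n) <= 2 * b ^+ (2 ^ n).
  have := h n; rewrite -!(rmorphXn (real_complex R)) /= -(rmorph_nat
    (real_complex R) 2).
  by rewrite -(rmorphM (real_complex R)) lecR.
have [b00|bN0] := eqVneq b 0.
  have := h 0; rewrite expn0 !expr1 b00 mulr0 leNgt; move: ba;
    rewrite b00 => ->.
  by [].
have bp : 0 < b by rewrite lt_def bN0.
have r1 : 1 < a / b by rewrite ltr_pdivlMr// mul1r.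
have hr n : (a / b) ^+ (2 ^ n) <= 2.
  by rewrite expr_div_n ler_pdivrMr ?exprn_gt0// h.
pose d := a / b - 1; have d0 : 0 < d by rewrite subr_gt0.
have bern n : 1 + d *+ n <= (a / b) ^+ n.
  elim: n => [|n IHn]; first by rewrite mulr0n addr0 expr0.
  rewrite exprS; apply: le_trans (ler_wpM2l (ltW (lt_trans ltr01 r1)) IHn).
  have -> : a / b = 1 + d by rewrite /d addrCA subrr addr0.
  rewrite mulrDl mul1r mulrDr mulr1 -addrA lerD2l mulrSr lerD2l lerDl.
  by rewrite mulr_ge0// ?mulrn_wge0// ltW.
pose n := Num.Def.archi_bound d^-1.
have := hr n; apply/negP; rewrite -ltNge.
apply: lt_le_trans (bern _); rewrite -[2]/(1 + 1) ltrD2l.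
rewrite -(@ltr_pM2l _ d^-1) ?invr_gt0// mulr1 mulrnAr mulVf ?gt_eqF//.
apply: lt_le_trans (archi_boundP _) _; first by rewrite invr_ge0 ltW.
by rewrite ler_nat ltnW// ltn_expl.
Qed.

End TwoPower.

Section Split.
Variables (R : realType) (B : unitalCStarAlgType R).
Implicit Types (h b p : B).

Local Notation sqr_iter n h := (iter n (fun b => b ** b) h).

Lemma star_sqr_iter n h : star h = h -> star (sqr_iter n h) = sqr_iter n h.
Proof. by move=> hS; elim: n => //= n IHn; rewrite starM IHn. Qed.

Lemma norm_sqr_iter n h : star h = h -> `|sqr_iter n h| = `|h| ^+ (2 ^ n).
Proof.
move=> hS; elim: n => [|n IHn]; first by rewrite expn0 expr1.
rewrite /= -{1}(star_sqr_iter n hS) cnorm_star IHn -exprM.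
by rewrite expnSr.
Qed.

(** For h = b^* b the powers h^N are the sums of the powers of h p and of
    h (1 - p), and the norm of a selfadjoint element is multiplicative on powers
    N = 2^n.  So |h|^N <= 2 max(|h p|, |h (1 - p)|)^N, and the factor 2
    disappears by [power_cancel]. *)
Lemma norm_split p b : star p = p -> p ** p = p -> b ** p = p ** b ->
  star b ** p = p ** star b ->
  `|b| <= `|b ** p| \/ `|b| <= `|b ** (1%g - p)|.
Proof.
move=> pS pp bp sbp; set r := 1%g - p.
have rS : star r = r by rewrite starB star1 pS.
have rr : r ** r = r.
  by rewrite /r cmulBr mulg1 cmulBl mul1g pp subrr subr0.
have br : b ** r = r ** b by rewrite /r cmulBr cmulBl mulg1 mul1g bp.
have sbr : star b ** r = r ** star b by rewrite /r cmulBr cmulBl mulg1 mul1g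
  sbp.
have pr : p ** r = 0 by rewrite /r cmulBr mulg1 pp subrr.
have rp : r ** p = 0 by rewrite /r cmulBl mul1g pp subrr.
set h := star b ** b.
have hS : star h = h by rewrite /h starM starK.
have cut e : star e = e -> e ** e = e -> b ** e = e ** b ->
    star b ** e = e ** star b ->
    [/\ star (h ** e) = h ** e, `|h ** e| = `|b ** e| ^+ 2 & h ** e = e ** h].
  move=> eS ee be sbe.
  have he : h ** e = e ** h by rewrite /h -mulgA be mulgA sbe mulgA.
  split=> //; first by rewrite starM eS hS.
  rewrite -cnorm_star starM eS !mulgA -sbe -!mulgA [e ** (b
    ** e)]mulgA -be -mulgA ee.
  by [].
have [hpS hpn hp] := cut p pS pp bp sbp.
have [hrS hrn hr] := cut r rS rr br sbr.
have pow n : sqr_iter n h = sqr_iter n (h ** p) + sqr_iter n (h ** r).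
  suff [-> _] : sqr_iter n h = sqr_iter n (h ** p) + sqr_iter n (h ** r) /\
     (sqr_iter n (h ** p) ** sqr_iter n (h ** r) = 0 /\
      sqr_iter n (h ** r) ** sqr_iter n (h ** p) = 0) by [].
  elim: n => [|n /= [-> []]] /=.
    rewrite -cmulDr /r addrCA subrr addr0 mulg1; split=> //; split.
      by rewrite hr -mulgA [p ** _]mulgA pr cmul0l cmul0r.
    by rewrite hp -mulgA [r ** _]mulgA rp cmul0l cmul0r.
  set X := iter _ _ _; set Y := iter _ _ _ => XY YX; split.
    by rewrite cmulDl !cmulDr XY YX addr0 add0r.
  by rewrite !mulgA -(mulgA X) XY -(mulgA Y) YX !(cmul0l, cmul0r).
have key c : 0 <= c -> `|b ** p| <= c -> `|b ** r| <= c -> `|b| <= c.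
  move=> c0 cp cr; rewrite -(@ler_pXn2r _ 2)// ?nnegrE//.
  apply: power_cancel; rewrite ?exprn_ge0// => n.
  rewrite -cnorm_star -/h.
  rewrite -norm_sqr_iter// pow; apply: le_trans (ler_normD _ _) _.
  rewrite !norm_sqr_iter// hpn hrn.
  rewrite mulr_natl mulr2n lerD// lerXn2r ?nnegrE ?exprn_ge0//.
    by rewrite lerXn2r ?nnegrE.
  by rewrite lerXn2r ?nnegrE.
have : `|b ** p| \is Num.real by rewrite normr_real.
move=> /real_leP/(_ (normr_real (b ** r))) [le|le]; [right|left];
  apply: key => //.
exact: ltW.
Qed.

End Split.

(** * Hilbert modules and representations *)
Section HilbertFacts.
Variables (R : realType) (D : cstarAlgType R) (M : hilbertModType D).
Implicit Types (m n p : M) (a b : D).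

Lemma inner0r m : inner m 0 = 0 :> D.
Proof. by rewrite -[X in inner _ X](scale0r (0 : M)) innerZr scale0r. Qed.

Lemma innerNr m n : inner m (- n) = - inner m n :> D.
Proof. by rewrite -scaleN1r innerZr scaleN1r. Qed.

Lemma innerBr m n p : inner m (n - p) = inner m n - inner m p :> D.
Proof. by rewrite innerDr innerNr. Qed.

Lemma innerZl (k : R[i]) m n : inner (k *: m) n = k^* *: inner m n :> D.
Proof. by rewrite -inner_star innerZr starZ inner_star. Qed.

Lemma innerBl m n p : inner (m - n) p = inner m p - inner n p :> D.
Proof. by rewrite -inner_star innerBr starB !inner_star. Qed.

Lemma inner_ractl m n a : inner (ract m a) n = star a ** inner m n :> D.
Proof. by rewrite -inner_star inner_ract starM inner_star. Qed.

Lemma inner0l m : inner 0 m = 0 :> D.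
Proof. by rewrite -inner_star inner0r star0. Qed.

Lemma inner_sumr m (I : Type) (r : seq I) (f : I -> M) :
  inner m (\sum_(i <- r) f i) = \sum_(i <- r) inner m (f i) :> D.
Proof. by apply: big_morph => [x y|]; rewrite ?innerDr ?inner0r. Qed.

Lemma ract_suml (I : Type) (r : seq I) (f : I -> M) a :
  ract (\sum_(i <- r) f i) a = \sum_(i <- r) ract (f i) a.
Proof.
apply: (big_morph (fun m => ract m a)) => [m n|]; first exact: ractDl.
by rewrite -[X in ract X _](scale0r (0 : M)) ractZl scale0r.
Qed.

Lemma norm_ract m a : `|ract m a| <= `|m| * `|a|.
Proof.
rewrite -(@ler_pXn2r _ 2)// ?nnegrE ?mulr_ge0// exprMn (inner_norm (ract m a)).
rewrite inner_ractl inner_ract; apply: le_trans (cnormM _ _) _.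
rewrite norm_star mulrC (expr2 `|a|) mulrA ler_wpM2r// inner_norm.
exact: cnormM.
Qed.

End HilbertFacts.

Section CommutativeCoefficients.
Variables (R : realType) (X : compactHausdorffType).
Variable M : correspondenceType (cfun R X).
Implicit Types (m n p : M) (a b : cfun R X).

Lemma inner_ge0 m w : 0 <= cfun_apply (inner m m) w.
Proof.
have [b ->] := inner_pos m.
have -> : cfun_apply (star b ** b) w = (cfun_apply b w)^* * cfun_apply b w by
  [].
by rewrite mulrC mul_conjC_ge0.
Qed.

(** The coefficients are functions, so the classical argument applies at each
    point w: with z = <m, n>(w), the vector |n|^2 m - z^* n has a nonnegative
    square at w. *)
Lemma cauchy_schwarz m n : `|inner m n : cfun R X| <= `|m| * `|n|.
Proof.
have [->|n0] := eqVneq n 0; first by rewrite inner0r !normr0 mulr0.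
have n2 : 0 < `|n| ^+ 2 by rewrite exprn_gt0 ?normr_gt0.
apply: (@cfun_norm_le R X); first by rewrite mulr_ge0.
move=> w; rewrite -(@ler_pXn2r _ 2)// ?nnegrE ?mulr_ge0//.
set z := cfun_apply (inner m n) w.
have zn : cfun_apply (inner n m) w = z^* by rewrite -inner_star.
have zz : `|z| ^+ 2 = z * z^* by rewrite normCK.
have := inner_ge0 (`|n| ^+ 2 *: m - z^* *: n) w.
have -> : inner (`|n| ^+ 2 *: m - z^* *: n) (`|n| ^+ 2 *: m - z^* *: n)
   = (`|n| ^+ 2 * `|n| ^+ 2) *: inner m m - (`|n| ^+ 2 * z^*) *: inner m n
     - (z * `|n| ^+ 2) *: inner n m + (z * z^*) *: inner n n :> cfun R X.
  rewrite !(innerBl, innerBr, innerZl, innerZr) conjCK.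
  rewrite (conj_Creal (x := `|n| ^+ 2)) ?rpredX ?normr_real// !scalerA.
  by rewrite opprB addrA addrAC.
have -> : cfun_apply ((`|n| ^+ 2 * `|n| ^+ 2) *: inner m m
      - (`|n| ^+ 2 * z^*) *: inner m n
      - (z * `|n| ^+ 2) *: inner n m + (z * z^*) *: inner n n) w
   = (`|n| ^+ 2 * `|n| ^+ 2) * cfun_apply (inner m m) w - `|n| ^+ 2 * z^* * z
     - z * `|n| ^+ 2 * z^* + z * z^* * cfun_apply (inner n n) w.
  by rewrite -zn.
have le (p : M) : cfun_apply (inner p p) w <= `|p| ^+ 2.
  rewrite inner_norm; apply: le_trans (cfun_norm_ge _ w).
  by rewrite ger0_norm ?inner_ge0.
move=> h; rewrite exprMn -(ler_pM2l n2) zz -subr_ge0; apply: le_trans h _.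
have h1 : `|n| ^+ 2 * `|n| ^+ 2 * cfun_apply (inner m m) w
    <= `|n| ^+ 2 * `|n| ^+ 2 * `|m| ^+ 2.
  by rewrite ler_wpM2l ?mulr_ge0 ?exprn_ge0.
have h2 : z * z^* * cfun_apply (inner n n) w <= z * z^* * `|n| ^+ 2.
  by rewrite ler_wpM2l// -zz exprn_ge0.
apply: (le_trans (lerD (lerD (lerD h1 (lexx _)) (lexx _)) h2)).
by rewrite le_eqVlt; apply/orP; left; apply/eqP; ring.
Qed.

Lemma ract1 m : ract m (1%g : cfun R X) = m.
Proof.
apply/eqP; rewrite -subr_eq0 -normr_eq0 -sqrf_eq0; apply/eqP.
rewrite inner_norm innerBr !innerBl !inner_ract !inner_ractl star1 !mul1g
  !mulg1.
by rewrite !subrr normr0.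
Qed.

Lemma lact0 m : lact (0 : cfun R X) m = 0.
Proof. by rewrite -[X in lact X _](scale0r (0 : cfun R X)) lactZl scale0r. Qed.

Lemma lactBr a m n : lact a (m - n) = lact a m - lact a n.
Proof. by rewrite -[- n]scaleN1r lactDr lactZr scaleN1r. Qed.

Lemma lact_sum (I : Type) (r : seq I) (f : I -> cfun R X) m :
  lact (\sum_(i <- r) f i) m = \sum_(i <- r) lact (f i) m.
Proof. by apply: (big_morph (fun a => lact a m)) => [x y|];
  rewrite ?lactDl ?lact0. Qed.

Lemma norm_lact_proj a m : star a = a -> a ** a = a -> `|lact a m| <= `|m|.
Proof.
move=> aS aa; have [->|a0] := eqVneq (lact a m) 0; first by rewrite normr0.
rewrite -(@ler_pM2r _ `|lact a m|) ?normr_gt0// -expr2 inner_norm.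
by rewrite lact_inner aS -lactM aa cauchy_schwarz.
Qed.

Section Completion.
Variables (U : set X) (sigma : X -> X) (cls : (X -> R[i]) -> M).
Hypothesis comp : is_completion U sigma cls.

Lemma cls_dense_in : dense_in (cls @` Cc U).
Proof. exact/dense_inP/(cls_dense comp). Qed.

Lemma Cc0 : Cc U (fun=> 0 : R[i]).
Proof.
split; first by move=> w; exact: cvg_cst.
rewrite [X in closure X](_ : _ = set0) ?closure0; first exact: sub0set.
by apply/seteqP; split=> // w /=; rewrite eqxx.
Qed.

Lemma cls0 : cls (fun=> 0) = 0.
Proof.
have := cls_linear comp (-1) Cc0 Cc0; rewrite scaleN1r addNr => <-.
by congr cls; apply/funext => w; rewrite mulr0 addr0.
Qed.

(** Identities in M are checked against the classes of compactly supported
    functions, where the formulas of [is_completion] are available. *)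
Lemma inner_cls_eq0 m :
  (forall f, Cc U f -> inner (cls f) m = 0 :> cfun R X) -> m = 0.
Proof.
move=> h; have [//|m0] := eqVneq m 0.
have mp : 0 < `|m| by rewrite normr_gt0.
apply: (@norm_eps_eq0 _ _ _ 1) => // e e0; rewrite mul1r.
have [_ [f fC <-] mf] := cls_dense_in m e0.
rewrite -(ler_pM2r mp) -expr2 inner_norm.
have -> : inner m m = inner (m - cls f) m :> cfun R X.
  by rewrite innerBl h// subr0.
by apply: le_trans (cauchy_schwarz _ _) _; rewrite ler_wpM2r// ltW.
Qed.

Lemma inner_cls_eq m n :
  (forall f, Cc U f -> inner (cls f) m = inner (cls f) n :> cfun R X) -> m = n.
Proof.
move=> h; apply/eqP; rewrite -subr_eq0; apply/eqP/inner_cls_eq0 => f fC.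
by rewrite innerBr h// subrr.
Qed.

Lemma lact1 m : lact (1%g : cfun R X) m = m.
Proof.
apply: inner_cls_eq => f fC; rewrite -[1%g]star1 -lact_inner (cls_lact comp)//.
by congr (inner (cls _) _); apply/funext => w; exact: mul1r.
Qed.

Lemma lact_off a m : (forall w, U w -> cfun_apply a w = 0) -> lact a m = 0.
Proof.
move=> aU; apply: inner_cls_eq0 => f fC.
rewrite -[a]starK -lact_inner (cls_lact comp)//.
rewrite [X in cls X](_ : _ = fun=> 0); first by rewrite cls0 ?inner0l.
apply/funext => w; have [->|fw] := eqVneq (f w) 0; first by rewrite mulr0.
change ((cfun_apply a w)^* * f w = 0).
by rewrite aU ?rmorph0 ?mul0r//; case: fC => _; apply; exact: subset_closure.
Qed.

End Completion.
End CommutativeCoefficients.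

Section RepFacts.
Variables (R : realType) (D : cstarAlgType R) (M : correspondenceType D).
Variables (B : cstarAlgType R) (pi : D -> B) (tau : M -> B).
Hypothesis rep : representation pi tau.

Lemma repB m n : tau (m - n) = tau m - tau n.
Proof.
case: rep => _ tl _ _ _.
by rewrite addrC -scaleN1r tl scaleN1r addrC.
Qed.

Lemma rep0 : tau 0 = 0.
Proof. by rewrite -(subrr 0) repB subrr. Qed.

Lemma repZ (k : R[i]) m : tau (k *: m) = k *: tau m.
Proof. by case: (rep) => _ tl _ _ _; rewrite -[k *: m]addr0 tl rep0 addr0. Qed.

Lemma rep_sum (I : Type) (r : seq I) (f : I -> M) :
  tau (\sum_(i <- r) f i) = \sum_(i <- r) tau (f i).
Proof.
apply: big_morph => [m n|]; last exact: rep0.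
by case: (rep) => _ tl _ _ _; rewrite -[m]scale1r tl !scale1r.
Qed.

(** A representation of the module is bounded because |tau m|^2 is the norm of
    the image of <m, m> under pi. *)
Lemma rep_bounded m : `|tau m| <= 2 * `|m|.
Proof.
case: rep => ph _ _ _ ti.
rewrite -(@ler_pXn2r _ 2)// ?nnegrE ?mulr_ge0// -cnorm_star ti.
apply: le_trans (star_hom_bounded ph _) _; rewrite exprMn inner_norm.
by rewrite ler_wpM2r// -natrX ler_nat.
Qed.

Lemma rep_comp (C : cstarAlgType R) (f : B -> C) : star_hom f ->
  representation (f \o pi) (f \o tau).
Proof.
move=> fh; case: rep => ph tl tla tra ti; split => /=.
- split=> [k a b|a b|a] /=.
  + by rewrite (shomP ph) (shomP fh).
  + by rewrite (shomM ph) (shomM fh).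
  + by rewrite (shom_star ph) (shom_star fh).
- by move=> k m n; rewrite tl (shomP fh).
- by move=> a m; rewrite tla (shomM fh).
- by move=> m a; rewrite tra (shomM fh).
- by move=> m n; rewrite -(shom_star fh) -(shomM fh) ti.
Qed.

End RepFacts.

Section Toeplitz.
Variables (R : realType) (D : cstarAlgType R) (M : correspondenceType D).
Variables (T : cstarAlgType R) (iA : D -> T) (iM : M -> T).
Hypothesis hT : is_toeplitz iA iM.

Lemma toeplitz_uniq (B : cstarAlgType R) (f g : T -> B) : star_hom f ->
  star_hom g ->
  (forall a, f (iA a) = g (iA a)) -> (forall m, f (iM m) = g (iM m)) ->
  forall t, f t = g t.
Proof.
move=> fh gh fa fm t; case: hT => rep univ.
have [rho [_ uniq]] := univ B _ _ (rep_comp rep fh).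
have <- : rho = f by apply: uniq; split.
have <- // : rho = g by apply: uniq; split=> // [a|m] /=; rewrite ?fa ?fm.
Qed.

(** Let u = 2 e - 1, a selfadjoint unitary multiplier of T.  The endomorphism
    t |-> u t u fixes the generators, so it is the identity and e is central.
    Then t |-> e t is an endomorphism that fixes the generators, so it is the
    identity as well. *)
Lemma toeplitz_unit (e : T) : e ** e = e -> star e = e ->
  (forall a, e ** iA a = iA a /\ iA a ** e = iA a) ->
  (forall m, e ** iM m = iM m /\ iM m ** e = iM m) -> is_identity e.
Proof.
move=> ee eS ea em.
(* L and Q are the left and right multiplications by 2 e - 1. *)
pose L t := 2 *: (e ** t) - t; pose Q t := 2 *: (t ** e) - t.
have dbl (p : T) : 2 *: p - p = p by rewrite scaler_nat mulr2n addrK.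
have back (p t : T) : 2 *: (2 *: p - p) - (2 *: p - t) = t.
  by rewrite dbl opprB addrC subrK.
have two : (2 : R[i])^* = 2 by rewrite conj_Creal// realn.
have LL t : L (L t) = t by rewrite {1}/L cmulBr cscaleAr mulgA ee back.
have LQ t : L (Q t) = Q (L t).
  rewrite /L /Q cmulBr cmulBl cscaleAr cscaleAl !scalerBr mulgA !opprB.
  by rewrite addrACA [RHS]addrACA [- _ - _]addrC.
have LM t u : L t ** u = L (t ** u) by rewrite /L cmulBl cscaleAl mulgA.
have QM t u : t ** Q u = Q (t ** u) by rewrite /Q cmulBr cscaleAr mulgA.
have QL t u : Q t ** L u = t ** u.
  rewrite -[RHS](back (t ** e ** u)) /Q /L cmulBl !cmulBr !cscaleAl !cscaleAr.
  by rewrite !mulgA -(mulgA t e e) ee scalerBr.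
have Llin (k : R[i]) a b : L (k *: a + b) = k *: L a + L b.
  rewrite /L cmulDr cscaleAr scalerDr opprD addrACA scalerBr.
  by rewrite !scalerA [2 * k]mulrC.
have Qlin (k : R[i]) a b : Q (k *: a + b) = k *: Q a + Q b.
  rewrite /Q cmulDl cscaleAl scalerDr opprD addrACA scalerBr.
  by rewrite !scalerA [2 * k]mulrC.
have Lstar a : star (L a) = Q (star a).
  by rewrite /L /Q starB starZ starM eS two.
have Qstar a : star (Q a) = L (star a).
  by rewrite /L /Q starB starZ starM eS two.
have fh : star_hom (L \o Q).
  split=> [k a b|a b|a] /=; first by rewrite Qlin Llin.
  - by rewrite LM (LQ b) QM QL.
  - by rewrite Lstar Qstar LQ.
have idh : star_hom (fun t : T => t) by split.
have Lfix t : e ** t = t -> L t = t by rewrite /L => ->; exact: dbl.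
have Qfix t : t ** e = t -> Q t = t by rewrite /Q => ->; exact: dbl.
have conj_id t : L (Q t) = t.
  apply: (toeplitz_uniq fh idh) => [a|m] /=.
    by have [h1 h2] := ea a; rewrite Qfix// Lfix.
  by have [h1 h2] := em m; rewrite Qfix// Lfix.
have central t : e ** t = t ** e.
  have : L t = Q t by rewrite -[in LHS](conj_id t) LL.
  by move=> /addIr /scalerI; apply; rewrite pnatr_eq0.
have gh : star_hom (fun t : T => e ** t).
  split=> [k a b|a b|a].
  - by rewrite cmulDr cscaleAr.
  - by rewrite [RHS]mulgA -(central (e ** a)) !mulgA ee.
  - by rewrite starM eS central.
have el t : e ** t = t.
  by apply: (toeplitz_uniq gh idh) => [a|m]; [case: (ea a)|case: (em m)].
by move=> t; rewrite -central el.
Qed.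

End Toeplitz.

Section WithUnit.
Variables (R : realType) (O : cstarAlgType R) (e : O).

(** A copy of O on which the identity e is the unit of the monoid structure.
    The proof that e is an identity is part of the type, so that the unital
    structure can be found by unification. *)
Definition with_unit of is_identity e : Type := O.

Variable he : is_identity e.
HB.instance Definition _ := CStarAlgebra.copy (with_unit he) O.

Fact with_unit_mul1 : left_id (e : with_unit he) (@monoid.mul _).
Proof. by move=> a; have [] := he a. Qed.
Fact with_unit_mulr1 : right_id (e : with_unit he) (@monoid.mul _).
Proof. by move=> a; have [] := he a. Qed.

HB.instance Definition _ := Magma_isUMagma.Build (with_unit he)
  with_unit_mul1 with_unit_mulr1.

End WithUnit.

(** * Range projections of reduced words *)
Section Words.
Variables (R : realType) (G : choiceType) (A : G -> G -> bool).
Variables (B : unitalCStarAlgType R) (S : G -> B).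
Hypothesis rel : OA_relations A S.
Implicit Types (a : letter G) (w v : seq (letter G)) (x y : G).

Definition letter_op a : B := if a.2 then S a.1 else star (S a.1).

(** This is S_w S_w^*, where S_w is the product of the operators of the letters
    of w. *)
Definition word_proj w : B := foldr (fun a b => letter_op a ** b
  ** star (letter_op a)) 1%g w.

Lemma word_proj_nil : word_proj [::] = 1%g.
Proof. by []. Qed.

Lemma word_proj_cons a w : word_proj (a :: w) = letter_op a
  ** word_proj w ** star (letter_op a).
Proof. by []. Qed.

Arguments word_proj : simpl never.

Lemma letter_op_flip a : letter_op (flip a) = star (letter_op a).
Proof. by case: a => x [] //=; rewrite /letter_op /= starK. Qed.

Lemma letter_op_pisom a : letter_op a ** star (letter_op a) ** letter_op a
  = letter_op a.
Proof.
case: a => x []; rewrite /letter_op /= ?starK;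
  first exact: (OA_partial_isometry rel).
by rewrite -[in RHS](OA_partial_isometry rel x) !starM starK mulgA.
Qed.

Lemma star_letter_op_pisom a : star (letter_op a) ** letter_op a
  ** star (letter_op a) = star (letter_op a).
Proof. by have := letter_op_pisom (flip a); rewrite letter_op_flip starK. Qed.

Lemma word_proj_letter a : word_proj [:: a] = letter_op a ** star (letter_op a).
Proof. by rewrite word_proj_cons mulg1. Qed.

Lemma word_proj_flip a : word_proj [:: flip a] = star (letter_op a)
  ** letter_op a.
Proof. by rewrite word_proj_letter letter_op_flip starK. Qed.

Lemma star_word_proj w : star (word_proj w) = word_proj w.
Proof. by elim: w => [|a w IH]; rewrite ?star1// word_proj_cons !starM starK IH
  mulgA. Qed.

Lemma OA_orth x y : x != y -> star (S x) ** S y = 0.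
Proof. exact: (OA_orthogonal rel). Qed.

(** If w is z w', then z differs from x and S_x^* S_z = 0.  If it begins with
    the inverse of z, then by induction the projection of w is 0 or S_z^* S_z,
    and the matrix relation gives S_x^* (S_z^* S_z) S_x = A(z, x) S_x^* S_x. *)
Lemma word_proj_neg x w : reduced ((x, false) :: w) ->
  word_proj ((x, false) :: w) = 0 \/ word_proj ((x, false) :: w)
    = star (S x) ** S x.
Proof.
elim: w x => [|[z b] w IHw] x; first by move=> _; right;
  rewrite word_proj_cons /letter_op mulg1 starK.
rewrite word_proj_cons => r; have /andP[zx zw] := r; case: b zx zw {r} => zx zw.
  left; rewrite word_proj_cons /letter_op /= !mulgA OA_orth ?cmul0l//.
  by apply: contraNN zx => /eqP->.
have [->|->] := IHw z zw; first by left; rewrite cmul0r cmul0l.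
rewrite /letter_op /= starK -mulgA (OA_matrix rel) cscaleAr.
by case: (A z x); [right; rewrite scale1r|left; rewrite scale0r].
Qed.

(** When w begins with y, S_x^* S_x S_y = A(x, y) S_y makes the left-hand side a
    real multiple of a selfadjoint element. *)
Lemma source_word_proj x w : reduced w ->
  star (S x) ** S x ** word_proj w = word_proj w ** (star (S x) ** S x).
Proof.
case: w => [|[y []] w] rw; first by rewrite mul1g mulg1.
  have l : star (S x) ** S x ** word_proj ((y, true) :: w)
      = ((A x y)%:R : R[i]) *: word_proj ((y, true) :: w).
    by rewrite !word_proj_cons /letter_op /= !mulgA (OA_matrix rel) !cscaleAl.
  have qs : star (star (S x) ** S x) = star (S x) ** S x by rewrite starM starK.
  rewrite l -[RHS]starK starM qs star_word_proj l starZ star_word_proj.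
  by rewrite conj_Creal// realn.
have [->|->] := word_proj_neg rw; first by rewrite cmul0l cmul0r.
exact: (OA_commute rel).
Qed.

Lemma word_proj_comm w v : reduced w -> reduced v -> word_proj w
  ** word_proj v = word_proj v ** word_proj w.
Proof.
elim: w v => [|[x []] w IHw] v rw rv; first by rewrite mul1g mulg1.
  have rw' : reduced w by exact: path_sorted rw.
  case: v rv => [|[y []] v] rv; first by rewrite mul1g mulg1.
    have rv' : reduced v by exact: path_sorted rv.
    have [<-|xy] := eqVneq x y.
      rewrite !word_proj_cons /letter_op /=; set e := word_proj w; set f :=
        word_proj v; set s := S x.
      have q_e : star s ** s ** e = e ** (star s
        ** s) by exact: source_word_proj.
      have q_f : star s ** s ** f = f ** (star s
        ** s) by exact: source_word_proj.
      have ef : e ** f = f ** e by exact: IHw.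
      have -> : s ** e ** star s ** (s ** f ** star s)
          = s ** (e ** (star s ** s) ** f) ** star s by rewrite !mulgA.
      by rewrite -q_e -(mulgA _ e f) ef (mulgA _ f e) q_f !mulgA.
    rewrite !word_proj_cons /letter_op /= !mulgA -(mulgA _ (star (S x)) (S y))
      OA_orth//.
    rewrite -(mulgA _ (star (S y)) (S x)) OA_orth 1?eq_sym//.
    by rewrite !(cmul0l, cmul0r).
  have [->|->] := word_proj_neg rv; first by rewrite cmul0l cmul0r.
  by rewrite source_word_proj.
have [->|->] := word_proj_neg rw; first by rewrite cmul0l cmul0r.
by rewrite source_word_proj.
Qed.

Lemma word_proj_idem w : reduced w -> word_proj w ** word_proj w = word_proj w.
Proof.
elim: w => [|[x []] w IHw] rw; first by rewrite mul1g.
  have rw' : reduced w by exact: path_sorted rw.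
  rewrite !word_proj_cons /letter_op /=; set e := word_proj w; set s := S x.
  have -> : s ** e ** star s ** (s ** e ** star s)
      = s ** (e ** (star s ** s)) ** e ** star s by rewrite !mulgA.
  rewrite -source_word_proj// -/s -/e !mulgA (OA_partial_isometry rel) -!mulgA.
  by rewrite [e ** (e ** _)]mulgA IHw.
have [->|->] := word_proj_neg rw; first by rewrite cmul0l.
by rewrite !mulgA (star_letter_op_pisom (x, true)).
Qed.

(** This commutation rule makes conjugation by the operator of a letter
    multiplicative on word projections ([conj_letter_opM]). *)
Lemma letter_op_word_proj a w : reduced w -> letter_op a ** word_proj w
  = letter_op a ** word_proj w ** star (letter_op a) ** letter_op a.
Proof.
move=> rw; rewrite -[in LHS](letter_op_pisom a) -!mulgA; congr (_ ** _).
have := @word_proj_comm [:: flip a] w isT rw; rewrite word_proj_flip => <-.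
by rewrite mulgA.
Qed.

Lemma conj_letter_opM a w (b : B) : reduced w ->
  letter_op a ** (word_proj w ** b) ** star (letter_op a)
  = letter_op a ** word_proj w ** star (letter_op a) ** (letter_op a ** b
    ** star (letter_op a)).
Proof. by move=> rw; rewrite !mulgA -letter_op_word_proj. Qed.

Lemma word_proj_cat w v : reduced (w ++ v) -> word_proj w
  ** word_proj (w ++ v) = word_proj (w ++ v).
Proof.
elim: w => [|a w IHw] rwv; first by rewrite mul1g.
have rwv' : reduced (w ++ v) by exact: path_sorted rwv.
have rw : reduced w.
  by move: rwv'; rewrite /reduced; case: (w) => //= b u;
    rewrite cat_path => /andP[].
by rewrite !word_proj_cons -conj_letter_opM// IHw.
Qed.

(** The relation S_a e_s S_a^* = e_(a s) e_a of a partial representation, whether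
    or not the letter a cancels in a s. *)
Lemma word_proj_push a w : reduced w ->
  letter_op a ** word_proj w ** star (letter_op a) = word_proj (push a w)
    ** word_proj [:: a].
Proof.
move=> rw; have rp := reduced_push a rw.
case: w rw rp => [|b w] rw rp; first by rewrite !word_proj_cons word_proj_nil
  !mulg1 !mulgA letter_op_pisom.
rewrite /push in rp *; case: eqVneq rp rw => [->|ba] rp rw.
  have -> : letter_op a ** word_proj (flip a :: w) ** star (letter_op a)
      = word_proj [:: a] ** word_proj w ** word_proj [:: a].
    by rewrite word_proj_letter word_proj_cons letter_op_flip starK !mulgA.
  by rewrite (@word_proj_comm [:: a] w)// -mulgA word_proj_idem.
by rewrite -/(word_proj (a :: b :: w)) word_proj_comm// (@word_proj_cat [:: a]
  (b :: w)).
Qed.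

End Words.

(** * Words in the free group *)
Section FreeWords.
Variable G : choiceType.
Local Notation F := (free_group G).
Implicit Types (a : letter G) (t s : F).

Definition fg_letter a : F := if a.2 then gen a.1 else (gen a.1)^-1%g.

Lemma word_letter a : word (fg_letter a) = [:: a].
Proof. by case: a => x []. Qed.

Lemma word_letterM a t : word (fg_letter a * t)%g = push a (word t).
Proof.
rewrite -[LHS]/(foldr (@push G) (word t) (word (fg_letter a))).
by rewrite word_letter.
Qed.

Lemma word_cons t a w : word t = a :: w ->
  exists2 t', t = (fg_letter a * t')%g & word t' = w.
Proof.
move=> tw; have rt := word_reduced t; rewrite tw in rt.
have rw : reduced w by exact: path_sorted rt.
exists (FreeGroup rw) => //; apply: val_inj; rewrite -[LHS]/(word t) tw.
by rewrite -[RHS]/(word (fg_letter a * FreeGroup rw)%g) word_letterM push_cons.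
Qed.

(** Induction that adds a letter on the left without cancellation. *)
Lemma fg_ind (P : F -> Prop) : P 1%g ->
  (forall a t, reduced (a :: word t) -> P t -> P (fg_letter a * t)%g) ->
  forall t, P t.
Proof.
move=> P1 PS t; move: {2}(word t) (erefl (word t)) => w.
elim: w t => [|a w IHw] t tw.
  by rewrite (_ : t = 1%g)//; exact: val_inj.
have [t' -> t'w] := word_cons tw; apply: PS; last exact: IHw.
by rewrite t'w -tw word_reduced.
Qed.

Lemma size_push a (w : seq (letter G)) : (size (push a w) <= (size w).+1)%N.
Proof. by case: w => //= b w; case: ifP => //= _; rewrite ltnW// ltnW. Qed.

(** Each letter of t either lengthens s or shortens it, so the lengths add up
    only if no cancellation occurs. *)
Lemma word_cat t s : word_length (t * s)%g = (word_length t
  + word_length s)%N ->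
  word (t * s)%g = word t ++ word s.
Proof.
have szf (u w : seq (letter G)) : (size (foldr (@push G) w u) <= size u
  + size w)%N.
  elim: u => //= a u IHu; apply: leq_trans (size_push _ _) _.
  by rewrite addSn ltnS.
rewrite /word_length -[word (t * s)%g]/(foldr (@push G) (word s) (word t)).
elim: (word t) => //= a u IHu.
move: (szf u (word s)) IHu; case: foldr => [|b r] /=.
  by move=> _ IHu [/IHu <-].
case: ifP => _ /= le IHu.
  by move=> sz; move: le; rewrite -ltnS in sz *; rewrite sz addSn ltnNge leqW.
by move=> [/IHu] <-.
Qed.

End FreeWords.

(** * Spectral subsets of the free group *)
Section AXYFacts.
Variables (R : realType) (G : choiceType) (A : G -> G -> bool).
Implicit Types (X Y : {fset G}) (j : G).

Lemma prod_natb (I : Type) (r : seq I) (b : I -> bool) :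
  \prod_(i <- r) (b i)%:R = (all b r)%:R :> R[i].
Proof.
elim: r => [|i r IHr]; first by rewrite big_nil.
by rewrite big_cons IHr /= -mulnb natrM.
Qed.

Lemma onem_natb (b : bool) : 1 - b%:R = (~~ b)%:R :> R[i].
Proof. by case: b; rewrite ?subrr ?subr0. Qed.

Lemma AXYE X Y j : AXY R A X Y j =
  (all (A^~ j) X && all (fun y => ~~ A y j) Y)%:R.
Proof.
rewrite /AXY prod_natb; under eq_bigr do rewrite onem_natb.
by rewrite prod_natb -mulnb natrM.
Qed.

Lemma sum_AXY (V : lmodType R[i]) (f : G -> V) X Y
    (fin : finite_set [set j | AXY R A X Y j != 0]) :
  \sum_(j \in [set: G]) AXY R A X Y j *: f j
  = \sum_(j <- fset_set [set j | AXY R A X Y j != 0]) f j.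
Proof.
rewrite (fsbigE (fset_set [set j | AXY R A X Y j != 0]))//.
- rewrite big_seq_cond [RHS]big_seq_cond;
  under eq_bigl do rewrite in_setT andbT.
  under [RHS]eq_bigl do rewrite andbT.
  apply: eq_bigr => j; rewrite in_fset_set// inE /= AXYE.
  by case: (_ && _); rewrite ?scale1r// eqxx.
- move=> j _; rewrite in_fset_set// notin_setE /= => /negP/negPn/eqP ->.
  by rewrite scale0r.
Qed.

End AXYFacts.

Section Spectrum.
Variables (R : realType) (G : choiceType) (A : G -> G -> bool).
Variables (B : unitalCStarAlgType R) (S : G -> B).
Hypothesis rel : OA_relations A S.
Local Notation F := (free_group G).
Implicit Types (t : F) (s : seq F) (xi om : F -> bool) (x y : G).

Definition elt_proj t : B := word_proj S (word t).

Definition lit t (b : bool) : B := if b then elt_proj t else 1%g - elt_proj t.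

(** The product over t in s of e_t or 1 - e_t, according to whether t belongs to
    xi: a minimal projection of the algebra generated by the e_t for t in s, or
    0. *)
Definition atom xi s : B := foldr (fun t b => lit t (xi t) ** b) 1%g s.

Lemma atom_cons xi t s : atom xi (t :: s) = lit t (xi t) ** atom xi s.
Proof. by []. Qed.

Arguments atom : simpl never.

Lemma elt_proj1 : elt_proj 1%g = 1%g.
Proof. by []. Qed.

Lemma elt_proj_star t : star (elt_proj t) = elt_proj t.
Proof. exact: star_word_proj. Qed.

Lemma elt_proj_comm t u : elt_proj t ** elt_proj u = elt_proj u ** elt_proj t.
Proof. by rewrite (word_proj_comm rel) ?word_reduced. Qed.

Lemma elt_proj_idem t : elt_proj t ** elt_proj t = elt_proj t.
Proof. by rewrite (word_proj_idem rel) ?word_reduced. Qed.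

Lemma elt_proj_gen x : elt_proj (gen x) = S x ** star (S x).
Proof. exact: (word_proj_letter S (x, true)). Qed.

Lemma elt_proj_genV x : elt_proj (gen x)^-1%g = star (S x) ** S x.
Proof. exact: (word_proj_flip S (x, true)). Qed.

Lemma comm_lit (b : B) t c : b ** elt_proj t = elt_proj t ** b -> b
  ** lit t c = lit t c ** b.
Proof. by case: c => //= bt; rewrite cmulBr cmulBl mulg1 mul1g bt. Qed.

Lemma comm_atom (b : B) xi s : (forall t, b ** elt_proj t = elt_proj t ** b) ->
  b ** atom xi s = atom xi s ** b.
Proof.
move=> bP; elim: s => [|t s IHs]; first by rewrite mul1g mulg1.
by rewrite !atom_cons mulgA (comm_lit _ (bP t)) -!mulgA IHs.
Qed.

Lemma lit_comm t b u c : lit t b ** lit u c = lit u c ** lit t b.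
Proof. by apply: comm_lit; apply/esym; apply: comm_lit;
  exact: elt_proj_comm. Qed.

Lemma lit_idem t b : lit t b ** lit t b = lit t b.
Proof.
case: b => /=; first exact: elt_proj_idem.
by rewrite cmulBr mulg1 cmulBl mul1g elt_proj_idem subrr subr0.
Qed.

Lemma lit_star t b : star (lit t b) = lit t b.
Proof. by case: b; rewrite /= ?starB ?star1 elt_proj_star. Qed.

Lemma elt_proj_lit t b : elt_proj t ** lit t b = (b%:R : R[i]) *: lit t b.
Proof.
case: b; rewrite /= ?scale1r ?scale0r ?elt_proj_idem//.
by rewrite cmulBr mulg1 elt_proj_idem subrr.
Qed.

Lemma lit_atom_comm t b xi s : lit t b ** atom xi s = atom xi s ** lit t b.
Proof.
by apply: comm_atom => u; apply/esym/comm_lit; exact: elt_proj_comm.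
Qed.

Lemma lit_atom t xi s : t \in s -> lit t (xi t) ** atom xi s = atom xi s.
Proof.
elim: s => //= u s IHs; rewrite inE atom_cons => /predU1P[->|/IHs ts].
  by rewrite mulgA lit_idem.
by rewrite mulgA lit_comm -mulgA ts.
Qed.

Lemma elt_proj_atom t xi s : t \in s ->
  elt_proj t ** atom xi s = ((xi t)%:R : R[i]) *: atom xi s.
Proof. by move=> ts; rewrite -(lit_atom xi ts) mulgA elt_proj_lit cscaleAl. Qed.

Lemma atom_sub xi s s' : {subset s <= s'} -> atom xi s ** atom xi s'
  = atom xi s'.
Proof.
elim: s => [|t s IHs] ss'; first by rewrite mul1g.
rewrite atom_cons -mulgA IHs ?lit_atom ?ss' ?mem_head// => u us.
by rewrite ss'// inE us orbT.
Qed.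

Lemma atom_star xi s : star (atom xi s) = atom xi s.
Proof.
elim: s => [|t s IHs]; first exact: star1.
by rewrite !atom_cons starM IHs lit_star lit_atom_comm.
Qed.

Lemma atom_norm xi s : `|atom xi s| <= 1.
Proof.
have [->|a0] := eqVneq (atom xi s) 0; first by rewrite normr0.
rewrite -(@ler_pM2r _ `|atom xi s|) ?normr_gt0// mul1r -expr2 -cnorm_star.
by rewrite atom_star atom_sub.
Qed.

Lemma atom_cat xi s s' : atom xi (s ++ s') = atom xi s ** atom xi s'.
Proof.
by elim: s => [|t s IHs]; rewrite ?mul1g//= !atom_cons IHs mulgA.
Qed.

Lemma eq_atom xi om s : {in s, xi =1 om} -> atom xi s = atom om s.
Proof.
elim: s => //= t s IHs h; rewrite !atom_cons h ?mem_head// IHs// => u us.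
by rewrite h// inE us orbT.
Qed.

(** These subsets are the characters of the commutative algebra generated by the
    e_t: the product of the factors is nonzero on every finite set of words. *)
Definition spectral xi := forall s, atom xi s != 0.

Lemma atom_subN0 xi s s' : {subset s <= s'} -> atom xi s' != 0 ->
  atom xi s != 0.
Proof.
by move=> ss'; apply: contraNN => /eqP s0; rewrite -(atom_sub xi ss') s0 cmul0l.
Qed.

(** Conjugation by the operator of a carries the atom of the translate along s
    to the atom of xi along a s, multiplied by e_a, which is a factor of the
    latter since a belongs to xi. *)
Lemma spectral_letter xi (a : letter G) : spectral xi -> xi (fg_letter a) ->
  spectral (fun t => xi (fg_letter a * t)%g).
Proof.
move=> xiP xia s; pose la := fg_letter a.
have := xiP (la :: map (fun t => la * t)%g s); apply: contraNN => /eqP s0.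
suff <- : letter_op S a ** atom (fun t => xi (la * t)%g) s
  ** star (letter_op S a)
   = atom xi (la :: [seq (la * t)%g | t <- s]) by rewrite s0 cmul0r cmul0l.
have pla : elt_proj la = letter_op S a ** star (letter_op S a) by rewrite
  /elt_proj word_letter word_proj_letter.
elim: s {s0} => [|t s IHs].
  by rewrite /= atom_cons xia /= pla !mulg1.
have tr : letter_op S a ** elt_proj t ** star (letter_op S a)
  = elt_proj (la * t)%g ** elt_proj la.
  by rewrite (word_proj_push rel) ?word_reduced// /elt_proj word_letterM
    word_letter.
have lt b : letter_op S a ** lit t b = letter_op S a ** lit t b
  ** star (letter_op S a) ** letter_op S a.
  case: b => /=; first by rewrite -(letter_op_word_proj rel) ?word_reduced.
  rewrite cmulBr mulg1 !cmulBl -(letter_op_word_proj rel) ?word_reduced//.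
  by rewrite (letter_op_pisom rel).
have trl b : letter_op S a ** lit t b ** star (letter_op S a)
  = lit (la * t)%g b ** elt_proj la.
  case: b => //=; rewrite cmulBr mulg1 !cmulBl mul1g tr.
  by rewrite -pla.
have -> : letter_op S a ** atom (fun t => xi (la * t)%g) (t :: s)
  ** star (letter_op S a)
    = lit (la * t)%g (xi (la * t)%g) ** elt_proj la
      ** (letter_op S a ** atom (fun t => xi (la * t)%g) s
        ** star (letter_op S a)).
  by rewrite -trl atom_cons !mulgA -lt.
rewrite IHs /= !atom_cons xia /= !mulgA; congr (_ ** _).
rewrite -[_ ** elt_proj la ** elt_proj la]mulgA elt_proj_idem.
exact: (lit_comm _ _ _ true).
Qed.

Lemma spectral_translate xi t : spectral xi -> xi t -> spectral (fun u :
  F => xi (t * u)%g).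
Proof.
elim/fg_ind: t xi => [|a t rat IHt] xi xiP xit.
  by rewrite (_ : (fun u : F => _) = xi)//; apply/funext => u; rewrite mul1g.
(* A spectral set is closed under prefixes, since e_a e_(a t) = e_(a t). *)
have xia : xi (fg_letter a).
  have := xiP [:: fg_letter a; fg_letter a * t]%g.
  rewrite !atom_cons xit; case: (xi (fg_letter a)) => //=.
  rewrite mulgA cmulBl mul1g /elt_proj word_letterM word_letter push_cons//.
  have -> : word_proj S [:: a] ** word_proj S (a :: word t)
    = word_proj S (a :: word t).
    exact: (word_proj_cat rel (w := [:: a])).
  by rewrite subrr cmul0l eqxx.
have -> : (fun u : F => xi (fg_letter a * t * u)%g)
    = (fun u : F => xi (fg_letter a * (t * u))%g).
  by apply/funext => u; rewrite mulgA.
exact: (IHt (fun u : F => xi (fg_letter a * u)%g) (spectral_letter xiP xia)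
  xit).
Qed.

Lemma spectral_one xi : spectral xi -> xi 1%g.
Proof.
move=> /(_ [:: 1%g]); rewrite atom_cons; case: (xi 1%g) => //=.
by rewrite elt_proj1 subrr cmul0l eqxx.
Qed.

Lemma spectral_gen_uniq xi x y : spectral xi -> xi (gen x) -> xi (gen y) ->
  x = y.
Proof.
move=> xiP xix xiy; apply/eqP/negPn/negP => xy.
have := xiP [:: gen x; gen y]; rewrite !atom_cons xix xiy /= !elt_proj_gen
  !mulgA.
by rewrite -(mulgA _ (star (S x))) (OA_orth rel xy) !(cmul0l, cmul0r) eqxx.
Qed.

Lemma spectral_matrix xi x y : spectral xi -> xi (gen y) ->
  xi (gen x)^-1%g = A x y.
Proof.
move=> xiP xiy; have := xiP [:: (gen x)^-1; gen y]%g.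
rewrite !atom_cons xiy /= elt_proj_gen mulgA.
have qp : elt_proj (gen x)^-1%g ** (S y ** star (S y))
    = ((A x y)%:R : R[i]) *: (S y ** star (S y)).
  by rewrite elt_proj_genV mulgA (OA_matrix rel) cscaleAl.
case: (xi _); rewrite /lit ?cmulBl ?mul1g qp; case: (A x y) => //.
  by rewrite scale0r cmul0l eqxx.
by rewrite scale1r subrr eqxx.
Qed.

Lemma atom_map xi (I : Type) (r : seq I) (f : I -> F) (b : bool) :
  all (fun i => xi (f i) == b) r -> atom xi (map f r)
    = (\prod_(i <- r) lit (f i) b)%g.
Proof.
elim: r => [|i r IHr] /=; first by rewrite big_nil.
by move=> /andP[/eqP ib /IHr h]; rewrite big_cons atom_cons ib h.
Qed.

(** Otherwise all factors 1 - S_j S_j^* occur in an atom, whose product with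
    sum_j S_j S_j^* vanishes; the finiteness relation identifies this sum with
    other factors of the same atom. *)
Lemma spectral_finite xi (X Y : {fset G}) : spectral xi ->
  finite_set [set j | AXY R A X Y j != 0] ->
  all (fun x => xi (gen x)^-1%g) X -> all (fun y => ~~ xi (gen y)^-1%g) Y ->
  exists j, xi (gen j).
Proof.
move=> xiP fin hX hY; apply: contrapT => no.
have no' j : xi (gen j) = false by apply/negP => xj; apply: no; exists j.
set J := fset_set [set j | AXY R A X Y j != 0].
have := xiP (map (fun x => (gen x)^-1%g) X ++ map (fun x => (gen x)^-1%g) Y
             ++ map (@gen G) J).
rewrite !atom_cat (@atom_map _ _ X _ true); last first.
  by apply: sub_all hX => x ->.
rewrite (@atom_map _ _ Y _ false); last by apply: sub_all hY => x /negPf->.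
rewrite mulgA /=.
have -> : (\prod_(i <- X) elt_proj (gen i)^-1
  ** \prod_(i <- Y) (1%g - elt_proj (gen i)^-1))%g
   = \sum_(j <- J) S j ** star (S j).
  rewrite -sum_AXY// -(OA_finite rel)//.
  by congr (_ ** _); apply: eq_bigr => i _; rewrite elt_proj_genV.
rewrite cmul_suml big_seq big1 ?eqxx// => j jJ.
rewrite -elt_proj_gen elt_proj_atom ?map_f// no' scale0r//.
Qed.

(** Each relation between the S_x excludes the patterns of membership on which
    the corresponding function of [RA] would not vanish. *)
Lemma spectral_RA xi (f : subsets G -> R[i]) : spectral xi -> RA A f ->
  f xi = 0.
Proof.
move=> xiP; case=> {f} [x y xy|x y|t s ts|X Y fin].
- rewrite /ind; case xix : (xi (gen x)); last by rewrite mul0r.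
  case xiy : (xi (gen y)); last by rewrite mulr0.
  by move: xy; rewrite (spectral_gen_uniq xiP xix xiy) eqxx.
- rewrite /ind; case xiy : (xi (gen y)); last by rewrite !mulr0 subrr.
  by rewrite (spectral_matrix x xiP xiy) subrr.
- rewrite /ind; case xits : (xi (t * s)%g); last by rewrite mul0r subrr.
  case xit : (xi t); first by rewrite mulr1 subrr.
  have := xiP [:: t; (t * s)%g]; rewrite !atom_cons xit xits /= mulgA cmulBl
    mul1g.
  rewrite /elt_proj word_cat// (word_proj_cat rel);
    first by rewrite subrr cmul0l eqxx.
  by rewrite -word_cat// word_reduced.
- rewrite /ind (prod_natb _ X (fun x => xi (gen x)^-1%g)).
  under [X in _ * X - _]eq_bigr do rewrite onem_natb.
  rewrite (prod_natb _ Y (fun x => ~~ xi (gen x)^-1%g)).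
  case: (pselect (exists j, xi (gen j))) => [[j xj]|no].
    rewrite -(fsbig_widen [set j] [set: G])//; last first.
      move=> i [_ /= ij]; case xi_i : (xi (gen i)); last by rewrite mulr0.
      by case: ij; exact: spectral_gen_uniq xi_i xj.
    rewrite fsbig_set1 xj mulr1 AXYE.
    rewrite (eq_all (fun i => spectral_matrix i xiP xj)).
    rewrite (@eq_all _ (fun y => ~~ xi (gen y)^-1%g) (fun y => ~~ A y j));
      last first.
      by move=> i; rewrite (spectral_matrix i xiP xj).
    by rewrite -natrM mulnb subrr.
  rewrite fsbig1; last first.
    by move=> j _; case xj : (xi (gen j)); [case: no; exists j|rewrite mulr0].
  rewrite subr0; apply/eqP; rewrite -natrM mulnb pnatr_eq0 eqb0; apply/negP.
  by move=> /andP[hX hY]; apply: no; exact: spectral_finite hX hY.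
Qed.

(** [OmegaA] imposes the relations on all translates of xi by its elements, and
    these translates are again spectral. *)
Lemma spectral_OmegaA xi : spectral xi -> OmegaA_set R A xi.
Proof.
move=> xiP; split; first exact: spectral_one.
move=> t f xit; apply: spectral_RA; rewrite /translate invgK.
exact: spectral_translate.
Qed.

End Spectrum.

Section Points.
Variables (R : realType) (G : choiceType) (A : G -> G -> bool).
Variables (B : unitalCStarAlgType R) (S : G -> B).
Hypothesis rel : OA_relations A S.
Local Notation F := (free_group G).

Lemma subsets_cylinder_nbhs (xi : subsets G) (s : seq F) :
  nbhs xi [set om : subsets G | {in s, om =1 xi}].
Proof.
elim: s => [|t s IHs]; first by apply: filterS filterT => om _ u;
  rewrite in_nil.
have ht : nbhs xi [set om : subsets G | om t = xi t].
  have pc := @proj_continuous F (fun _ => bool) t xi.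
  by apply: (pc [set b | b = xi t]); exact: discrete_set1.
apply: filterS (filterI ht IHs) => om [omt oms] u.
by rewrite inE => /predU1P[->|/oms].
Qed.

(** Since atom xi s is nonzero and is the sum of its products with e_t and with
    1 - e_t, the choice on s extends to any finite set.  The extensions that are
    good for larger and larger finite sets generate a filter, and any of its
    cluster points is spectral. *)
Lemma spectral_extension (xi : F -> bool) (s : seq F) : atom S xi s != 0 ->
  exists2 om : subsets G, spectral S om & {in s, om =1 xi}.
Proof.
move=> xis.
pose C s' := [set om : subsets G | {in s, om =1 xi} /\ atom S om s' != 0].
have C0 s' : C s' !=set0.
  suff [om [oms omN]] : exists om : subsets G,
      {in s, om =1 xi} /\ atom S om (s' ++ s) != 0.
    exists om; split=> //; apply: (atom_subN0 rel _ omN) => u us.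
    by rewrite mem_cat us.
  elim: s' => [|t s' [om [oms omN]]]; first by exists xi; split.
  have [ts|ts] := boolP (t \in s' ++ s).
    exists om; split=> //; rewrite cat_cons atom_cons.
    by rewrite (lit_atom rel).
  pose up b : subsets G := fun u => if u == t then b else om u.
  have ups b : {in s, up b =1 xi}.
    move=> u us; rewrite /up ifN ?oms//; apply: contraNN ts => /eqP <-.
    by rewrite mem_cat us orbT.
  have upa b : atom S (up b) (t :: s' ++ s) = lit S t b ** atom S om (s' ++ s).
    rewrite atom_cons {1}/up eqxx; congr (_ ** _); apply: eq_atom => u us.
    by rewrite /up ifN//; apply: contraNN ts => /eqP <-.
  have [h|h] := eqVneq (lit S t true ** atom S om (s' ++ s)) 0; last first.
    by exists (up true); split=> //; rewrite cat_cons upa.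
  exists (up false); split=> //; rewrite cat_cons upa /=.
  by rewrite cmulBl mul1g [X in _ - X]h subr0.
pose H := filter_from [set: seq F] C.
have HF : ProperFilter H.
  apply: filter_from_proper => //; apply: filter_fromT_filter.
    by exists [::].
  move=> s1 s2; exists (s1 ++ s2) => om [oms omN]; split; split=> //.
    by apply: (atom_subN0 rel _ omN) => u us; rewrite mem_cat us.
  by apply: (atom_subN0 rel _ omN) => u us; rewrite mem_cat us orbT.
have [om [_ clom]] := @subsets_compact G H HF filterT.
exists om => [s'|].
  have [|om' [[_ omN] e]] := clom (C s') _ _ (subsets_cylinder_nbhs om s').
    by exists s'.
  by rewrite -(eq_atom S e).
have [|om' [[om's _] e]] := clom (C [::]) _ _ (subsets_cylinder_nbhs om s).
  by exists [::].
by move=> u us; rewrite -om's// e.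
Qed.

End Points.

(** * Functions on the space OmegaA *)
Section Cylinder.
Variables (R : realType) (G : choiceType) (A : G -> G -> bool).
Local Notation F := (free_group G).
Local Notation Om := (OmegaA R A).
Local Notation CO := (cfun R Om).
Implicit Types (f g : CO) (om : Om) (t : F).

Lemma val_continuous : continuous (val : Om -> subsets G).
Proof. exact: initial_continuous. Qed.

Lemma cind_continuous t : continuous (fun om : Om => ind R t (val om)).
Proof.
move=> om; apply: (@continuous_comp _ _ _ (val : Om -> subsets G)).
  exact: val_continuous.
exact: ind_continuous.
Qed.

Definition cind t : CO := Cfun (@cind_continuous t).

Lemma cindE t om : cind t om = ((val om : F -> bool) t)%:R.
Proof. by []. Qed.

Lemma cfun0E om : cfun_apply (0 : CO) om = 0. Proof. by []. Qed.
Lemma cfunDE f g om : cfun_apply (f + g) om = f om + g om. Proof. by []. Qed.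
Lemma cfunNE f om : cfun_apply (- f) om = - f om. Proof. by []. Qed.
Lemma cfunZE (k : R[i]) f om : cfun_apply (k *: f) om
  = k * f om. Proof. by []. Qed.
Lemma cfunME f g om : cfun_apply (f ** g) om = f om * g om. Proof. by []. Qed.
Lemma cfun1E om : cfun_apply (1%g : CO) om = 1. Proof. by []. Qed.
Lemma cfun_starE f om : cfun_apply (star f) om = (f om)^*. Proof. by []. Qed.
Definition cfE := (cfun0E, cfunDE, cfunNE, cfunZE, cfunME, cfun1E, cfun_starE,
  cindE).

Lemma cfun_sumE (I : Type) (r : seq I) (h : I -> CO) om :
  cfun_apply (\sum_(i <- r) h i) om = \sum_(i <- r) cfun_apply (h i) om.
Proof. exact: (big_morph (fun g : CO => cfun_apply g om)). Qed.

Lemma cfun_prodE (I : Type) (r : seq I) (h : I -> CO) om :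
  cfun_apply (\prod_(i <- r) h i)%g om = \prod_(i <- r) cfun_apply (h i) om.
Proof. exact: (big_morph (fun g : CO => cfun_apply g om)). Qed.

Lemma cfun_normP f om : `|f om| <= `|f|.
Proof. exact: (cfun_norm_ge f). Qed.

Lemma cfun_normleP f (c : R[i]) : 0 <= c -> (forall om, `|f om| <= c) ->
  `|f| <= c.
Proof. exact: cfun_norm_le. Qed.

Lemma cfun_comm f g : f ** g = g ** f.
Proof. by apply: cfunP => om; rewrite !cfE mulrC. Qed.

Lemma Om_one om : (val om : F -> bool) 1%g.
Proof. by have [] := set_valP om. Qed.

Lemma cind1 : cind 1%g = 1%g.
Proof. by apply: cfunP => om; rewrite !cfE Om_one. Qed.

Lemma star_cind t : star (cind t) = cind t.
Proof. by apply: cfunP => om; rewrite !cfE conj_Creal// realn. Qed.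

Lemma Om_cylinder_nbhs om (s : seq F) :
  nbhs om [set om' : Om | {in s, (val om' : F -> bool) =1 val om}].
Proof. exact: (@val_continuous om _ (@subsets_cylinder_nbhs G (val om) s)). Qed.

(** Otherwise there are, for each finite s, two points that agree on s and on
    which the values of f are d apart.  A cluster point of these pairs is a
    diagonal point, which contradicts the continuity of f. *)
Lemma cylinder_uniform f (d : R[i]) : 0 < d -> exists s : seq F,
  forall om om', {in s, (val om : F -> bool) =1 val om'} -> `|f om - f om'| < d.
Proof.
move=> d0; apply: contrapT => no.
pose C (s : seq F) := [set oo : Om * Om | {in s, (val oo.1 : F ->
  bool) =1 val oo.2}
  /\ ~ (`|f oo.1 - f oo.2| < d)].
pose H := filter_from [set: seq F] C.
have HF : ProperFilter H.
  apply: filter_from_proper.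
    apply: filter_fromT_filter; first by exists [::].
    move=> s1 s2; exists (s1 ++ s2) => -[om om'] [e h]; split; split=> // t ts.
      by apply: e; rewrite mem_cat ts.
    by apply: e; rewrite mem_cat ts orbT.
  move=> s _; apply: contrapT => C0; apply: no; exists s => om om' e.
  by apply: contrapT => h; apply: C0; exists (om, om').
have HT : H ([set: Om] `*` [set: Om]) by apply: filterS filterT.
have [[om om'] [_ cl]] := compact_setX (@compactT Om) (@compactT Om) HF HT.
have eq : om = om'.
  apply: val_inj; apply/funext => t.
  have [||[o1 o2] [[e _] [/= h1 h2]]] :=
    cl (C [:: t]) ([set o | {in [:: t], (val o : F -> bool) =1 val om}]
         `*` [set o | {in [:: t], (val o : F -> bool) =1 val om'}]).
  - by exists [:: t].
  - exists ([set o | {in [:: t], (val o : F -> bool) =1 val om}],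
            [set o | {in [:: t], (val o : F -> bool) =1 val om'}]) => //.
    by split; exact: Om_cylinder_nbhs.
  - by rewrite -h1 ?mem_head// -h2 ?mem_head// e ?mem_head.
have d20 : 0 < d / 2 by rewrite divr_gt0.
have nb : nbhs om [set o | `|f om - f o| < d / 2].
  by have /cvgrPdist_lt/(_ _ d20) := @cfun_cont R Om f om.
subst om'.
have [||[o1 o2] [[_ hn] [/= h1 h2]]] :=
  cl (C [::]) ([set o | `|f om - f o| < d / 2] `*` [set o | `|f om - f o| < d /
    2]).
- by exists [::].
- by exists ([set o | `|f om - f o| < d / 2], [set o | `|f om - f o| < d / 2]).
- apply: hn => /=; rewrite (splitr d); apply: le_lt_trans (ler_distD (f om) _
  _) _.
  by rewrite ltrD// distrC.
Qed.

End Cylinder.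

(** * The homomorphism defined on functions *)
Section SpectralHom.
Variables (R : realType) (G : choiceType) (A : G -> G -> bool).
Variables (B : unitalCStarAlgType R) (S : G -> B).
Hypothesis rel : OA_relations A S.
Local Notation F := (free_group G).
Local Notation Om := (OmegaA R A).
Local Notation CO := (cfun R Om).
Implicit Types (f g : CO) (om : Om) (t : F) (b c : B).

(** The graph of the homomorphism 1_t |-> e_t on the algebra generated by the
    1_t, before it is known to be the graph of a function. *)
Inductive cyl : CO -> B -> Prop :=
| cyl_gen t : cyl (cind R A t) (elt_proj S t)
| cyl_lin (k : R[i]) f g b c : cyl f b -> cyl g c ->
    cyl (k *: f + g) (k *: b + c)
| cyl_mul f g b c : cyl f b -> cyl g c -> cyl (f ** g) (b ** c).

Lemma cyl1 : cyl 1%g 1%g.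
Proof. by have := cyl_gen 1%g; rewrite cind1 elt_proj1. Qed.

Lemma cyl0 : cyl 0 0.
Proof. by have := cyl_lin (-1) cyl1 cyl1; rewrite !scaleN1r !addNr. Qed.

Lemma cylZ k f b : cyl f b -> cyl (k *: f) (k *: b).
Proof. by move=> fb; have := cyl_lin k fb cyl0; rewrite !addr0. Qed.

Lemma cylD f g b c : cyl f b -> cyl g c -> cyl (f + g) (b + c).
Proof. by move=> fb gc; have := cyl_lin 1 fb gc; rewrite !scale1r. Qed.

Lemma cyl_star f b : cyl f b -> cyl (star f) (star b).
Proof.
elim=> {f b} [t|k f g b c _ fb _ gc|f g b c _ fb _ gc].
- by rewrite star_cind elt_proj_star; exact: cyl_gen.
- by rewrite !starD !starZ; exact: cyl_lin.
- by rewrite !starM; exact: cyl_mul.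
Qed.

Lemma cyl_comm f b t : cyl f b -> b ** elt_proj S t = elt_proj S t ** b.
Proof.
elim=> {f b} [u|k f g b c _ fb _ gc|f g b c _ fb _ gc].
- exact: (elt_proj_comm rel).
- by rewrite cmulDl cmulDr cscaleAl cscaleAr fb gc.
- by rewrite -mulgA gc mulgA fb mulgA.
Qed.

(** A pair (f, b) involves finitely many words, and on an atom along these words
    b acts as the scalar f(om). *)
Lemma cyl_local f b : cyl f b -> exists s : seq F,
  forall s', {subset s <= s'} -> forall om,
    b ** atom S (val om) s' = f om *: atom S (val om) s'.
Proof.
elim=> {f b} [t|k f g b c _ [s1 h1] _ [s2 h2]|f g b c _ [s1 h1] _ [s2 h2]].
- exists [:: t] => s' ss' om; rewrite (elt_proj_atom rel) ?cindE//.
  exact/ss'/mem_head.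
- exists (s1 ++ s2) => s' ss' om; rewrite cmulDl cscaleAl h1 ?h2 ?scalerA
  -?scalerDl//.
    by move=> u us; apply: ss'; rewrite mem_cat us orbT.
  by move=> u us; apply: ss'; rewrite mem_cat us.
- exists (s1 ++ s2) => s' ss' om; rewrite -mulgA h2 ?cscaleAr ?h1 ?scalerA ?cfE.
  + by rewrite mulrC.
  + by move=> u us; apply: ss'; rewrite mem_cat us.
  + by move=> u us; apply: ss'; rewrite mem_cat us orbT.
Qed.

(** Splitting along one projection e_t after the other, the norm of b is attained
    on one of the atoms. *)
Lemma norm_atom b (s : seq F) : (forall t, b ** elt_proj S t
  = elt_proj S t ** b) ->
  (forall t, star b ** elt_proj S t = elt_proj S t ** star b) ->
  exists xi : F -> bool, `|b| <= `|b ** atom S xi s|.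
Proof.
move=> bP sbP; elim: s => [|t s [xi IHs]].
  by exists (fun=> true); rewrite [X in _ ** X](_ : _ = 1%g)// mulg1.
have [ts|ts] := boolP (t \in s).
  by exists xi; rewrite atom_cons (lit_atom rel).
set a := b ** atom S xi s in IHs.
have ap u : a ** elt_proj S u = elt_proj S u ** a.
  have := comm_atom xi s (elt_proj_comm rel u) => au.
  by rewrite /a -mulgA -au mulgA bP -mulgA.
have sap u : star a ** elt_proj S u = elt_proj S u ** star a.
  by rewrite -[elt_proj S u](elt_proj_star S) -!starM ap.
pose up (d : bool) : F -> bool := fun u => if u == t then d else xi u.
have upE d : b ** atom S (up d) (t :: s) = a ** lit S t d.
  rewrite atom_cons {1}/up eqxx (lit_atom_comm rel) /a -!mulgA; congr (_
    ** (_ ** _)).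
  by apply: eq_atom => u us; rewrite /up ifN//; apply: contraNN ts => /eqP <-.
have [le|le] := norm_split (elt_proj_star S t) (elt_proj_idem rel t) (ap t)
  (sap t).
  by exists (up true); rewrite upE; exact: le_trans le.
by exists (up false); rewrite upE; exact: le_trans le.
Qed.

(** The norm of b is attained on an atom; if this atom is nonzero, it comes from
    a point of [OmegaA], at which the value of f is the scalar by which b acts.
      *)
Lemma cyl_contractive f b : cyl f b -> `|b| <= `|f|.
Proof.
move=> fb; have [s sP] := cyl_local fb.
have [|t|xi le] := @norm_atom b s.
- by move=> t; exact: cyl_comm fb.
- exact: cyl_comm (cyl_star fb).
apply: le_trans le _; have [->|xi0] := eqVneq (atom S xi s) 0.
  by rewrite cmul0r normr0.
have [om omS e] := spectral_extension rel xi0.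
pose om' : Om := exist _ om (mem_set (spectral_OmegaA rel omS)).
rewrite -(eq_atom S e) (sP s _ om')// normrZ -[leRHS]mulr1.
by rewrite ler_pM// ?cfun_normP ?(atom_norm rel).
Qed.

(** By [cylinder_uniform] f is almost constant once the membership of the words
    of a finite list s is prescribed.  The approximation is built by prescribing
    these words one after the other: 1_t g_1 + (1 - 1_t) g_0 glues the
    approximations on the two halves. *)
Lemma cyl_dense : dense_in [set f | exists b, cyl f b].
Proof.
move=> f e e0; have e20 : 0 < e / 2 by rewrite divr_gt0.
have [s sP] := cylinder_uniform f e20.
(* s2 lists the words already prescribed, by xi, and s1 those still to be. *)
suff H (s1 s2 : seq F) (xi : F -> bool) :
    (forall om om', {in s1 ++ s2, (val om : F -> bool) =1 val om'} ->
      `|f om - f om'| < e / 2) ->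
    exists g b, cyl g b /\ forall om, {in s2, (val om : F -> bool) =1 xi} ->
      `|f om - g om| <= e / 2.
  have [|g [b [gb h]]] := H s [::] (fun=> true); first by rewrite cats0.
  exists g; first by exists b.
  apply: (@le_lt_trans _ _ (e / 2)); last by rewrite ltr_pdivrMr// ltr_pMr//
    ltr1n.
  apply: cfun_normleP; first exact: ltW.
  by move=> om; apply: h.
elim: s1 s2 xi => [|t s1 IHs] s2 xi h.
  have [[om0 om0E]|no] := pselect (exists om : Om, {in s2, (val om : F ->
    bool) =1 xi}).
    exists (f om0 *: 1%g), (f om0 *: 1%g); split; first exact: cylZ cyl1.
    move=> om omE; rewrite !cfE mulr1; apply/ltW/h => u us.
    by rewrite omE// om0E.
  exists 0, 0; split; first exact: cyl0.
  by move=> om omE; case: no; exists om.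
have h' om om' : {in s1 ++ t :: s2, (val om : F -> bool) =1 val om'} ->
    `|f om - f om'| < e / 2.
  move=> oo; apply: h => u us; apply: oo.
  by move: us; rewrite !(mem_cat, inE); case: (u == t); rewrite ?orbT.
pose up (d : bool) : F -> bool := fun u => if u == t then d else xi u.
have [g1 [b1 [gb1 h1]]] := IHs (t :: s2) (up true) h'.
have [g0 [b0 [gb0 h0]]] := IHs (t :: s2) (up false) h'.
have [ts|ts] := boolP (t \in s2).
  have [g [b [gb hg]]] := IHs (t :: s2) xi h'.
  exists g, b; split=> // om omE; apply: hg => u.
  by rewrite inE => /predU1P[->|/omE//]; exact: omE.
pose ct := cind R A t; have cct : cyl ct (elt_proj S t) by exact: cyl_gen.
have cct' : cyl (1%g + (-1) *: ct) (1%g + (-1) *: elt_proj S t).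
  exact/cylD/cylZ/cct/cyl1.
exists (ct ** g1 + (1%g + (-1) *: ct) ** g0), (elt_proj S t ** b1 + (1%g
  + (-1) *: elt_proj S t) ** b0).
split; first by apply: cylD; exact: cyl_mul.
move=> om omE; rewrite !cfE.
have upE : {in t :: s2, (val om : F -> bool) =1 up (val om t)}.
  move=> u; rewrite inE /up; case: eqVneq => [->//|_] /=; exact: omE.
case omt : ((val om : F -> bool) t) upE => upE /=.
  by rewrite mul1r mulN1r subrr mul0r addr0 h1.
by rewrite mul0r mulr0 addr0 add0r mul1r h0.
Qed.

(** The extension by density of the relation [cyl].  Multiplicativity is extended
    in one variable at a time. *)
Lemma spectral_hom : exists pi : CO -> B,
  [/\ star_hom pi, forall f, `|pi f| <= `|f| & forall t, pi (cind R A t)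
    = elt_proj S t].
Proof.
have [pi [piE piL piC]] :=
  contractive_extension cyl_dense (fun k u v x y => @cyl_lin k u v x y)
    cyl_contractive.
have piB u v : pi (u - v) = pi u - pi v.
  by have := piL (-1) v u; rewrite !scaleN1r ![- _ + _]addrC.
exists pi; split=> //; last by move=> t; apply: piE; exact: cyl_gen.
split=> //.
- move=> f g.
  suff H f' b' : cyl f' b' -> forall g', pi (f' ** g') = pi f' ** pi g'.
    apply: (@dense_eq _ _ _ _ (fun f => pi (f ** g)) (fun f => pi f ** pi g)
        `|g| _ cyl_dense) => //.
    + by move=> u v; rewrite cmulBl piB.
    + by move=> u v; rewrite piB cmulBl.
    + move=> u; apply: le_trans (piC _) _; rewrite mulrC; exact: cnormM.
    + move=> u; apply: le_trans (cnormM _ _) _.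
      by rewrite mulrC ler_pM.
    + by move=> d [b db]; rewrite (H d b db).
  move=> fb' g'; apply: (@dense_eq _ _ _ _ (fun g => pi (f' ** g))
      (fun g => pi f' ** pi g) `|f'| _ cyl_dense) => //.
  + by move=> u v; rewrite cmulBr piB.
  + by move=> u v; rewrite piB cmulBr.
  + by move=> u; apply: le_trans (piC _) _; exact: cnormM.
  + by move=> u; apply: le_trans (cnormM _ _) _; rewrite ler_pM.
  + by move=> d [b db]; rewrite (piE _ _ (cyl_mul fb' db)) (piE _ _ fb') (piE _
    _ db).
- apply: (@dense_eq _ _ _ _ _ _ 1 _ cyl_dense) => //.
  + by move=> u v; rewrite starB piB.
  + by move=> u v; rewrite piB starB.
  + by move=> u; rewrite mul1r -[leRHS]norm_star; exact: piC.
  + by move=> u; rewrite mul1r norm_star.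
  + by move=> d [b db]; rewrite (piE _ _ (cyl_star db)) (piE _ _ db).
Qed.

End SpectralHom.

(** * The shift and the module of compactly supported functions *)
Section ShiftSpace.
Variables (R : realType) (G : choiceType) (A : G -> G -> bool).
Local Notation F := (free_group G).
Local Notation Om := (OmegaA R A).
Local Notation CO := (cfun R Om).
Implicit Types (om eta : Om) (x y : G) (t : F) (f : Om -> R[i]) (a b : CO).

Definition mem_om om t : bool := (val om : F -> bool) t.

Lemma cind_mem t om : cfun_apply (cind R A t) om = (mem_om om t)%:R.
Proof. by []. Qed.

Lemma om_ext om eta : (forall t, mem_om om t = mem_om eta t) -> om = eta.
Proof. by move=> h; apply: val_inj; apply/funext. Qed.

Lemma mem_sigma x eta t : Delta x eta -> mem_om (sigma eta) t
  = mem_om eta (gen x * t)%g.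
Proof. by move=> ex; rewrite /mem_om (val_sigma ex) /translate invgK. Qed.

(** The translate of om by x contains x because om contains 1, and the shift maps
    it back to om. *)
Lemma sigma_lift x om : mem_om om (gen x)^-1%g ->
  exists2 eta, Delta x eta & sigma eta = om.
Proof.
move=> omx.
have := OmegaA_translate (set_valP om) omx; rewrite invgK => h.
pose eta : Om := exist (fun xi => xi \in OmegaA_set R A) _ (mem_set h).
have etaE t : mem_om eta t = mem_om om ((gen x)^-1 * t)%g by [].
have ex : Delta x eta.
  change (is_true (mem_om eta (gen x))).
  by rewrite etaE mulVg; exact: Om_one.
exists eta => //; apply: om_ext => t.
by rewrite (mem_sigma _ ex) etaE mulgA mulVg mul1g.
Qed.

Lemma mem_sigmaV x eta : Delta x eta -> mem_om (sigma eta) (gen x)^-1%g.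
Proof. by move=> ex; rewrite (mem_sigma _ ex) mulgV; exact: Om_one. Qed.

Lemma sigma_inj x eta eta' : Delta x eta -> Delta x eta' ->
  sigma eta = sigma eta' -> eta = eta'.
Proof.
move=> ex ex' e; apply: om_ext => t.
have := mem_sigma ((gen x)^-1 * t)%g ex; rewrite e (mem_sigma _ ex').
by rewrite mulgA mulgV mul1g.
Qed.

(** The shift is injective on [Delta x], so a function supported there
    contributes a single term to the sum that defines [transfer]. *)
Lemma transfer_at x f eta : (forall om, ~ Delta x om -> f om = 0) ->
  Delta x eta -> transfer UA sigma f (sigma eta) = f eta.
Proof.
move=> foff ex; rewrite /transfer -(fsbig_widen [set eta]) ?fsbig_set1//.
  by move=> _ ->; split=> //; exists x.
move=> om [[_ so] /= ne]; apply: foff => ox; apply: ne.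
exact: sigma_inj ox ex so.
Qed.

Lemma transfer_out x f om : (forall om, ~ Delta x om -> f om = 0) ->
  ~~ mem_om om (gen x)^-1%g -> transfer UA sigma f om = 0.
Proof.
move=> foff nx; rewrite /transfer fsbig1// => eta [_ se]; apply: foff => ex.
by move: nx; rewrite -se mem_sigmaV.
Qed.

(** The points that contain the inverse of x are those of sigma (Delta x); the
    functions of the module supported on [Delta x] are computed at these points
    and vanish elsewhere. *)
Lemma om_case x (P : Om -> Prop) : (forall eta, Delta x eta -> P (sigma eta)) ->
  (forall om, ~~ mem_om om (gen x)^-1%g -> P om) -> forall om, P om.
Proof.
move=> h1 h2 om; have [/sigma_lift[eta ex <-]|] :=
  boolP (mem_om om (gen x)^-1%g).
  exact: h1.
exact: h2.
Qed.

Lemma chiE x om : chi x om = (mem_om om (gen x))%:R.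
Proof. by []. Qed.

Lemma chi_in x om : Delta x om -> chi x om = 1.
Proof. by rewrite chiE /mem_om => ->. Qed.

Lemma chi_out x om : ~ Delta x om -> chi x om = 0.
Proof. by rewrite chiE /mem_om /Delta /=; case: (\val om (gen x)) => // h;
  case: h. Qed.

Lemma chi_conj x om : (chi x om)^* = chi x om.
Proof. by rewrite chiE conj_Creal// realn. Qed.

Lemma cind_in x om : Delta x om -> cfun_apply (cind R A (gen x)) om = 1.
Proof. exact: chi_in. Qed.

Lemma cind_out x om : ~ Delta x om -> cfun_apply (cind R A (gen x)) om = 0.
Proof. exact: chi_out. Qed.

(** The sum is the indicator of a union, as the sets [Delta x] are disjoint. *)
Definition Delta_ind (X : {fset G}) : CO := \sum_(x <- X) cind R A (gen x).

Lemma Delta_ind_in (X : {fset G}) x om : x \in X -> Delta x om ->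
  cfun_apply (Delta_ind X) om = 1.
Proof.
move=> xX ox.
rewrite /Delta_ind cfun_sumE (big_fsetD1 x)// (cind_in ox)// big_seq big1 =>
  [|y]; first exact: addr0.
rewrite !inE => /andP[yx _]; apply: cind_out => oy.
by move: yx; rewrite (Delta_uniq oy ox) eqxx.
Qed.

Lemma Delta_ind_out (X : {fset G}) om : (forall x, x \in X -> ~ Delta x om) ->
  cfun_apply (Delta_ind X) om = 0.
Proof.
move=> h.
by rewrite /Delta_ind cfun_sumE big_seq big1// => x xX; rewrite cind_out//;
  exact: h.
Qed.

Lemma Delta_ind_case (X : {fset G}) om :
  (exists2 x, x \in X & Delta x om) /\ cfun_apply (Delta_ind X) om = 1 \/
  (forall x, x \in X -> ~ Delta x om) /\ cfun_apply (Delta_ind X) om = 0.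
Proof.
have [[x xX ox]|no] := pselect (exists2 x, x \in X & Delta x om).
  by left; split; [exists x|exact: Delta_ind_in ox].
have h x : x \in X -> ~ Delta x om by move=> xX ox; apply: no; exists x.
by right; split=> //; exact: Delta_ind_out.
Qed.

Lemma Delta_ind_star (X : {fset G}) : star (Delta_ind X) = Delta_ind X.
Proof.
by apply: cfunP => om; rewrite !cfE; have [[_ ->]|[_ ->]] :=
  Delta_ind_case X om;
  rewrite ?rmorph1 ?rmorph0.
Qed.

Lemma Delta_ind_idem (X : {fset G}) : Delta_ind X ** Delta_ind X = Delta_ind X.
Proof.
by apply: cfunP => om; rewrite !cfE; have [[_ ->]|[_ ->]] :=
  Delta_ind_case X om;
  rewrite ?mulr1 ?mulr0.
Qed.

Lemma Delta_ind_sub (X Y : {fset G}) : (X `<=` Y)%fset -> Delta_ind Y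
  ** Delta_ind X = Delta_ind X.
Proof.
move=> /fsubsetP XY; apply: cfunP => om; rewrite !cfE.
have [[[x xX ox] ->]|[_ ->]] := Delta_ind_case X om; last by rewrite mulr0.
by rewrite (Delta_ind_in (XY _ xX) ox) mulr1.
Qed.

Lemma Delta_open x : open (Delta x : set Om).
Proof.
have -> : Delta x = val @^-1` [set xi : subsets G | xi (gen x) = true] by [].
apply: open_comp; first by move=> ? _; exact: val_continuous.
rewrite (_ : [set xi : subsets G | xi (gen x) = true]
  = ~` [set xi | xi (gen x) = false]).
  exact/closed_openC/closed_ind.
by apply/seteqP; split=> xi /=; case: (xi (gen x)).
Qed.

(** The support of f is compact and covered by the disjoint open sets [Delta x].
    If no finite set of them sufficed, the points of the support outside
      finitely
    many of them would have a cluster point, which lies in some [Delta x]. *)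
Lemma Cc_finite f : Cc UA f -> exists X : {fset G},
  forall om, f om != 0 -> exists2 x, x \in X & Delta x om.
Proof.
move=> [fc fU]; have cK : compact (closure [set om : Om | f om != 0]).
  apply: subclosed_compact (@compactT Om) _ => //; exact: closed_closure.
apply: contrapT => no.
pose C (X : {fset G}) := [set om : Om | f om != 0 /\ forall x, x \in X ->
  ~ Delta x om].
pose H := filter_from [set: {fset G}] C.
have HF : ProperFilter H.
  apply: filter_from_proper.
    apply: filter_fromT_filter; first by exists fset0.
    move=> X Y; exists (X `|` Y)%fset => om [fom h]; split; split=> // x xX.
      by apply: h; rewrite inE xX.
    by apply: h; rewrite inE xX orbT.
  move=> X _; apply: contrapT => C0; apply: no; exists X => om fom.
  apply: contrapT => h; apply: C0; exists om; split=> // x xX ox.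
  by apply: h; exists x.
have [|om [/fU [x _ ox] cl]] := cK H HF.
  by exists fset0 => // om [fom _]; exact: subset_closure.
have [||eta [[_ h] ex]] := cl (C [fset x]%fset) (Delta x).
- by exists [fset x]%fset.
- exact/open_nbhs_nbhs/(conj (Delta_open x) ox).
- by apply: (h x); rewrite ?inE.
Qed.

End ShiftSpace.

Section ShiftModule.
Variables (R : realType) (G : choiceType) (A : G -> G -> bool).
Local Notation F := (free_group G).
Local Notation Om := (OmegaA R A).
Local Notation CO := (cfun R Om).
Variables (M : correspondenceType CO) (cls : (Om -> R[i]) -> M).
Hypothesis hM : is_completion UA sigma cls.
Implicit Types (om eta : Om) (x y : G) (t : F) (f : Om -> R[i]) (a b :
  CO) (m : M).

Definition chi_cls x : M := cls (chi x).

Lemma inner_chi x f : Cc UA f -> forall om,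
  cfun_apply (inner (chi_cls x) (cls f)) om
    = transfer UA sigma (fun eta => chi x eta * f eta) om.
Proof.
move=> fC om; rewrite -[LHS]/((inner (chi_cls x) (cls f) : CO) om).
rewrite [LHS](cls_inner hM (chi_Cc R A x) fC).
by congr (transfer _ _ _ _); apply/funext => eta; rewrite chi_conj.
Qed.

Lemma inner_chi_at x f eta : Cc UA f -> Delta x eta ->
  cfun_apply (inner (chi_cls x) (cls f)) (sigma eta) = f eta.
Proof.
move=> fC ex; rewrite inner_chi// (@transfer_at _ _ _ x)//;
  first by rewrite chi_in// mul1r.
by move=> om ox; rewrite chi_out// mul0r.
Qed.

Lemma inner_chi_out x f om : Cc UA f -> ~~ mem_om om (gen x)^-1%g ->
  cfun_apply (inner (chi_cls x) (cls f)) om = 0.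
Proof.
move=> fC ox; rewrite inner_chi// (@transfer_out _ _ _ x)// => eta ex.
by rewrite chi_out// mul0r.
Qed.

Lemma inner_chi_chi x y : inner (chi_cls x) (chi_cls y)
  = if x == y then cind R A (gen x)^-1%g else 0.
Proof.
apply: cfunP; apply: (@om_case _ _ _ x) => [eta ex|om ox].
  rewrite inner_chi_at//; last exact: chi_Cc.
  case: eqVneq => [<-|xy]; first by rewrite chi_in// cind_mem mem_sigmaV.
  by rewrite chi_out// => ey; move: xy; rewrite (Delta_uniq ex ey) eqxx.
rewrite inner_chi_out//; last exact: chi_Cc.
by case: eqVneq => // _; rewrite cind_mem (negPf ox).
Qed.

Lemma ract_chi x a f : Cc UA f -> (forall eta, Delta x eta ->
  cfun_apply a (sigma eta) = f eta) ->
  (forall eta, ~ Delta x eta -> f eta = 0) -> ract (chi_cls x) a = cls f.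
Proof.
move=> fC h1 h2; rewrite (cls_ract hM); last exact: chi_Cc.
congr cls; apply/funext => eta.
have [ex|ex] := pselect (Delta x eta); last by rewrite h2// chi_out// mul0r.
by rewrite chi_in// mul1r -h1.
Qed.

Lemma lact_cls a f : Cc UA f -> lact a (cls f)
  = cls (fun om => cfun_apply a om * f om).
Proof. by move=> fC; rewrite (cls_lact hM). Qed.

Lemma Cc_mul a f : Cc UA f -> Cc UA (fun om => cfun_apply a om * f om).
Proof.
move=> [fc fU]; split.
  by move=> om; exact: (cvgM (@cfun_cont R Om a om) (fc om)).
apply: subset_trans fU; apply: closure_subset => om /=.
by apply: contraNN => /eqP ->; rewrite mulr0.
Qed.

(** The left action of 1_x is of rank one.  This makes 1_x act as a compact
    operator, and it is the source of the redundancies that matter. *)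
Lemma lact_cind x m : lact (cind R A (gen x)) m
  = ract (chi_cls x) (inner (chi_cls x) m).
Proof.
have h f : Cc UA f -> lact (cind R A (gen x)) (cls f)
  = ract (chi_cls x) (inner (chi_cls x) (cls f)).
  move=> fC; rewrite lact_cls//; apply/esym/ract_chi; first exact: Cc_mul.
    by move=> eta ex; rewrite inner_chi_at// cind_in// mul1r.
  by move=> eta ex; rewrite cind_out// mul0r.
apply: (inner_cls_eq hM) => f fC.
by rewrite inner_ract -{1}[cind _ _ _]star_cind -lact_inner h// inner_ractl
  inner_star.
Qed.

Lemma lact_cind_chi x : lact (cind R A (gen x)) (chi_cls x) = chi_cls x.
Proof.
rewrite lact_cls; last exact: chi_Cc.
congr cls; apply/funext => om; have [ox|ox] := pselect (Delta x om).
  by rewrite cind_in// mul1r.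
by rewrite cind_out// mul0r chi_out.
Qed.

Lemma lact_chi_cind x t : lact (cind R A (gen x * t)%g) (chi_cls x)
  = ract (chi_cls x) (cind R A t).
Proof.
rewrite lact_cls; last exact: chi_Cc.
apply/esym/ract_chi; first exact/Cc_mul/chi_Cc.
  by move=> eta ex; rewrite chi_in// mulr1 !cind_mem (mem_sigma _ ex).
by move=> eta ex; rewrite chi_out// mulr0.
Qed.

(** The function om |-> a(x om) on sigma (Delta x), extended by 0.  As an inner
    product it is continuous by construction. *)
Definition pull x a : CO := inner (chi_cls x) (lact a (chi_cls x)).

Lemma pullE_at x a eta : Delta x eta -> cfun_apply (pull x a) (sigma eta)
  = cfun_apply a eta.
Proof.
move=> ex; rewrite /pull lact_cls; last exact: chi_Cc.
by rewrite inner_chi_at ?chi_in ?mulr1//; exact/Cc_mul/chi_Cc.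
Qed.

Lemma pullE_out x a om : ~~ mem_om om (gen x)^-1%g ->
  cfun_apply (pull x a) om = 0.
Proof.
move=> ox; rewrite /pull lact_cls; last exact: chi_Cc.
by rewrite inner_chi_out//; exact/Cc_mul/chi_Cc.
Qed.

Lemma lact_chi x a : lact a (chi_cls x) = ract (chi_cls x) (pull x a).
Proof.
rewrite lact_cls; last exact: chi_Cc.
apply/esym/ract_chi; first exact/Cc_mul/chi_Cc.
  by move=> eta ex; rewrite pullE_at// chi_in// mulr1.
by move=> eta ex; rewrite chi_out// mulr0.
Qed.

Lemma pullM x a b : pull x (a ** b) = pull x a ** pull x b.
Proof.
apply: cfunP; apply: (@om_case _ _ _ x) => [eta ex|om ox].
  by rewrite cfunME !pullE_at.
by rewrite cfunME !pullE_out// mulr0.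
Qed.

Lemma pull_star x a : pull x (star a) = star (pull x a).
Proof.
apply: cfunP; apply: (@om_case _ _ _ x) => [eta ex|om ox].
  by rewrite cfun_starE !pullE_at.
by rewrite cfun_starE !pullE_out// rmorph0.
Qed.

Lemma pull_cind x t : pull x (cind R A t)
  = cind R A (gen x)^-1%g ** cind R A ((gen x)^-1 * t)%g.
Proof.
apply: cfunP; apply: (@om_case _ _ _ x) => [eta ex|om ox].
  rewrite pullE_at// cfunME !cind_mem mem_sigmaV// mul1r (mem_sigma _ ex).
  by rewrite mulgA mulgV mul1g.
by rewrite pullE_out// cfunME !cind_mem (negPf ox) mul0r.
Qed.

Lemma inner_lact x a m : inner (chi_cls x) (lact a m) = pull x a
  ** inner (chi_cls x) m :> CO.
Proof.
rewrite -[a in LHS]starK -lact_inner lact_chi inner_ractl pull_star starK.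
by [].
Qed.

Lemma norm_chi x : `|chi_cls x| <= 1.
Proof.
rewrite -(@ler_pXn2r _ 2)// ?nnegrE// inner_norm inner_chi_chi eqxx expr1n.
apply: cfun_normleP => // om; rewrite cind_mem.
by case: (mem_om _ _); rewrite ?normr1 ?normr0.
Qed.

Lemma lact_Delta_ind (X : {fset G}) m :
  lact (Delta_ind R A X) m = \sum_(x <- X) ract (chi_cls x) (inner (chi_cls x)
    m).
Proof. by rewrite /Delta_ind lact_sum; apply: eq_bigr => x _;
  exact: lact_cind. Qed.

Lemma Delta_ind_cls f : Cc UA f -> exists X : {fset G}, forall Y :
  {fset G}, (X `<=` Y)%fset ->
  lact (Delta_ind R A Y) (cls f) = cls f.
Proof.
move=> fC; have [X hX] := Cc_finite fC; exists X => Y /fsubsetP XY.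
rewrite lact_cls//; congr cls; apply/funext => om.
have [->|/hX[x xX ox]] := eqVneq (f om) 0; first by rewrite mulr0.
by rewrite (Delta_ind_in (XY _ xX) ox) mul1r.
Qed.

(** The partial sums are eventually constant on classes of compactly supported
    functions, and the left actions of the projections [Delta_ind X] are
    contractive. *)
Lemma Delta_ind_cvg m (e : R[i]) : 0 < e -> exists X : {fset G},
  forall Y : {fset G}, (X `<=` Y)%fset -> `|m - lact (Delta_ind R A Y) m| < e.
Proof.
move=> e0; have e20 : 0 < e / 2 by rewrite divr_gt0.
have [_ [f fC <-] mf] := cls_dense_in hM m e20.
have [X hX] := Delta_ind_cls fC; exists X => Y XY.
have -> : m - lact (Delta_ind R A Y) m = (m - cls f) - lact (Delta_ind R A Y)
  (m - cls f).
  by rewrite lactBr hX// opprB addrA subrK.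
rewrite (splitr e); apply: le_lt_trans (ler_normB _ _) _; rewrite ltrD//.
apply: le_lt_trans mf; apply: norm_lact_proj;
  [exact: Delta_ind_star|exact: Delta_ind_idem].
Qed.

End ShiftModule.

(** * The representation of the module *)
Section Representation.
Variables (R : realType) (G : choiceType) (A : G -> G -> bool).
Variables (B : unitalCStarAlgType R) (S : G -> B).
Hypothesis rel : OA_relations A S.
Local Notation F := (free_group G).
Local Notation Om := (OmegaA R A).
Local Notation CO := (cfun R Om).
Variable pi : CO -> B.
Hypothesis pihom : star_hom pi.
Hypothesis pi_norm : forall f, `|pi f| <= `|f|.
Hypothesis pi_cind : forall t, pi (cind R A t) = elt_proj S t.
Variables (M : correspondenceType CO) (cls : (Om -> R[i]) -> M).
Hypothesis hM : is_completion UA sigma cls.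
Implicit Types (x y : G) (t : F) (a b : CO) (m n : M) (X Y : {fset G}).
Local Notation chi_cls := (chi_cls cls).
Local Notation P := (Delta_ind R A).

Lemma pullB x a b : pull cls x (a - b) = pull cls x a - pull cls x b.
Proof.
apply: cfunP; apply: (@om_case _ _ _ x) => [eta ex|om ox].
  by rewrite cfunDE cfunNE !(pullE_at hM _ ex).
by rewrite cfunDE cfunNE !(pullE_out hM _ ox) subrr.
Qed.

Lemma norm_pull x a : `|pull cls x a| <= `|a|.
Proof.
apply: cfun_normleP => //; apply: (@om_case _ _ _ x) => [eta ex|om ox].
  by rewrite (pullE_at hM _ ex) cfun_normP.
by rewrite (pullE_out hM _ ox) normr0.
Qed.

Lemma elt_proj_S x t : elt_proj S t ** S x
  = S x ** (elt_proj S (gen x)^-1%g ** elt_proj S ((gen x)^-1 * t)%g).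
Proof.
have rw := word_reduced ((gen x)^-1 * t)%g.
have := word_proj_push rel (x, true) rw.
have -> : push (x, true) (word ((gen x)^-1 * t)%g) = word t.
  by rewrite -(word_letterM (x, true)) -[fg_letter _]/(gen x) mulVKg.
rewrite word_proj_letter => e.
rewrite elt_proj_genV !mulgA (OA_partial_isometry rel) /elt_proj.
rewrite [RHS](letter_op_word_proj rel (x, true) rw) e.
by rewrite -mulgA (OA_partial_isometry rel).
Qed.

(** Both sides are continuous in a, and multiplicative in the sense that the rule
    for a product follows from the rules for its factors;
      so it is enough to take
    a = 1_t, where the rule is [elt_proj_S]. *)
Lemma covariance x a : pi a ** S x = S x ** pi (pull cls x a).
Proof.
apply: (@dense_eq _ _ _ _ (fun a => pi a ** S x) (fun a => S x
  ** pi (pull cls x a))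
  `|S x| _ (@cyl_dense R G A B S)) => //.
- by move=> u v; rewrite (shomB pihom) cmulBl.
- by move=> u v; rewrite pullB (shomB pihom) cmulBr.
- move=> v; apply: le_trans (cnormM _ _) _; rewrite mulrC ler_wpM2l//.
- move=> v; apply: le_trans (cnormM _ _) _; rewrite ler_wpM2l//.
  exact: le_trans (pi_norm _) (norm_pull _ _).
- move=> d [b db]; elim: db => {d b} [t|k f g b c _ fb _ gc|f g b c _ fb _ gc].
  + by rewrite (pull_cind hM) (shomM pihom) !pi_cind elt_proj_S.
  + have -> : pull cls x (k *: f + g) = k *: pull cls x f + pull cls x g.
      apply: cfunP; apply: (@om_case _ _ _ x) => [eta ex|om ox].
        by rewrite cfunDE cfunZE !(pullE_at hM _ ex).
      by rewrite cfunDE cfunZE !(pullE_out hM _ ox) mulr0 addr0.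
    by rewrite !(shomP pihom) cmulDl cmulDr cscaleAl cscaleAr fb gc.
  + by rewrite (pullM hM) !(shomM pihom) -mulgA gc mulgA fb mulgA.
Qed.

(** The finite sums that define tau m = sum_x S_x pi(<chi_x, m>). *)
Definition tsum X m : B := \sum_(x <- X) S x ** pi (inner (chi_cls x) m).

Lemma tsum_lin X (k : R[i]) m n : tsum X (k *: m + n) = k *: tsum X m
  + tsum X n.
Proof.
rewrite /tsum scaler_sumr -big_split; apply: eq_bigr => x _ /=.
by rewrite innerDr innerZr (shomP pihom) cmulDr cscaleAr.
Qed.

Lemma tsum_ract X m a : tsum X (ract m a) = tsum X m ** pi a.
Proof.
rewrite /tsum cmul_suml; apply: eq_bigr => x _.
by rewrite inner_ract (shomM pihom) mulgA.
Qed.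

Lemma tsum_lact X m a : tsum X (lact a m) = pi a ** tsum X m.
Proof.
rewrite /tsum cmul_sumr; apply: eq_bigr => x _.
by rewrite (inner_lact hM) (shomM pihom) !mulgA covariance.
Qed.

Lemma inner_Delta_ind X m n : inner (lact (P X) m) (lact (P X) n)
  = \sum_(x <- X) star (inner (chi_cls x) m) ** inner (chi_cls x) n :> CO.
Proof.
rewrite lact_inner Delta_ind_star -lactM Delta_ind_idem (lact_Delta_ind hM)
  inner_sumr.
by apply: eq_bigr => x _; rewrite inner_ract inner_star.
Qed.

(** The terms S_x^* S_y with x different from y vanish, and S_x^* S_x is the image
    of <chi_x, chi_x>. *)
Lemma tsum_inner X m n :
  star (tsum X m) ** tsum X n = pi (inner (lact (P X) m) (lact (P X) n)).
Proof.
rewrite inner_Delta_ind (shom_sum pihom) /tsum.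
have -> : star (\sum_(x <- X) S x ** pi (inner (chi_cls x) m))
    = \sum_(x <- X) star (pi (inner (chi_cls x) m)) ** star (S x).
  rewrite star_sum; apply: eq_bigr => x _; exact: starM.
rewrite cmul_suml big_seq [RHS]big_seq; apply: eq_bigr => x xX.
rewrite cmul_sumr (big_fsetD1 x)// big_seq big1 => [|y]; last first.
  rewrite !inE => /andP[yx _]; rewrite -mulgA [star (S x)
    ** _]mulgA (OA_orth rel).
    by rewrite cmul0l cmul0r.
  by rewrite eq_sym.
rewrite [LHS]addr0 (shomM pihom) (shom_star pihom) -mulgA; congr (_ ** _).
rewrite mulgA -elt_proj_genV -pi_cind -(shomM pihom); congr pi.
have := inner_lact hM x 1%g n; rewrite (lact1 hM).
by rewrite /pull (lact1 hM) (inner_chi_chi hM) eqxx => <-.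
Qed.

Lemma norm_tsum X m : `|tsum X m| <= `|lact (P X) m|.
Proof.
rewrite -(@ler_pXn2r _ 2)// ?nnegrE//.
by rewrite -cnorm_star tsum_inner inner_norm pi_norm.
Qed.

Lemma inner_chi_Delta_ind X x m : x \notin X ->
  inner (chi_cls x) (lact (P X) m) = 0 :> CO.
Proof.
move=> xX; rewrite (inner_lact hM) (_ : pull _ _ _ = 0) ?cmul0l//.
apply: cfunP; apply: (@om_case _ _ _ x) => [eta ex|om ox].
  rewrite (pullE_at hM _ ex) Delta_ind_out// => y yX ey.
  by move: xX; rewrite (Delta_uniq ex ey) yX.
by rewrite (pullE_out hM _ ox).
Qed.

Lemma tsum_sub X Y m : (X `<=` Y)%fset -> lact (P X) m = m -> tsum Y m
  = tsum X m.
Proof.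
move=> XY Xm; rewrite /tsum; apply/esym/big_fset_incl => // x _ xX.
by rewrite -Xm inner_chi_Delta_ind// (shom0 pihom) cmul0r.
Qed.

Lemma Delta_ind_subl X Y m : (X `<=` Y)%fset -> lact (P X) m = m ->
  lact (P Y) m = m.
Proof. by move=> XY Xm; rewrite -Xm -lactM Delta_ind_sub. Qed.

Lemma Delta_ind_ract X m a : lact (P X) (ract m a) = ract (lact (P X) m) a.
Proof.
rewrite !(lact_Delta_ind hM) ract_suml.
by apply: eq_bigr => x _; rewrite inner_ract ractM.
Qed.

(** The map tau on the vectors supported on finitely many [Delta x]; the sum does
    not depend on the finite set X, by [tsum_sub]. *)
Definition tau_rel m (b : B) := exists2 X, lact (P X) m = m & b = tsum X m.

Lemma tau_dense : dense_in [set m | exists b : B, tau_rel m b].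
Proof.
move=> m e e0; have [X hX] := Delta_ind_cvg hM m e0.
exists (lact (P X) m); last exact/hX/fsubset_refl.
by exists (tsum X (lact (P X) m)), X => //; rewrite -lactM Delta_ind_idem.
Qed.

Lemma tau_exists : exists2 tau : M -> B, representation pi tau &
  forall x, tau (chi_cls x) = S x.
Proof.
have rlin (k : R[i]) m n (b c : B) : tau_rel m b -> tau_rel n c ->
    tau_rel (k *: m + n) (k *: b + c).
  move=> [X Xm ->] [Y Yn ->]; have Zm := Delta_ind_subl (fsubsetUl X Y) Xm.
  have Zn := Delta_ind_subl (fsubsetUr X Y) Yn.
  exists (X `|` Y)%fset; first by rewrite lactDr lactZr Zm Zn.
  by rewrite tsum_lin (tsum_sub (fsubsetUl X Y) Xm) (tsum_sub (fsubsetUr X Y)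
    Yn).
have rcon m (b : B) : tau_rel m b -> `|b| <= `|m|.
  by move=> [X Xm ->]; apply: le_trans (norm_tsum _ _) _; rewrite Xm.
have [tau [tauE tauL tauC]] := contractive_extension tau_dense rlin rcon.
have tauB u v : tau (u - v) = tau u - tau v.
  by have := tauL (-1) v u; rewrite !scaleN1r ![- _ + _]addrC.
exists tau; last first.
  move=> x; have xx : lact (P [fset x]%fset) (chi_cls x) = chi_cls x.
    by rewrite /Delta_ind big_seq_fset1 (lact_cind_chi hM).
  rewrite (tauE _ (tsum [fset x]%fset (chi_cls x)));
    last by exists [fset x]%fset.
  rewrite /tsum big_seq_fset1 (inner_chi_chi hM) eqxx pi_cind elt_proj_genV
    mulgA.
  exact: (OA_partial_isometry rel).
split=> //.
- move=> a m; apply/eqP; rewrite -subr_eq0; apply/eqP.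
  apply: (@norm_eps_eq0 _ _ _ (1 + `|a|)); first by rewrite addr_ge0.
  move=> e e0; have [X hX] := Delta_ind_cvg hM m e0.
  have [Y hY] := Delta_ind_cvg hM (lact a m) e0.
  set Z := (X `|` Y)%fset.
(* The identity holds exactly for the finite sums over Z; Z is chosen large for
   m and for its image under a, which dispenses with a bound on the left
     action. *)
  have near n : `|n - lact (P Z) n| < e -> `|tau n - tsum Z n| <= e.
    move=> ne; have -> : tsum Z n = tau (lact (P Z) n).
      apply/esym/tauE; exists Z; first by rewrite -lactM Delta_ind_idem.
      have pz : pi (P Z) ** tsum Z n = tsum Z n.
        rewrite -tsum_lact /tsum big_seq [RHS]big_seq; apply: eq_bigr => x xZ.
        congr (_ ** pi _); rewrite (inner_lact hM).
        have -> : pull cls x (P Z) = pull cls x 1%g.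
          apply: cfunP; apply: (@om_case _ _ _ x) => [eta ex|om ox].
            by rewrite !(pullE_at hM _ ex) (Delta_ind_in xZ ex).
          by rewrite !(pullE_out hM _ ox).
        by rewrite -(inner_lact hM) (lact1 hM).
      by rewrite tsum_lact pz.
    by rewrite -tauB; apply: le_trans (tauC _) _; exact: ltW.
  have h1 := near _ (hX Z (fsubsetUl X Y)); have h2 :=
    near _ (hY Z (fsubsetUr X Y)).
  have -> : tau (lact a m) - pi a ** tau m
      = (tau (lact a m) - tsum Z (lact a m)) - pi a ** (tau m - tsum Z m).
    by rewrite tsum_lact cmulBr opprB addrA subrK.
  rewrite mulrDl mul1r; apply: le_trans (ler_normB _ _) _; rewrite lerD//.
  by apply: le_trans (cnormM _ _) _; rewrite ler_pM ?pi_norm.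
- move=> m a; apply: (@dense_eq _ _ _ _ (fun m => tau (ract m a))
    (fun m => tau m ** pi a) `|a| _ tau_dense) => //.
  + move=> u v; have -> : ract (u - v) a = ract u a - ract v a;
    last exact: tauB.
    by rewrite ractDl -[- v]scaleN1r ractZl scaleN1r.
  + by move=> u v; rewrite tauB cmulBl.
  + by move=> v; apply: le_trans (tauC _) _; rewrite mulrC; exact: norm_ract.
  + by move=> v; apply: le_trans (cnormM _ _) _;
    rewrite mulrC ler_pM ?pi_norm ?tauC.
  + move=> d [b [X Xd bE]].
    rewrite (tauE (ract d a) (tsum X (ract d a))); last by exists X;
      rewrite ?Delta_ind_ract ?Xd.
    by rewrite (tauE d (tsum X d)) ?tsum_ract//; exists X.
- have H m n : [set m | exists b : B, tau_rel m b] m -> star (tau m)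
  ** tau n = pi (inner m n).
    move=> [b [X Xm bE]]; apply: (@dense_eq _ _ _ _ (fun n => star (tau m) **
      tau n)
      (fun n => pi (inner m n)) `|m| _ tau_dense) => //.
    + by move=> u v; rewrite tauB cmulBr.
    + by move=> u v; rewrite innerBr (shomB pihom).
    + by move=> v; apply: le_trans (cnormM _ _) _;
      rewrite norm_star ler_pM ?tauC.
    + move=> v; apply: le_trans (pi_norm _) _; exact: cauchy_schwarz.
    + move=> n' [c [Y Yn cE]]; set Z := (X `|` Y)%fset.
      have Zm : lact (P Z) m = m by exact: Delta_ind_subl (fsubsetUl X Y) Xm.
      have Zn : lact (P Z) n' = n' by exact: Delta_ind_subl (fsubsetUr X Y) Yn.
      rewrite (tauE m (tsum Z m)) ?(tauE n' (tsum Z n'));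
        [|by exists Z|by exists Z].
      by rewrite tsum_inner Zm Zn.
  move=> m n; apply: (@dense_eq _ _ _ _ (fun m => star (tau m) ** tau n)
      (fun m => pi (inner m n)) `|n| _ tau_dense) => //.
  + by move=> u v; rewrite tauB starB cmulBl.
  + by move=> u v; rewrite innerBl (shomB pihom).
  + by move=> v; apply: le_trans (cnormM _ _) _;
    rewrite norm_star mulrC ler_pM ?pi_norm ?tauC.
  + by move=> v; apply: le_trans (pi_norm _) _; rewrite mulrC;
    exact: cauchy_schwarz.
  + by move=> d db; exact: H.
Qed.

End Representation.

(** * Redundancies act trivially *)
Section Katsura.
Variables (R : realType) (G : choiceType) (A : G -> G -> bool).
Local Notation Om := (OmegaA R A).
Local Notation CO := (cfun R Om).
Variables (M : correspondenceType CO) (cls : (Om -> R[i]) -> M).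
Hypothesis hM : is_completion UA sigma cls.
Implicit Types (x y : G) (a b : CO) (m n : M) (X Y : {fset G}).
Local Notation chi_cls := (chi_cls cls).
Local Notation P := (Delta_ind R A).

Lemma norm_lact_chi a x eta : Delta x eta ->
  `|cfun_apply a eta| <= `|lact a (chi_cls x)|.
Proof.
move=> ex; rewrite -(@ler_pXn2r _ 2)// ?nnegrE// inner_norm lact_inner -lactM.
rewrite -[inner _ _]/(pull cls x (star a ** a)).
apply: le_trans (cfun_normP _ (sigma eta)); rewrite (pullE_at hM _ ex).
by rewrite cfunME cfun_starE normrM norm_conjC expr2.
Qed.

Lemma Delta_ind_cvg_seq (s : seq (M * M)) (e : R[i]) : 0 < e -> exists X,
  forall Y, (X `<=` Y)%fset ->
    \sum_(mn <- s) `|mn.1| * `|mn.2 - lact (P Y) mn.2| <= e.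
Proof.
elim: s e => [|[m n] s IHs] e e0.
  by exists fset0 => Y _; rewrite big_nil ltW.
have e20 : 0 < e / 2 by rewrite divr_gt0.
have [X hX] := IHs _ e20.
have m1 : 0 < `|m| + 1 by rewrite ltr_wpDl.
have [Z hZ] := Delta_ind_cvg hM n (divr_gt0 e20 m1).
exists (X `|` Z)%fset => Y XZY; rewrite big_cons (splitr e) lerD//=; last first.
  by apply: hX; exact: fsubset_trans (fsubsetUl X Z) XZY.
have /ltW := hZ Y (fsubset_trans (fsubsetUr X Z) XZY).
rewrite ler_pdivlMr// => h; apply: le_trans h.
by rewrite mulrC ler_wpM2l// lerDl.
Qed.

(** The first clause concerns the points of U.  The operator a is within e / 2 of
    a finite sum of rank-one operators m <n, .>, and each n is almost supported
      on
    finitely many [Delta x].  For y outside these finitely many indices the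
      vector
    chi_y is almost orthogonal to every n, so a is at most e on [Delta y].
    Outside U, a vanishes where a function killed by the left action does not.
      To
    treat the boundary of U together with its exterior, a is multiplied by its
    own excess over e, cut off outside Y, which is such a function. *)
Lemma katsura_vanish a (e : R[i]) : katsura_ideal M a -> 0 < e ->
  exists X, forall Y, (X `<=` Y)%fset -> `|a - a ** P Y| <= e.
Proof.
move=> [aker acpt] e0; have e20 : 0 < e / 2 by rewrite divr_gt0.
have [s hs] := acpt _ e20; have [X hX] := Delta_ind_cvg_seq s e20.
exists X => Y XY.
have off y eta : y \notin Y -> Delta y eta -> `|cfun_apply a eta| <= e.
  move=> yY ey; apply: le_trans (norm_lact_chi a ey) _.
  rewrite -[lact a (chi_cls y)](subrK (\sum_(mn <- s) rank_one mn.1 mn.2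
    (chi_cls y))) (splitr e).
  apply: le_trans (ler_normD _ _) _; rewrite lerD//.
    apply: le_trans (hs (chi_cls y)) _.
    by rewrite -[leRHS]mulr1 ler_wpM2l ?(ltW e20)// (norm_chi hM).
  apply: le_trans (hX Y XY); apply: le_trans (ler_norm_sum _ _ _) _.
  apply: ler_sum => -[m n] _ /=; rewrite /rank_one.
  apply: le_trans (norm_ract m (inner n (chi_cls y) : CO)) _;
    rewrite ler_wpM2l//.
  have -> : inner n (chi_cls y) = inner (n - lact (P Y) n) (chi_cls y) :> CO.
    rewrite innerBl -[X in _ = _ - X]inner_star (inner_chi_Delta_ind hM _ yY)
      star0.
    by rewrite subr0.
  apply: le_trans (cauchy_schwarz _ _) _.
  by rewrite -[leRHS]mulr1 ler_wpM2l// (norm_chi hM).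
have eR : e \is Num.real by rewrite gtr0_real.
(* bf is twice the positive part of |a| - e, multiplied by the indicator of the
   complement of the [Delta x] for x in Y; it vanishes on U by the bound off. *)
pose bf := fun eta : Om =>
  (`| `|cfun_apply a eta| - e | + (`|cfun_apply a eta| - e))
    * cfun_apply (1%g - P Y : CO) eta.
have bc : continuous bf.
  move=> eta; have ac := @cfun_cont R Om a eta.
  have a1 : (fun eta => `|cfun_apply a eta| - e) @ eta --> `|cfun_apply a eta|
    - e.
    exact: (cvgB (cvg_norm ac) (@cont_cst R Om e eta)).
  exact: (cvgM (cvgD (cvg_norm a1) a1) (@cfun_cont R Om (1%g - P Y) eta)).
pose b : CO := Cfun bc.
have bE eta : cfun_apply b eta = bf eta by [].
have bker : lact_kernel M b.
  move=> m; apply: (lact_off hM) => eta [y _ ey]; rewrite bE /bf.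
  have [yY|yY] := boolP (y \in Y).
    by rewrite cfunDE cfunNE (Delta_ind_in yY ey) cfun1E subrr mulr0.
  have le := off y eta yY ey.
  by rewrite ler0_norm ?subr_le0// addNr mul0r.
have ab := aker _ bker.
apply: cfun_normleP; first exact: ltW.
move=> eta; rewrite cfunDE cfunNE cfunME.
have [[_ ->]|[no p0]] := Delta_ind_case Y eta.
  by rewrite mulr1 subrr normr0 ltW.
rewrite p0 mulr0 subr0.
have /real_leP/(_ eR) [//|lt] : `|cfun_apply a eta| \is Num.real by exact:
  normr_real.
have := congr1 (fun g : CO => cfun_apply g eta) ab.
rewrite cfunME bE /bf cfunDE cfunNE cfun1E p0 subr0 mulr1.
have pos : 0 < `|cfun_apply a eta| - e by rewrite subr_gt0.
rewrite gtr0_norm// => /eqP; rewrite mulf_eq0 => /orP[/eqP a0|].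
  by move: lt; rewrite a0 normr0 => /(lt_trans e0); rewrite ltxx.
by rewrite gt_eqF// addr_gt0.
Qed.

End Katsura.

Section Redundancies.
Variables (R : realType) (G : choiceType) (A : G -> G -> bool).
Variables (B : unitalCStarAlgType R) (S : G -> B).
Local Notation Om := (OmegaA R A).
Local Notation CO := (cfun R Om).
Variable pi : CO -> B.
Hypothesis pi_norm : forall f, `|pi f| <= `|f|.
Hypothesis pi_cind : forall x, pi (cind R A (gen x)) = S x ** star (S x).
Variables (M : correspondenceType CO) (cls : (Om -> R[i]) -> M).
Hypothesis hM : is_completion UA sigma cls.
Variable tau : M -> B.
Hypothesis rep : representation pi tau.
Hypothesis tau_chi : forall x, tau (chi_cls cls x) = S x.
Variables (T : cstarAlgType R) (iA : CO -> T) (iM : M -> T).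
Variable rho : T -> B.
Hypothesis rho_hom : star_hom rho.
Hypothesis rho_iA : forall a, rho (iA a) = pi a.
Hypothesis rho_iM : forall m, rho (iM m) = tau m.
Implicit Types (x y : G) (a b : CO) (m n : M) (X Y : {fset G}).
Local Notation P := (Delta_ind R A).

Let pihom : star_hom pi. Proof. by case: rep. Qed.

Lemma norm_Delta_ind X : `|P X| <= 1.
Proof.
apply: cfun_normleP => // om.
by have [[_ ->]|[_ ->]] := Delta_ind_case X om; rewrite ?normr1 ?normr0.
Qed.

Lemma norm_tau m : `|tau m| <= `|m|.
Proof.
rewrite -(@ler_pXn2r _ 2)// ?nnegrE// -cnorm_star inner_norm.
by case: rep => _ _ _ _ ->; exact: pi_norm.
Qed.

Lemma rho_ker_closed : closed_ideal [set t : T | rho t = 0].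
Proof.
split=> /=.
- move=> t /= clt; apply: (@norm_eps_eq0 _ _ _ 2) => // e e0.
  have [d [d0 td]] := clt (ball t e) (nbhsx_ballx _ _ e0).
  rewrite -[rho t]subr0 -d0 -(shomB rho_hom).
  apply: le_trans (star_hom_bounded rho_hom _) _; rewrite ler_wpM2l//.
  by move: td; rewrite -ball_normE => /ltW.
- exact: (shom0 rho_hom).
- by move=> k a b a0 b0; rewrite (shomP rho_hom) a0 b0 scaler0 addr0.
- by move=> a b b0; rewrite !(shomM rho_hom) b0 cmul0l cmul0r.
Qed.

(** The elements k with this property form a closed subalgebra, and it contains
    the iM m iM(n)^* because n is the limit of its truncations. *)
Lemma K1_cutoff (k : T) : K1_hat iM k -> forall e : R[i], 0 < e -> exists X,
  forall Y, (X `<=` Y)%fset -> `|rho k - rho k ** pi (P Y)| <= e.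
Proof.
pose K := [set k : T | forall e : R[i], 0 < e -> exists X,
  forall Y, (X `<=` Y)%fset -> `|rho k - rho k ** pi (P Y)| <= e].
have pP Y : `|pi (P Y)| <= 1 by exact: le_trans (pi_norm _) (norm_Delta_ind _).
apply: (@smallest_sub _ _ _ K); last first.
  move=> _ [m [n ->]] e e0.
  have m1 : 0 < `|m| + 1 by rewrite ltr_wpDl.
  have [X hX] := Delta_ind_cvg hM n (divr_gt0 e0 m1).
  exists X => Y /hX /ltW; rewrite ler_pdivlMr// => h; apply: le_trans h.
  rewrite (shomM rho_hom) (shom_star rho_hom) !rho_iM.
  have -> : tau m ** star (tau n) - tau m ** star (tau n) ** pi (P Y)
      = tau m ** star (tau (n - lact (P Y) n)).
    case: rep => _ tl tla _ _.
    have -> : tau (n - lact (P Y) n) = tau n - pi (P Y) ** tau n.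
      by rewrite -tla addrC -scaleN1r tl scaleN1r addrC.
    by rewrite starB starM -(shom_star pihom) Delta_ind_star cmulBr mulgA.
  apply: le_trans (cnormM _ _) _; rewrite norm_star mulrC ler_pM ?norm_tau//.
  by apply: le_trans (norm_tau _) _; rewrite lerDl.
split.
- move=> t clt e e0; have e40 : 0 < e / 4 by rewrite divr_gt0.
  have e20 : 0 < e / 2 by rewrite divr_gt0.
  have e80 : 0 < e / 8 by rewrite divr_gt0.
  have [d [dK td]] := clt (ball t (e / 8)) (nbhsx_ballx _ _ e80).
  have [X hX] := dK _ e20; exists X => Y /hX h.
  have -> : rho t - rho t ** pi (P Y) = (rho (t - d) - rho (t - d) ** pi (P Y))
      + (rho d - rho d ** pi (P Y)).
    by rewrite (shomB rho_hom) cmulBl opprB addrAC !subrKA.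
  rewrite (splitr e); apply: le_trans (ler_normD _ _) _; rewrite lerD//.
  have rtd : `|rho (t - d)| <= e / 4.
    apply: le_trans (star_hom_bounded rho_hom _) _.
    have -> : e / 4 = 2 * (e / 8) by field.
    by rewrite ler_wpM2l//; move: td; rewrite -ball_normE => /ltW.
  have -> : e / 2 = e / 4 + e / 4 * 1 by field.
  apply: le_trans (ler_normB _ _) _; rewrite lerD//.
  by apply: le_trans (cnormM _ _) _; rewrite ler_pM.
- by move=> e e0; exists fset0 => Y _; rewrite (shom0 rho_hom) cmul0l subrr
  normr0 ltW.
- move=> k1 t u tK uK e e0.
  have k0 : 0 < `|k1| + 1 by rewrite ltr_wpDl.
  have [X hX] := tK _ (divr_gt0 (divr_gt0 e0 (ltr0n _ 2)) k0).
  have [Z hZ] := uK _ (divr_gt0 e0 (ltr0n _ 2)).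
  exists (X `|` Z)%fset => Y XZY.
  have h1 := hX Y (fsubset_trans (fsubsetUl X Z) XZY).
  have h2 := hZ Y (fsubset_trans (fsubsetUr X Z) XZY).
  have -> : rho (k1 *: t + u) - rho (k1 *: t + u) ** pi (P Y)
      = k1 *: (rho t - rho t ** pi (P Y)) + (rho u - rho u ** pi (P Y)).
    by rewrite (shomP rho_hom) cmulDl cscaleAl scalerBr opprD addrACA.
  rewrite (splitr e); apply: le_trans (ler_normD _ _) _; rewrite lerD// normrZ.
  move: h1; rewrite ler_pdivlMr// => h1; apply: le_trans h1.
  by rewrite mulrC ler_wpM2l// lerDl.
- move=> t u tK uK e e0.
  have k0 : 0 < `|rho t| + 1 by rewrite ltr_wpDl.
  have [X hX] := uK _ (divr_gt0 e0 k0); exists X => Y /hX;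
    rewrite ler_pdivlMr// => h.
  apply: le_trans h; rewrite (shomM rho_hom) -mulgA -cmulBr.
  by apply: le_trans (cnormM _ _) _; rewrite mulrC ler_wpM2l// lerDl.
Qed.

(** Both pi a and rho k are limits of their products with the projections
    pi (P Y), and these products coincide: k iM(chi_x) = iA(a) iM(chi_x) gives
    rho(k) S_x = pi(a) S_x. *)
Lemma redundancy_killed (t : T) : redundancy_ideal iA iM t -> rho t = 0.
Proof.
apply: (@smallest_sub _ _ _ [set t : T | rho t = 0]);
  first exact: rho_ker_closed.
move=> _ [a [k [[kK kE] aK ->]]] /=; rewrite (shomB rho_hom) rho_iA.
apply: (@norm_eps_eq0 _ _ _ (1 + 1)); first by rewrite addr_ge0.
move=> e e0.
have [X hX] := katsura_vanish hM aK e0; have [Z hZ] := K1_cutoff kK e0.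
set Y := (X `|` Z)%fset.
have same : pi a ** pi (P Y) = rho k ** pi (P Y).
  rewrite /Delta_ind (shom_sum pihom) !cmul_sumr; apply: eq_bigr => x _.
  rewrite pi_cind !mulgA; congr (_ ** _).
  by have := congr1 rho (kE (chi_cls cls x));
    rewrite !(shomM rho_hom) rho_iA rho_iM tau_chi.
have -> : pi a - rho k = pi (a - a ** P Y) - (rho k - rho k ** pi (P Y)).
  by rewrite (shomB pihom) (shomM pihom) same opprB addrA subrK.
rewrite mulrDl !mul1r; apply: le_trans (ler_normB _ _) _; rewrite lerD//.
  by apply: le_trans (pi_norm _) _; apply: hX; exact: fsubsetUl.
by apply: hZ; exact: fsubsetUr.
Qed.

End Redundancies.

(** * The crossed product *)
Section CrossedProduct.
Variables (R : realType) (G : choiceType) (A : G -> G -> bool).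
Local Notation F := (free_group G).
Local Notation Om := (OmegaA R A).
Local Notation CO := (cfun R Om).
Variables (M : correspondenceType CO) (cls : (Om -> R[i]) -> M).
Hypothesis hM : is_completion UA sigma cls.
Variables (T : cstarAlgType R) (iA : CO -> T) (iM : M -> T).
Hypothesis hT : is_toeplitz iA iM.
Variables (O : cstarAlgType R) (q : T -> O).
Hypothesis hO : is_quotient (redundancy_ideal iA iM) q.
Implicit Types (x y : G) (t : F) (a b : CO) (m n : M).
Local Notation chi_cls := (chi_cls cls).

Definition jA a : O := q (iA a).
Definition jM m : O := q (iM m).
Local Notation s x := (jM (chi_cls x)).

Lemma q_hom : star_hom q. Proof. by case: hO. Qed.

Lemma iAM_rep : representation iA iM. Proof. by case: hT. Qed.

Lemma jAM_rep : representation jA jM.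
Proof. exact: (rep_comp iAM_rep q_hom). Qed.

Lemma jA_hom : star_hom jA. Proof. by case: jAM_rep. Qed.

Lemma jM_lact a m : jM (lact a m) = jA a ** jM m.
Proof. by case: jAM_rep. Qed.

Lemma jM_ract m a : jM (ract m a) = jM m ** jA a.
Proof. by case: jAM_rep. Qed.

Lemma jM_inner m n : star (jM m) ** jM n = jA (inner m n).
Proof. by case: jAM_rep. Qed.

Lemma jA_identity : is_identity (jA 1%g).
Proof.
case: iAM_rep => ih _ il ir _.
have id1 : is_identity (iA 1%g).
  apply: (toeplitz_unit hT).
  - by rewrite -(shomM ih) mul1g.
  - by rewrite -(shom_star ih) star1.
  - by move=> a; rewrite -!(shomM ih) mul1g mulg1.
  - by move=> m; rewrite -il -ir (lact1 hM) ract1.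
move=> o; case: hO => qh /(_ o)[t <-] _.
by rewrite /jA -!(shomM qh); have [-> ->] := id1 t.
Qed.

Lemma cind_katsura x : katsura_ideal M (cind R A (gen x)).
Proof.
split=> [b bker|e e0].
  apply: cfunP => om; rewrite cfunME.
  have [ox|ox] := pselect (Delta x om); last by rewrite cind_out// mul0r.
  have := norm_lact_chi hM b ox; rewrite bker normr0 normr_le0 => /eqP ->.
  by rewrite mulr0.
exists [:: (chi_cls x, chi_cls x)] => p;
  rewrite big_seq1 /rank_one (lact_cind hM) subrr normr0.
by rewrite mulr_ge0// ltW.
Qed.

(** The pair formed by 1_x and iM(chi_x) iM(chi_x)^* is a redundancy, by
    [lact_cind], so its two members have the same image in O. *)
Lemma jA_cind x : jA (cind R A (gen x)) = s x ** star (s x).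
Proof.
case: hO => qh _ qker; apply/eqP; rewrite -subr_eq0 /jA /jM.
rewrite -(shom_star qh) -(shomM qh) -(shomB qh); apply/eqP/qker.
apply: sub_gen_smallest; exists (cind R A (gen x)), (iM (chi_cls x)
  ** star (iM (chi_cls x))).
split=> //; last exact: cind_katsura.
split; first by apply: sub_gen_smallest; exists (chi_cls x), (chi_cls x).
move=> m; case: iAM_rep => _ _ il ir ii.
by rewrite -il (lact_cind hM) ir -mulgA ii.
Qed.

Lemma Om_matrix (om : Om) x y : Delta y om -> mem_om om (gen x)^-1%g = A x y.
Proof.
move=> oy; have [om1 omR] := set_valP om.
have := omR _ _ om1 (RA_matrix R A x y); rewrite /= !ind_translate !mul1g => h.
have {h} : (mem_om om (gen x)^-1%g)%:R * (mem_om om (gen y))%:R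
    - (A x y)%:R * (mem_om om (gen y))%:R = 0 :> R[i] by exact: h.
have -> : mem_om om (gen y) by exact: oy.
move=> /eqP; rewrite !mulr1 subr_eq0 eqr_nat.
by case: (mem_om _ _); case: (A x y).
Qed.

Lemma Om_prefix (om : Om) t u : word_length (t * u)%g = (word_length t
  + word_length u)%N ->
  mem_om om (t * u)%g -> mem_om om t.
Proof.
move=> tu otu; have [om1 omR] := set_valP om.
have := omR _ _ om1 (RA_prefix R A tu); rewrite /= !ind_translate !mul1g => h.
have {h} : (mem_om om (t * u)%g)%:R * (mem_om om t)%:R
    - (mem_om om (t * u)%g)%:R = 0 :> R[i] by exact: h.
rewrite otu mul1r; case: (mem_om om t) => // /eqP.
by rewrite sub0r oppr_eq0 oner_eq0.
Qed.

Lemma cind_prefix (a : letter G) t : reduced (a :: word t) ->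
  cind R A (fg_letter a * t)%g ** cind R A (fg_letter a)
    = cind R A (fg_letter a * t)%g.
Proof.
move=> rat; apply: cfunP => om; rewrite cfunME !cind_mem.
case h : (mem_om om (fg_letter a * t)%g); last by rewrite mul0r.
rewrite (Om_prefix _ h) ?mulr1//.
by rewrite /word_length word_letterM push_cons// word_letter.
Qed.

(** At a point of [OmegaA] this is the vanishing of the function [RA_finite]. *)
Lemma finite_relation (X Y : {fset G}) :
  finite_set [set j | AXY R A X Y j != 0] ->
  (\prod_(x <- X) cind R A (gen x)^-1)%g
    ** (\prod_(y <- Y) (1%g - cind R A (gen y)^-1%g))%g
  = \sum_(j \in [set: G]) AXY R A X Y j *: cind R A (gen j).
Proof.
move=> fin; apply: cfunP => om; rewrite cfunME !cfun_prodE sum_AXY// cfun_sumE.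
rewrite -(@sum_AXY R G A (R[i]^o) (fun j => cfun_apply (cind R A (gen j)) om) X
  Y fin).
have [om1 omR] := set_valP om; have := omR _ _ om1 (RA_finite fin).
have -> : translate 1^-1%g (val om) = val om :> subsets G.
  by apply/funext => t; rewrite /translate invgK mul1g.
by move=> /eqP; rewrite subr_eq0 => /eqP.
Qed.

Local Notation O1 := (with_unit jA_identity).

Lemma gens_OA_relations : @OA_relations R G A O1 (fun x => s x : O1).
Proof.
have jh := jA_hom.
have qV x : star (s x) ** s x = jA (cind R A (gen x)^-1%g).
  by rewrite jM_inner (inner_chi_chi hM) eqxx.
split.
- move=> x; rewrite -[LHS]/(s x ** star (s x) ** s x).
  by rewrite -jA_cind -jM_lact (lact_cind_chi hM).
- move=> x y; rewrite -[LHS]/((star (s x) ** s x) ** (star (s y) ** s y)).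
  by rewrite !qV -(shomM jh) cfun_comm (shomM jh) -!qV.
- move=> x y xy; rewrite -[LHS]/(star (s x) ** s y).
  by rewrite jM_inner (inner_chi_chi hM) (negPf xy) (shom0 jh).
- move=> x y; rewrite -[LHS]/(star (s x) ** s x ** s y) qV -jM_lact.
  rewrite (lact_cls hM); last exact: chi_Cc.
  have -> : cls (fun om => cfun_apply (cind R A (gen x)^-1%g) om * chi y om)
      = ((A x y)%:R : R[i]) *: chi_cls y.
    rewrite -[RHS]addr0 -(cls0 hM) -(cls_linear hM);
      [|exact: chi_Cc|exact: Cc0].
    congr cls; apply/funext => om; rewrite addr0 cind_mem.
    have [oy|oy] := pselect (Delta y om); first by rewrite (Om_matrix _ oy).
    by rewrite chi_out// !mulr0.
  exact: (repZ jAM_rep).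
- move=> X Y fin.
  have jprod (r : seq G) (f : G -> CO) (g : G -> O1) : (forall x, g x
    = jA (f x)) ->
      (\prod_(x <- r) g x)%g = jA (\prod_(x <- r) f x)%g :> O1.
    move=> gE; elim: r => [|x r IHr]; first by rewrite !big_nil.
    by rewrite !big_cons IHr gE (shomM jh).
  rewrite (jprod X (fun x => cind R A (gen x)^-1%g)); last exact: qV.
  rewrite (jprod Y (fun x => 1%g - cind R A (gen x)^-1%g)); last first.
    by move=> x; rewrite (shomB jh) -qV.
  rewrite -[LHS](shomM jh) finite_relation// !sum_AXY// (shom_sum jh).
  by apply: eq_bigr => x _; rewrite jA_cind.
Qed.

Section Inverse.
Variables (OA : unitalCStarAlgType R) (S : G -> OA).
Hypothesis hOA : is_universal_OA A S.
Variable psi : OA -> O.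
Hypothesis psih : unital_star_hom psi.
Hypothesis psiS : forall x, psi (S x) = s x.

Let rel : OA_relations A S. Proof. by case: hOA. Qed.
Let ph : star_hom psi. Proof. by case: psih. Qed.

Lemma psi1 : psi 1%g = jA 1%g.
Proof.
case: psih => _ id1; have [h _] := jA_identity (psi 1%g).
by have [_ h'] := id1 (jA 1%g); rewrite -h -[RHS]h'.
Qed.

(** Adding a letter to t conjugates by S_x or S_x^*; on the side of O, conjugation
    by s_x and s_x^* translates functions, and no factor remains because points
    of [OmegaA] are closed under prefixes. *)
Lemma psi_elt_proj t : psi (elt_proj S t) = jA (cind R A t).
Proof.
elim/fg_ind: t => [|a t rat IHt]; first by rewrite cind1 -psi1.
have -> : elt_proj S (fg_letter a * t)%g = letter_op S a ** elt_proj S t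
  ** star (letter_op S a).
  by rewrite /elt_proj word_letterM push_cons.
rewrite -(cind_prefix rat) !(shomM ph) (shom_star ph) IHt.
case: a {rat} => x []; rewrite /letter_op /fg_letter /= ?(shom_star ph) psiS
  ?starK.
  rewrite -jM_ract -(lact_chi_cind hM) jM_lact (shomM jA_hom) jA_cind.
  by rewrite mulgA.
rewrite -mulgA -jM_lact jM_inner -[inner _ _]/(pull cls x _) (pull_cind hM).
by rewrite cfun_comm.
Qed.

(** The homomorphism rho : T -> OA given by the representation (pi, tau) satisfies
    psi rho = q on the generators, hence everywhere, and it factors through q
    since it kills the redundancies. *)
Lemma gens_isomorphism : star_isomorphism psi.
Proof.
split=> //; have [pi [pih pin picind]] := spectral_hom rel.
have [tau rep tauS] := tau_exists rel pih pin picind hM.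
have [_ Tuniv] := hT; have [rho [[rh rA rM] _]] := Tuniv _ _ _ rep.
have pig x : pi (cind R A (gen x)) = S x ** star (S x).
  by rewrite picind elt_proj_gen.
have kill := redundancy_killed pin pig hM rep tauS rh rA rM.
have psipi a : psi (pi a) = jA a.
  apply: (@dense_eq _ _ _ _ (fun a => psi (pi a)) jA 2 _ (@cyl_dense R G A OA
    S)) => //.
  - by move=> u v; rewrite (shomB pih) (shomB ph).
  - exact: (shomB jA_hom).
  - move=> v; apply: le_trans (star_hom_bounded ph _) _.
    by rewrite ler_wpM2l.
  - exact: (star_hom_bounded jA_hom).
  - move=> d [b db]; elim: db => {d b} [t|k f g b c _ fb _ gc|f g b c _ fb _
    gc].
    + by rewrite picind psi_elt_proj.
    + by rewrite (shomP pih) (shomP ph) (shomP jA_hom) fb gc.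
    + by rewrite (shomM pih) (shomM ph) (shomM jA_hom) fb gc.
have rep' := rep_comp rep ph.
have psitau m : psi (tau m) = jM m.
  apply: (@dense_eq _ _ _ [set m | exists X, lact (Delta_ind R A X) m = m]
    (fun m => psi (tau m)) jM 2) => //.
  - move=> n e e0; have [X hX] := Delta_ind_cvg hM n e0.
    exists (lact (Delta_ind R A X) n); last exact/hX/fsubset_refl.
    by exists X; rewrite -lactM Delta_ind_idem.
  - exact: (repB rep').
  - exact: (repB jAM_rep).
  - exact: (rep_bounded rep').
  - exact: (rep_bounded jAM_rep).
  - move=> d [X <-]; rewrite (lact_Delta_ind hM) (rep_sum rep) (shom_sum ph)
    (rep_sum jAM_rep).
    apply: eq_bigr => x _; case: rep => _ _ _ -> _.
    by rewrite (shomM ph) jM_ract psipi tauS psiS.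
have psirho (z : T) : psi (rho z) = q z.
  apply: (toeplitz_uniq hT (f := psi \o rho) (g := q)) => /=.
  - split=> [k a b|a b|a] /=.
    + by rewrite (shomP rh) (shomP ph).
    + by rewrite (shomM rh) (shomM ph).
    + by rewrite (shom_star rh) (shom_star ph).
  - exact: q_hom.
  - by move=> a; rewrite rA psipi.
  - by move=> m; rewrite rM psitau.
have [_ qsurj qker] := hO; have qh := q_hom.
have [lift liftK] := choice qsurj.
pose theta o := rho (lift o).
have thetaq (z : T) : theta (q z) = rho z.
  apply/eqP; rewrite -subr_eq0 -(shomB rh); apply/eqP/kill/qker.
  by rewrite (shomB qh) liftK subrr.
have thetah : star_hom theta.
  split=> [k a b|a b|a].
  - by rewrite -(liftK a) -(liftK b) -(shomP qh) !thetaq (shomP rh).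
  - by rewrite -(liftK a) -(liftK b) -(shomM qh) !thetaq (shomM rh).
  - by rewrite -(liftK a) -(shom_star qh) !thetaq (shom_star rh).
exists theta; last by move=> o; rewrite /theta psirho liftK.
have [id0 [_ uniq]] : exists! r : OA -> OA,
    [/\ star_hom r, r 1%g = 1%g & forall x, r (S x)
      = S x] by case: hOA => _; apply.
have id0E : id0 = theta \o psi.
  apply: uniq; split.
  - split=> [k c d|c d|c] /=.
    + by rewrite (shomP ph) (shomP thetah).
    + by rewrite (shomM ph) (shomM thetah).
    + by rewrite (shom_star ph) (shom_star thetah).
  - by rewrite /= psi1 thetaq rA -cind1 picind elt_proj1.
  - by move=> x; rewrite /= psiS thetaq rM tauS.
have id0_id : id0 = id by apply: uniq; split.
by move=> b; rewrite -[LHS]/((theta \o psi) b) -id0E id0_id.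
Qed.

End Inverse.
End CrossedProduct.

Theorem proposition2p13 (R : realType) (G : choiceType) (A : G -> G -> bool)
    (OA : unitalCStarAlgType R) (S : G -> OA)
    (hOA : is_universal_OA A S)
    (M : correspondenceType (cfun R (OmegaA R A)))
    (cls : (OmegaA R A -> R[i]) -> M)
    (hM : is_completion UA sigma cls)
    (T : cstarAlgType R) (iA : cfun R (OmegaA R A) -> T) (iM : M -> T)
    (hT : is_toeplitz iA iM)
    (O : cstarAlgType R) (q : T -> O)
    (hO : is_quotient (redundancy_ideal iA iM) q) :
  (exists! psi : OA -> O, unital_star_hom psi /\
     forall x : G, psi (S x) = q (iM (cls (chi x)))) /\
  (forall psi : OA -> O, unital_star_hom psi ->
     (forall x : G, psi (S x) = q (iM (cls (chi x)))) ->
     star_isomorphism psi).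
Proof.
split; last exact: (gens_isomorphism hM hT hO hOA).
have [_ univ] := hOA.
have [psi [[psih psi_one psiS] uniq]] := univ _ _ (gens_OA_relations hM hT hO).
have unit_hom (f : OA -> O) : star_hom f -> f 1%g = jA iA q 1%g ->
  unital_star_hom f.
  by move=> fh f1; split=> //; rewrite f1; exact: (jA_identity hM hT hO).
exists psi; split; first by split=> //; exact: (unit_hom _ psih psi_one).
move=> f [fh fS]; apply: uniq; split=> //; first by case: fh.
exact: (psi1 hM hT hO fh).
Qed.
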